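(* Let $f_1,f_2,\dots$ be independent random functions, each with distribution $\mathbb P_{\mathsf{PL}}$. Then almost surely the set $V=\{f_1,f_2,\dots\}$ is smoothly dense.
   Context: $C[0,1]$ is the space of continuous real functions on $[0,1]$ with the sup norm $\|\cdot\|$. The measure $\mathbb P_{\mathsf{PL}}$ on $C[0,1]$ is the law of the random function obtained as follows: let $n$ be Poisson with mean $1$, let $x_1,x_2,\dots$ be i.i.d. uniform on $[0,1]$, and let $y_0,y_1,y_2,\dots$ be i.i.d. standard normal, all independent; let $\hat x_1<\dots<\hat x_n$ be $x_1,\dots,x_n$ in increasing order (almost surely distinct); the function is the piecewise linear function whose graph consists of the line segments joining consecutively the points $(0,y_0),(\hat x_1,y_1),\dots,(\hat x_n,y_n),(1,y_{n+1})$. For $x\in\mathbb R$ let $\langle x\rangle=x-\lfloor x\rfloor$. For $f,g\in C[0,1]$, $\mathsf{cr}(f,g)=\{x\in[0,1]:\langle f(x)\rangle=\langle g(x)\rangle\}$. For finite $A,B\subseteq[0,1]$, $A\sim_\epsilon B$ means $|A|=|B|$ and, listing both in increasing order, the $i$-th elements are within $\epsilon$ for all $i$. A set $\mathcal F\subseteq C[0,1]$ is transverse if (i) the sets $\mathsf{cr}(f,g)$ are pairwise disjoint for distinct pairs of distinct elements of $\mathcal F$; and (ii) for all distinct $f,g\in\mathcal F$, $\mathsf{cr}(f,g)$ is finite, does not contain $0$ or $1$, and no $t\in\mathsf{cr}(f,g)$ is a local extremum of $f-g$. A countable $V\subseteq C[0,1]$ is smoothly dense if: (1) $V$ is dense in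 $C[0,1]$; (2) $V$ is transverse; (3) every element of $V$ is Lipschitz; (4) for every finite $\mathcal F\subseteq V$, every $f\in C[0,1]$ with $\mathcal F\cup\{f\}$ transverse and every $\epsilon>0$, there is $g\in V$ with $\|f-g\|<\epsilon$ and $\mathsf{cr}(f,h)\sim_\epsilon\mathsf{cr}(g,h)$ for all $h\in\mathcal F$.
   Formalization: In condition (4) of smooth density the comparison of cr(f,h) with cr(g,h) is required only for h in F different from f, since cr(f,f)=[0,1] is infinite and the relation is defined only for finite sets. *)

(* Defs.v *)
From HB Require Import structures.
From mathcomp Require Import all_boot all_order all_algebra finmap.
From mathcomp Require Import all_classical all_reals all_analysis.

Set Implicit Arguments.
Unset Strict Implicit.
Unset Printing Implicit Defensive.

Import Order.TTheory GRing.Theory Num.Theory.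
Import numFieldNormedType.Exports.

Local Open Scope classical_set_scope.
Local Open Scope ring_scope.

Notation I01 R := (set_type `[0%R : R, 1%R]%classic).
Notation C01 R := (continuousType (I01 R) R).

HB.instance Definition _ (R : realType) :=
  isPointed.Build (C01 R) (cst (0 : R) : C01 R).

Definition supnorm (R : realType) (h : I01 R -> R) : R :=
  sup [set `|h t| | t in [set: I01 R]].

Definition C01_open (R : realType) : set (set (C01 R)) :=
  [set U | forall f : C01 R, U f -> exists2 e : R, 0 < e &
     forall g : C01 R, supnorm (f \- g) < e -> U g].

Definition C01_borel (R : realType) := g_sigma_algebraType (@C01_open R).

Definition sigma_of (d d' : measure_display) (T : measurableType d)
    (T' : measurableType d') (X : T -> T') : set (set T) :=
  preimage_set_system [set: T] X measurable.

Definition mutually_independent (d : measure_display) (T : measurableType d)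
    (R : realType) (P : probability T R) (I : choiceType)
    (F : I -> set (set T)) : Prop :=
  forall (J : {fset I}) (E : I -> set T),
    (forall i, i \in J -> F i (E i)) ->
    P (\bigcap_(i in [set` J]) E i) = (\prod_(i <- J) P (E i))%E.

Section piecewise_linear.
Context {R : realType}.
Implicit Types (n : nat) (x y : nat -> R).

Definition knots n x : seq R := 0 :: rcons (sort <=%R (mkseq x n)) 1.

(** Union of the segments joining consecutively the points (0, y_0),
    (x^_1, y_1), ..., (x^_n, y_n), (1, y_(n+1)); the x_i of the text are
    [x 0], ..., [x n.-1]. *)
Definition polyline n x y : set (R * R) :=
  [set p | exists i, (i <= n)%N /\ exists s : R, 0 <= s <= 1 /\
     p = ((1 - s) * (knots n x)`_i + s * (knots n x)`_i.+1,
          (1 - s) * y i + s * y i.+1)].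

Definition graph (g : C01 R) : set (R * R) :=
  [set (\val t, g t) | t in [set: I01 R]].

End piecewise_linear.

Section PL_law.
Local Open Scope ereal_scope.

(** [n], the [x i] and the [y i] are the input of the construction, and [g] is
    the resulting random function; its graph is prescribed only almost surely
    because the [x i] are distinct and different from 0 and 1 only almost
    surely. *)
Definition PL_construction (R : realType) (d : measure_display)
    (T : measurableType d) (P : probability T R) (n : {RV P >-> nat})
    (x y : nat -> {RV P >-> R}) (g : {RV P >-> C01_borel R}) : Prop :=
  [/\ forall k : nat, distribution P n [set k] = (poisson_pmf 1 k)%:E,
      forall i (A : set R), measurable A ->
        distribution P (x i) A = uniform_prob (@ltr01 R) A,
      forall i (A : set R), measurable A ->
        distribution P (y i) A = normal_prob 0 1 A,
      mutually_independent P (fun j : option (nat + nat) =>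
        match j with
        | None => sigma_of n
        | Some (inl i) => sigma_of (x i)
        | Some (inr i) => sigma_of (y i)
        end) &
      {ae P, forall w,
        graph (g w) = polyline (n w) (fun i => x i w) (fun i => y i w)}].

Definition is_PL_law (R : realType) (mu : set (C01_borel R) -> \bar R) : Prop :=
  exists (d : measure_display) (T : measurableType d) (P : probability T R)
    (n : {RV P >-> nat}) (x y : nat -> {RV P >-> R})
    (g : {RV P >-> C01_borel R}),
    PL_construction n x y g /\
    forall A, measurable A -> mu A = distribution P g A.

End PL_law.

Section smoothly_dense.
Context {R : realType}.
Implicit Types (f g h : C01 R) (F V : set (C01 R)).

Definition fracpart (r : R) : R := r - (Num.floor r)%:~R.

Definition cr f g : set R :=
  [set \val t | t in [set t : I01 R | fracpart (f t) = fracpart (g t)]].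

Definition sim (e : R) (A B : set R) : Prop :=
  exists s t : seq R,
    [/\ sorted <%R s /\ A = [set` s], sorted <%R t /\ B = [set` t],
        size s = size t &
        forall i, (i < size s)%N -> `|s`_i - t`_i| <= e].

Definition local_extremum (h : I01 R -> R) (t : I01 R) : Prop :=
  (\forall u \near t, h u <= h t) \/ (\forall u \near t, h t <= h u).

Definition transverse F : Prop :=
  (forall f g h k, F f -> F g -> F h -> F k -> f <> g -> h <> k ->
     [set f; g] <> [set h; k] -> cr f g `&` cr h k = set0) /\
  (forall f g, F f -> F g -> f <> g ->
     [/\ finite_set (cr f g), ~ cr f g 0, ~ cr f g 1 &
         forall t : I01 R, cr f g (\val t) -> ~ local_extremum (f \- g) t]).

Definition lipschitz01 f : Prop :=
  exists k : R, forall s t : I01 R, `|f s - f t| <= k * `|\val s - \val t|.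

(** In the last clause [h <> f] matters only when [f] belongs to [F]: then
    cr(f, f) = [0,1] is infinite, and the relation [sim] is about finite sets. *)
Definition smoothly_dense V : Prop :=
  countable V /\
  [/\ forall f (e : R), 0 < e -> exists2 g, V g & supnorm (f \- g) < e,
      transverse V,
      forall f, V f -> lipschitz01 f &
      forall F f (e : R), finite_set F -> F `<=` V ->
        transverse (F `|` [set f]) -> 0 < e ->
        exists g, [/\ V g, supnorm (f \- g) < e &
          forall h, F h -> h <> f -> sim e (cr f h) (cr g h)]].

End smoothly_dense.

(* Main.v *)
Require Import Defs.
From HB Require Import structures.
From mathcomp Require Import all_boot all_order all_algebra finmap.
From mathcomp Require Import all_classical all_reals all_analysis.
From mathcomp Require Import measurable_realfun.
From mathcomp Require Import ring lra zify.

Set Implicit Arguments.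
Unset Strict Implicit.
Unset Printing Implicit Defensive.

Import Order.TTheory GRing.Theory Num.Theory.
Import numFieldNormedType.Exports.

Local Open Scope classical_set_scope.
Local Open Scope ring_scope.

(* Each event is reduced to explicit estimates, without product measures.

   A value [g c] of the random function is a convex combination of two
   independent normal variables, with weights depending on the abscissas only.
   Discretizing the abscissas and one of the two normals into cells, whose joint
   events are products, shows that [g c] has a bounded density. Hence for four
   functions, on a grid of mesh [1/N], the probability that [f_i = f_j] and
   [f_k = f_l] mod 1 nearly hold at a given grid point is [O(1/N^2)], and so is
   the probability that [f_i] has a kink in a given cell and nearly meets [f_j]
   there. Summing over the [N] cells, neither happens almost surely. At a
   crossing the difference [f_i - f_j] is therefore locally affine; it is not
   locally constant, since otherwise the end of a maximal interval of constancy
   would be a kink or an end point. So crossings are isolated, hence finite in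
   number, and are not local extrema.

   For the last clause, a function [f] crossing finitely many Lipschitz functions
   [h] is perturbed to a piecewise linear interpolant on the grid [i/N] which is
   pushed below [h] before each crossing and above it after (or conversely), so
   that it crosses [h] once, in a single cell, with a slope exceeding the
   Lipschitz constant. Being close to this interpolant together with its slopes
   on the middle thirds of the cells is an event of probability bounded below, so
   it occurs for some [f_i] almost surely, simultaneously for all interpolants
   with rational values. *)

(** * Functions on the unit interval *)

(** Two obstacles shape the probabilistic half. The law of [f i] is given by a construction that may
    live on another probability space, so a bound proved there reaches [f i] only through a Borel
    set of functions; crossings at an unspecified point and the equality of a graph with a polyline
    are not given as such sets. Hence probabilities are bounded through measurable supersets
    ([outer_le]), and only closed conditions on the values of a function are shown to be Borel.
    Moreover the Lipschitz constant of a polyline is random, so no mesh suits all outcomes: a bound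
    [L] is fixed, the mesh tends to 0, and only then is the countable union over [L] taken.

    Two distinct pairs of indices may share an index. What matters is one index outside the three
    others: given the cells of the other three functions at a grid point, the second near crossing
    confines the value of that function alone, which gives the second factor [1/N]. *)

Lemma clamp01_subproof (R : realType) (x : R) :
  Num.min 1 (Num.max 0 x) \in `[0%R : R, 1%R]%classic.
Proof.
apply/mem_set; rewrite /= in_itv /= ge_min lexx /= andbT.
by rewrite le_min ler01 le_max lexx.
Qed.

Definition clamp01 (R : realType) (x : R) : I01 R :=
  exist (fun y => y \in `[0%R : R, 1%R]%classic) _ (clamp01_subproof x).

Lemma val_clamp01 (R : realType) (x : R) : 0 <= x <= 1 -> \val (clamp01 x) = x.
Proof. by move=> /andP[x0 x1] /=; rewrite max_r// min_r. Qed.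

Lemma I01_bound (R : realType) (t : I01 R) : 0 <= \val t <= 1.
Proof. by case: t => t /= /set_mem; rewrite /= in_itv. Qed.

Lemma clamp01_val (R : realType) (t : I01 R) : clamp01 (\val t) = t.
Proof. by apply: val_inj; rewrite val_clamp01// I01_bound. Qed.

(** Extends [g] to the line by its end values. The extension is continuous everywhere, so the
    intermediate and extreme value theorems apply to it on real intervals. *)
Definition ev (R : realType) (g : C01 R) (x : R) : R := g (clamp01 x).

Lemma ev_val (R : realType) (g : C01 R) (t : I01 R) : ev g (\val t) = g t.
Proof. by rewrite /ev clamp01_val. Qed.

Lemma continuous_clamp01 (R : realType) : continuous (@clamp01 R).
Proof.
apply: continuous_comp_initial => x.
apply: (@continuous_min R R (cst 1) (fun x => Num.max 0 x)).
  exact: cst_continuous.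
by apply: (@continuous_max R R (cst 0) id); [exact: cst_continuous|exact: cvg_id].
Qed.

Lemma continuous_ev (R : realType) (g : C01 R) : continuous (ev g).
Proof.
move=> x; apply: continuous_comp; first exact: continuous_clamp01.
exact: cts_fun.
Qed.

Lemma ev_cont (R : realType) (g : C01 R) (x e : R) : 0 < e ->
  exists2 d : R, 0 < d & forall y, `|y - x| < d -> `|ev g y - ev g x| < e.
Proof.
move=> e0; have /cvgrPdist_lt /(_ e e0) := @continuous_ev R g x.
move=> /nbhs_ballP[d /= d0 H]; exists d => // y yx.
by rewrite distrC; apply: H; rewrite /ball /= distrC.
Qed.

(** Compactness of the segment in its near-covering form, for the filter of right neighbourhoods of
    0: smallness of [e] that is locally uniform in the point is globally uniform. *)
Lemma compact01_unif (R : realType) (Q : R -> R -> Prop) :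
  (forall x, 0 <= x <= 1 -> exists2 d : R, 0 < d & forall y e,
     0 <= y <= 1 -> `|y - x| < d -> 0 < e < d -> Q e y) ->
  exists2 d : R, 0 < d & forall x e, 0 <= x <= 1 -> 0 < e < d -> Q e x.
Proof.
move=> H.
have /compact_near_coveringP := @segment_compact R 0 1.
move=> /(_ R (0^'+) (fun e x => 0 <= x <= 1 -> Q e x)) [].
  move=> x /=; rewrite in_itv /= => /H[d d0 {}H].
  exists (ball x d, [set e | 0 < e < d]) => /=.
    split; first exact: nbhsx_ballx.
    near=> e => /=; apply/andP; split; near: e; first exact: nbhs_right_gt.
    exact: nbhs_right_lt.
  move=> [y e] [/= yx ed] y01; apply: H => //.
  by move: yx; rewrite /ball /= distrC.
move=> d /= d0 {}H; exists d => // x e x01 /andP[e0 ed].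
by apply: H => //; rewrite /ball_ /= ?sub0r ?normrN ?gtr0_norm// in_itv.
Unshelve. all: by end_near. Qed.

Lemma ev_unif_cont (R : realType) (g : C01 R) (e : R) : 0 < e ->
  exists2 d : R, 0 < d & forall x y, 0 <= x <= 1 -> 0 <= y <= 1 -> `|x - y| < d ->
    `|ev g x - ev g y| < e.
Proof.
move=> e0.
have [|d d0 H] := @compact01_unif R (fun d x => forall y, 0 <= y <= 1 ->
    `|x - y| < d -> `|ev g x - ev g y| < e).
  move=> x x01; have [d d0 H] := @ev_cont R g x (e / 2) ltac:(by rewrite divr_gt0).
  exists (d / 2) => [|y r y01 yx /andP[r0 rd] z z01 yz]; first by rewrite divr_gt0.
  have {}H w : `|w - x| < d -> - (e / 2) < ev g w - ev g x < e / 2.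
    by move=> /H; rewrite ltr_norml.
  have /H/andP[? ?] : `|y - x| < d by lra.
  have /H/andP[? ?] : `|z - x| < d.
    by move: yx yz; rewrite !ltr_norml => /andP[? ?] /andP[? ?]; apply/andP; split; lra.
  by rewrite ltr_norml; apply/andP; split; lra.
exists (d / 2) => [|x y x01 y01 xy]; first by rewrite divr_gt0.
apply: (H x (d / 2)) => //; apply/andP; split; lra.
Qed.

Lemma ev_bounded (R : realType) (g : C01 R) :
  exists M : R, forall t : I01 R, `|g t| <= M.
Proof.
have cg : {within `[0, 1], continuous (fun x => `|ev g x|)}.
  apply: continuous_subspaceT => x; apply: continuous_comp; first exact: continuous_ev.
  exact: norm_continuous.
have [c _ H] := EVT_max ler01 cg.
exists `|ev g c| => t; rewrite -ev_val; apply: H.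
by rewrite in_itv /= I01_bound.
Qed.

Lemma le_supnorm (R : realType) (f g : C01 R) (t : I01 R) :
  `|f t - g t| <= supnorm (f \- g).
Proof.
apply: ub_le_sup; last by exists t.
have [M fM] := ev_bounded f; have [N gN] := ev_bounded g.
exists (M + N) => _ [s _ <-] /=; apply: (le_trans (ler_normB _ _)).
exact: lerD.
Qed.

Lemma supnorm_le (R : realType) (f g : C01 R) (e : R) :
  (forall t, `|f t - g t| <= e) -> supnorm (f \- g) <= e.
Proof.
move=> H; apply: ge_sup => [|_ [s _ <-]]; last exact: H.
by exists (`|f (clamp01 0) - g (clamp01 0)|), (clamp01 0).
Qed.

Lemma fracpart_eqP (R : realType) (a b : R) :
  fracpart a = fracpart b <-> exists m : int, a - b = m%:~R.
Proof.
rewrite /fracpart; split=> [ab|[m abm]].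
  exists (Num.floor a - Num.floor b); rewrite rmorphB /=; lra.
have -> : a = b + m%:~R by lra.
by rewrite floorDrz ?intr_int// rmorphD /= intrKfloor; lra.
Qed.

Lemma crP (R : realType) (f g : C01 R) (x : R) :
  cr f g x <-> 0 <= x <= 1 /\ exists m : int, ev f x - ev g x = m%:~R.
Proof.
split=> [[t /= /fracpart_eqP H <-]|[x01 H]].
  by rewrite !ev_val; split => //; exact: I01_bound.
by exists (clamp01 x); [apply/fracpart_eqP|exact: val_clamp01].
Qed.

(** The value [c = N.+1] occurs only for [x = 1]. *)
Lemma grid_cell (R : realType) (N : nat) (x : R) : 0 <= x <= 1 ->
  exists2 c, (c <= N.+1)%N & 0 <= x - c%:R / N.+1%:R < N.+1%:R^-1.
Proof.
move=> /andP[x0 x1]; have N0 : 0 < N.+1%:R :> R by [].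
exists (Num.truncn (x * N.+1%:R)).
  rewrite truncn_le_nat (@le_lt_trans _ _ N.+1%:R) ?ltr_nat//.
  by rewrite ler_piMl.
have := @truncn_itv R (x * N.+1%:R); rewrite mulr_ge0//= => /(_ isT)/andP[l u].
rewrite subr_ge0 ler_pdivrMr// l /= ltrBlDr -[X in _ < X + _]mul1r -mulrDl.
by rewrite ltr_pdivlMr// nat1r.
Qed.

Lemma exists_natSinv_lt (R : realType) (d : R) : 0 < d ->
  exists N : nat, N.+1%:R^-1 < d.
Proof.
move=> d0; have [N _ NH] := @near_infty_natSinv_lt R (PosNum d0).
by exists N; apply: (NH N); rewrite /= leqnn.
Qed.

(** By compactness one radius [d] isolates everywhere, so on a grid of mesh less than [d / 2] each
    grid point accounts for at most one element of [A]. *)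
Lemma isolated_finite (R : realType) (A : set R) : A `<=` `[0, 1] ->
  (forall x, 0 <= x <= 1 -> exists2 d : R, 0 < d &
     forall y, A y -> `|y - x| < d -> y = x) -> finite_set A.
Proof.
move=> A01 H.
have [|d d0 {}H] := @compact01_unif R (fun e x =>
    exists z, forall y, A y -> `|y - x| < e -> y = z).
  move=> x /H[d d0 {}H]; exists (d / 2) => [|y e y01 yx /andP[e0 ed]].
    by rewrite divr_gt0.
  exists x => z Az zy; apply: H => //.
  by move: yx zy; rewrite !ltr_norml => /andP[? ?] /andP[? ?]; apply/andP; split; lra.
have [N Nd] := exists_natSinv_lt (divr_gt0 d0 (ltr0Sn R 1)).
have N0 : 0 < N.+1%:R :> R by [].
have /choice[z zH] : forall c : 'I_N.+2, exists z, forall y, A y ->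
    `|y - c%:R / N.+1%:R| < d / 2 -> y = z.
  move=> c; apply: H; last by apply/andP; split; lra.
  by rewrite divr_ge0 ?ler0n// ler_pdivrMr// mul1r ler_nat -ltnS ltn_ord.
apply: (@sub_finite_set _ _ [set z c | c in [set: 'I_N.+2]]); last first.
  exact: finite_image.
move=> y Ay; have := A01 _ Ay; rewrite /= in_itv /= => /andP[y0 y1].
have [|c cN /andP[? ?]] := @grid_cell R N y; first by rewrite y0.
exists (Ordinal (cN : (c < N.+2)%N)) => //; apply/esym/zH => //=.
by rewrite ger0_norm//; apply: lt_trans Nd.
Qed.

(** * Crossings of locally affine functions *)

Lemma intr_dist_lt1 (R : realType) (m n : int) :
  `|m%:~R - n%:~R : R| < 1 -> m = n.
Proof.
by rewrite -rmorphB /= -intr_norm -[1]/(1%:~R) ltr_int => H; lia.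
Qed.

Lemma exists_min2 (R : realType) (a b : R) : 0 < a -> 0 < b ->
  exists r : R, [/\ 0 < r, r <= a & r <= b].
Proof.
move=> a0 b0; exists (Num.min a b); split; first by rewrite lt_min a0.
  by rewrite ge_min lexx.
by rewrite ge_min lexx orbT.
Qed.

Lemma exists_min3 (R : realType) (a b c : R) : 0 < a -> 0 < b -> 0 < c ->
  exists r : R, [/\ 0 < r, r <= a, r <= b & r <= c].
Proof.
move=> a0 b0 c0; have [r [r0 ra rb]] := exists_min2 a0 b0.
have [q [q0 qr qc]] := exists_min2 r0 c0.
by exists q; split=> //; [exact: le_trans ra|exact: le_trans rb].
Qed.

(** Collinearity of any three points of the graph, written without division so that it is a closed
    condition on [g]. The window may stick out of [0,1]. *)
Definition affine_on (R : realType) (g : C01 R) (a b : R) : Prop :=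
  forall x y z : I01 R, a <= \val x <= b -> a <= \val y <= b ->
    a <= \val z <= b ->
    (g y - g x) * (\val z - \val x) = (g z - g x) * (\val y - \val x).

Lemma affine_on_slope (R : realType) (g : C01 R) (t e : R) : 0 < t < 1 ->
  0 < e -> affine_on g (t - e) (t + e) ->
  exists r s : R, [/\ 0 < r, 0 < t - r, t + r < 1 &
    forall x, `|x - t| <= r -> ev g x = ev g t + s * (x - t)].
Proof.
move=> /andP[t0 t1] e0 ag.
have [||r [r0 re rt r1]] := @exists_min3 R _ (t / 2) ((1 - t) / 2) e0; [lra|lra|].
exists r, ((ev g (t + r) - ev g t) / r); split=> //; [lra|lra|].
move=> x; rewrite ler_norml => /andP[x1 x2].
have inI y : t - r <= y <= t + r -> \val (clamp01 y) = y /\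
    t - e <= \val (clamp01 y) <= t + e.
  move=> /andP[? ?]; have -> : \val (clamp01 y) = y.
    by rewrite val_clamp01//; apply/andP; split; lra.
  by split=> //; apply/andP; split; lra.
have [vt it] := inI t ltac:(apply/andP; split; lra).
have [vx ix] := inI x ltac:(apply/andP; split; lra).
have [vr ir] := inI (t + r) ltac:(apply/andP; split; lra).
have := ag _ _ _ it ix ir; rewrite vt vx vr -/(ev g t) -/(ev g x) -/(ev g _).
rewrite (_ : t + r - t = r); last by ring.
move=> /(canRL (mulfK (lt0r_neq0 r0))) H.
by rewrite -[LHS](subrK (ev g t)) H; field; exact: lt0r_neq0.
Qed.

(** The almost sure information on a pair of polylines from which the second clause of
    transversality follows deterministically. *)
Definition regular_crossings (R : realType) (f g : C01 R) : Prop :=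
  [/\ ~ cr f g 0, ~ cr f g 1 & forall t, cr f g t ->
    exists2 e : R, 0 < e & affine_on f (t - e) (t + e) /\ affine_on g (t - e) (t + e)].

Lemma crossing_slope0 (R : realType) (f g : C01 R) (t : R) :
  regular_crossings f g -> cr f g t ->
  exists r s : R, [/\ 0 < r, 0 < t - r, t + r < 1 & forall x, `|x - t| <= r ->
    ev f x - ev g x = ev f t - ev g t + s * (x - t)].
Proof.
move=> [n0 n1 H] crt; have [/andP[t0 t1] _] := (crP f g t).1 crt.
have t01 : 0 < t < 1.
  rewrite !lt_neqAle t0 t1 !andbT; apply/andP; split.
    by apply/eqP => t_eq; rewrite -t_eq in crt.
  by apply/eqP => t_eq; rewrite t_eq in crt.
have [e e0 [af ag]] := H _ crt.
have [r [s [r0 r1 r2 rs]]] := affine_on_slope t01 e0 af.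
have [q [u [q0 q1 q2 qu]]] := affine_on_slope t01 e0 ag.
exists (Num.min r q), (s - u); split.
- by rewrite lt_min r0.
- by have : Num.min r q <= r by [rewrite ge_min lexx]; lra.
- by have : Num.min r q <= r by [rewrite ge_min lexx]; lra.
- by move=> x; rewrite le_min => /andP[/rs -> /qu ->]; ring.
Qed.

Lemma crossing_slope (R : realType) (f g : C01 R) (t : R) :
  regular_crossings f g -> cr f g t ->
  exists r s : R, [/\ 0 < r, s != 0, 0 < t - r, t + r < 1 & forall x, `|x - t| <= r ->
    ev f x - ev g x = ev f t - ev g t + s * (x - t)].
Proof.
move=> reg crt; have [r [s [r0 r1 r2 rs]]] := crossing_slope0 reg crt.
exists r, s; split=> //; apply/eqP => s0.
pose D x := ev f x - ev g x; pose m := D t.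
pose S := [set u | t <= u <= 1 /\ forall x, t <= x <= u -> D x = m].
have Str : S (t + r).
  split=> [|x /andP[x1 x2]]; first by apply/andP; split; lra.
  rewrite /m /D rs ?s0 ?mul0r ?addr0//; rewrite ger0_norm; lra.
have Sub : has_sup S.
  by split; [exists (t + r)|exists 1 => u [/andP[_ ?] _]].
pose u := sup S.
have tru : t + r <= u by apply: sup_upper_bound.
have u1 : u <= 1 by apply: ge_sup => [|v [/andP[_ ?] _] //]; exists (t + r).
have below x : t <= x < u -> D x = m.
  move=> /andP[tx xu]; have xu' : 0 < u - x by rewrite subr_gt0.
  have [v [/andP[tv v1] Sv] uv] := sup_adherent xu' Sub.
  by apply: Sv; rewrite tx /=; move: uv; rewrite /u opprB addrC subrK => /ltW.
have Du : D u = m.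
  apply/eqP; rewrite -subr_eq0 -normr_le0; apply/ler_addgt0Pl => e e0; rewrite addr0.
  have e20 : 0 < e / 2 by rewrite divr_gt0.
  have [d1 d10 H1] := ev_cont f u e20; have [d2 d20 H2] := ev_cont g u e20.
  have [d [d0 dd1 dd2 dr]] := exists_min3 d10 d20 r0.
  have <- : D (u - d / 2) = m by apply: below; apply/andP; split; lra.
  have dist : `|u - d / 2 - u| < d by rewrite addrAC subrr sub0r normrN gtr0_norm; lra.
  have := H1 _ (lt_le_trans dist dd1); have := H2 _ (lt_le_trans dist dd2).
  rewrite !ltr_norml /D ler_norml => /andP[? ?] /andP[? ?]; apply/andP; split; lra.
(* The supremum [u] is itself a crossing, hence [u < 1] and the difference is affine around [u];
   being constant on the left of [u] it has slope 0 there, so [S] reaches beyond its supremum. *)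
have cru : cr f g u.
  apply/crP; split; first by have [/andP[? ?] _] := (crP f g t).1 crt; apply/andP; split; lra.
  have [_ [k kE]] := (crP f g t).1 crt; exists k; rewrite -kE; exact: Du.
have [q [v [q0 q1 q2 qv]]] := crossing_slope0 reg cru.
have [d [d0 dq dr]] := exists_min2 q0 r0.
have v0 : v = 0.
  have := below (u - d) ltac:(apply/andP; split; lra).
  rewrite /D qv; last by rewrite addrAC subrr sub0r normrN gtr0_norm.
  rewrite (Du : ev f u - ev g u = m) => Hd.
  have /eqP : v * d = 0 by lra.
  by rewrite mulf_eq0 (gt_eqF d0) orbF => /eqP.
have : S (u + q).
  split=> [|x /andP[x1 x2]]; first by apply/andP; split; lra.
  have [xu|ux] := ltP x u; first by apply: below; rewrite x1.
  rewrite /D qv ?v0 ?mul0r ?addr0//; rewrite ger0_norm; lra.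
move=> /(ub_le_sup Sub.2); rewrite -/u; lra.
Qed.

Lemma nbhs_I01P (R : realType) (t : I01 R) (Q : I01 R -> Prop) :
  (\forall u \near t, Q u) <->
  exists2 d : R, 0 < d & forall u, `|\val u - \val t| < d -> Q u.
Proof.
split=> [/nbhs_ballP[d /= d0 H]|[d d0 H]].
  exists d => // u ut; apply: H.
  have : ball (\val t) d (\val u) by rewrite /ball /= distrC.
  by [].
apply/nbhs_ballP; exists d => //= u ut; apply: H.
by have : ball (\val t) d (\val u) := ut; rewrite /ball /= distrC.
Qed.

(** A nonzero slope gives increments [s * h] and [- (s * h)] at points arbitrarily close to [t]; an
    extremum would force both to vanish. *)
Lemma regular_no_extremum (R : realType) (f g : C01 R) (t : I01 R) :
  regular_crossings f g -> cr f g (\val t) -> ~ local_extremum (f \- g) t.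
Proof.
move=> reg crt; have [r [s [r0 s0 r1 r2 rs]]] := crossing_slope reg crt.
have ext (u : I01 R) : `|\val u - \val t| <= r ->
    f u - g u - (f t - g t) = s * (\val u - \val t).
  by move=> /rs; rewrite !ev_val => ->; ring.
have pts (d : R) : 0 < d -> exists h : R, exists u v : I01 R, [/\ 0 < h,
    `|\val u - \val t| < d, `|\val v - \val t| < d,
    f u - g u - (f t - g t) = s * h & f v - g v - (f t - g t) = - (s * h)].
  move=> d0; have [h [h0 hd hr]] := exists_min2 (divr_gt0 d0 (ltr0Sn R 1)) r0.
  exists h, (clamp01 (\val t + h)), (clamp01 (\val t - h)).
  have vu : \val (clamp01 (\val t + h)) - \val t = h.
    rewrite (@val_clamp01 R (\val t + h)); first by move: (\val t) => t'; ring.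
    by move: (\val t) r1 r2 hr h0 => t'; clear; move=> *; apply/andP; split; lra.
  have vv : \val (clamp01 (\val t - h)) - \val t = - h.
    rewrite (@val_clamp01 R (\val t - h)); first by move: (\val t) => t'; ring.
    by move: (\val t) r1 r2 hr h0 => t'; clear; move=> *; apply/andP; split; lra.
  split=> //.
  - by rewrite vu gtr0_norm//; clear -h0 hd; lra.
  - by rewrite vv normrN gtr0_norm//; clear -h0 hd; lra.
  - by rewrite ext vu// gtr0_norm.
  - by rewrite ext vv ?normrN ?gtr0_norm// mulrN.
case=> /nbhs_I01P[d d0 H]; have [h [u [v [h0 ud vd uE vE]]]] := pts d d0.
  have /= Hu := H _ ud; have /= Hv := H _ vd.
  have : s * h = 0 by clear -Hu Hv uE vE; lra.
  by apply/eqP; rewrite mulf_neq0// gt_eqF.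
have /= Hu := H _ ud; have /= Hv := H _ vd.
have : s * h = 0 by clear -Hu Hv uE vE; lra.
by apply/eqP; rewrite mulf_neq0// gt_eqF.
Qed.

(** The difference at [x] lies strictly between two consecutive integers, at distance at least
    [2 * e] from both. Each function moves by less than [e / 2] near [x], which leaves a distance
    [e] to every integer. *)
Lemma not_cr_near (R : realType) (f g : C01 R) (x : R) : 0 <= x <= 1 ->
  ~ cr f g x -> exists2 d : R, 0 < d & forall y e (m : int), `|y - x| < d ->
    0 < e < d -> e <= `|ev f y - ev g y - m%:~R|.
Proof.
move=> x01 ncr; pose D x := ev f x - ev g x; pose m := Num.floor (D x).
have mD : m%:~R < D x < (m + 1)%:~R.
  rewrite floorD1_gt ?num_real// andbT lt_neqAle floor_le_tmp ?num_real// andbT.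
  by apply/eqP => mE; apply: ncr; apply/crP; split => //; exists m.
have mD1 : m%:~R + 1 = (m + 1)%:~R :> R by rewrite rmorphD.
move/andP: mD => [l u].
pose e : R := Num.min (D x - m%:~R) ((m + 1)%:~R - D x) / 2.
have [e1 e2] : e * 2 <= D x - m%:~R /\ e * 2 <= (m + 1)%:~R - D x.
  by rewrite /e divfK ?pnatr_eq0//; split; rewrite ge_min lexx ?orbT.
have e0 : 0 < e by rewrite divr_gt0// lt_min !subr_gt0 l.
have e20 : 0 < e / 2 by rewrite divr_gt0.
have [d1 d10 H1] := ev_cont f x e20; have [d2 d20 H2] := ev_cont g x e20.
exists (Num.min e (Num.min d1 d2)) => [|y r k]; first by rewrite !lt_min e0 d10.
rewrite !lt_min => /and3P[_ /H1 + /H2 +] /and4P[r0 re _ _].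
rewrite !ltr_norml => /andP[? ?] /andP[? ?].
have Dy : m%:~R + e < D y < (m + 1)%:~R - e.
  by rewrite /D in e1 e2 *; apply/andP; split; lra.
have [km|mk] := leP k m.
  have km' : k%:~R <= m%:~R :> R by rewrite ler_int.
  by rewrite -/(D y) ger0_norm; move/andP: Dy => [? ?]; lra.
have mk' : (m + 1)%:~R <= k%:~R :> R by rewrite ler_int lezD1.
by rewrite -/(D y) ler0_norm; move/andP: Dy => [? ?]; lra.
Qed.

Lemma regular_finite (R : realType) (f g : C01 R) :
  regular_crossings f g -> finite_set (cr f g).
Proof.
move=> reg; apply: isolated_finite => [x /crP[x01 _]|x x01].
  by rewrite /= in_itv.
have [crx|ncr] := pselect (cr f g x); last first.
  have [d d0 H] := not_cr_near x01 ncr; exists d => // y /crP[_ [m mE]] yx.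
  have := H y (d / 2) m yx ltac:(apply/andP; split; lra).
  by rewrite mE subrr normr0; lra.
have [r [s [r0 s0 r1 r2 rs]]] := crossing_slope reg crx.
have ns0 : 0 < `|s| by rewrite normr_gt0.
(* Within [|s|^-1] of [x] the difference moves by less than 1. If it is again an integer, it is the
   same one, and the nonzero slope forces [y = x]. *)
exists (Num.min r (`|s|^-1)) => [|y]; first by rewrite lt_min r0 invr_gt0.
move=> /crP[_ [m mE]]; rewrite lt_min => /andP[yr ys].
have [_ [k kE]] := (crP f g x).1 crx.
have := rs _ (ltW yr); rewrite mE kE => mk.
have := @intr_dist_lt1 R m k; rewrite mk addrAC subrr add0r normrM.
rewrite -ltr_pdivlMl// mulr1 => /(_ ys) mk'.
move: mk; rewrite mk' -[LHS]addr0 => /addrI/esym/eqP.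
by rewrite mulf_eq0 (negbTE s0) subr_eq0 => /eqP.
Qed.

(** * Approximation with prescribed crossings *)

Lemma convex_mono (R : realType) (l a b c d : R) : 0 <= l <= 1 ->
  a <= c -> b <= d -> (1 - l) * a + l * b <= (1 - l) * c + l * d.
Proof.
by move=> /andP[l0 l1] ac bd; rewrite lerD// ler_wpM2l// subr_ge0.
Qed.

Lemma convex_idem (R : realType) (l c : R) : (1 - l) * c + l * c = c.
Proof. by ring. Qed.

Lemma convex_dist (R : realType) (l a b c e : R) : 0 <= l <= 1 ->
  `|a - c| <= e -> `|b - c| <= e -> `|(1 - l) * a + l * b - c| <= e.
Proof.
move=> l01; rewrite !ler_distl => /andP[a1 a2] /andP[b1 b2].
rewrite -[c - e](convex_idem l) -[c + e](convex_idem l).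
by rewrite !convex_mono.
Qed.

Lemma segment_cell (R : realType) (k : nat) (x : R) : 0 <= x <= 1 ->
  exists i : nat, exists l : R,
    [/\ (i <= k)%N, 0 <= l <= 1 & x = (i%:R + l) / k.+1%:R].
Proof.
move=> x01; have n0 : 0 < k.+1%:R :> R by [].
have [c ck /andP[c0 c1]] := @grid_cell R k x x01.
have [ck'|ck'] := leqP c k; last first.
  have cE : c = k.+1 by apply/eqP; rewrite eqn_leq ck.
  exists k, 1; rewrite leqnn ler01 lexx; split => //.
  rewrite natr1 divff ?gt_eqF//; move: c0; rewrite cE divff ?gt_eqF//.
  by move: x01 => /andP[_ x1] x1'; apply/eqP; rewrite eq_le x1 -subr_ge0.
exists c, (k.+1%:R * x - c%:R); split=> //; last first.
  by rewrite addrC subrK mulrAC divff ?mul1r ?gt_eqF.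
rewrite (_ : _ - _ = k.+1%:R * (x - c%:R / k.+1%:R)); last first.
  by rewrite mulrBr mulrCA divff ?mulr1 ?gt_eqF.
by rewrite mulr_ge0 ?ler0n//= -ler_pdivlMl// mulr1 ltW.
Qed.

Lemma cell_in01 (R : realType) (k i : nat) (l : R) : (i <= k)%N ->
  0 <= l <= 1 -> 0 <= (i%:R + l) / k.+1%:R <= 1.
Proof.
move=> ik /andP[l0 l1]; rewrite divr_ge0 ?addr_ge0//= ler_pdivrMr// mul1r.
by rewrite -natr1 lerD// ler_nat.
Qed.

Lemma const_sign (R : realType) (u : R -> R) (a b : R) : continuous u ->
  (forall x, a < x < b -> u x != 0) ->
  (forall x, a < x < b -> 0 < u x) \/ (forall x, a < x < b -> u x < 0).
Proof.
move=> cu u0; apply: contrapT => /not_orP[/existsNP[x /not_implyP[xab ux]]].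
move=> /existsNP[y /not_implyP[yab uy]].
have {}ux : u x < 0.
  by rewrite lt_neqAle u0//=; move/negP: ux; rewrite -leNgt.
have {}uy : 0 < u y.
  by rewrite lt_neqAle eq_sym u0//=; move/negP: uy; rewrite -leNgt.
have cuw c d : {within `[c, d], continuous u} by apply: continuous_subspaceT.
have [xy|yx] := leP x y.
  have [|c] := @IVT R u x y 0 xy (cuw x y).
    by rewrite ge_min le_max (ltW ux) (ltW uy) orbT.
  rewrite in_itv /= => /andP[xc cy] /eqP; apply/negP/u0.
  by move: xab yab => /andP[? ?] /andP[? ?]; apply/andP; split; lra.
have [|c] := @IVT R u y x 0 (ltW yx) (cuw y x).
  by rewrite ge_min le_max (ltW ux) (ltW uy) orbT.
rewrite in_itv /= => /andP[xc cy] /eqP; apply/negP/u0.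
by move: xab yab => /andP[? ?] /andP[? ?]; apply/andP; split; lra.
Qed.

Lemma finite_uniform (R : realType) (T : choiceType) (A : set T)
    (Q : T -> R -> Prop) : finite_set A ->
  (forall a, A a -> exists2 d : R, 0 < d & forall e, 0 < e <= d -> Q a e) ->
  exists2 d : R, 0 < d & forall a e, A a -> 0 < e <= d -> Q a e.
Proof.
move=> /finite_seqP[s ->]; elim: s => [|x s IH] H.
  by exists 1 => // a e; rewrite /= in_nil.
have [a /= as_|d d0 Hd] := IH; first by apply: H; rewrite /= in_cons as_ orbT.
have [|d' d'0 Hd'] := H x; first by rewrite /= mem_head.
have [r [r0 rd rd']] := exists_min2 d0 d'0.
exists r => // a e; rewrite /= in_cons => /orP[/eqP ->|as_] /andP[e0 er].
  by apply: Hd'; rewrite e0 (le_trans er).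
by apply: Hd => //; rewrite e0 (le_trans er).
Qed.

Lemma finite_isolated (R : realType) (A : set R) (t : R) : finite_set A ->
  exists2 d : R, 0 < d & forall y, A y -> y != t -> d <= `|y - t|.
Proof.
move=> fA.
have [|d d0 H] := @finite_uniform R R A (fun y e => y != t -> e <= `|y - t|) fA.
  move=> y Ay; have [->|yt] := eqVneq y t.
    by exists 1.
  by exists `|y - t| => [|e /andP[]//]; rewrite normr_gt0 subr_eq0.
by exists d => // y Ay; apply: H => //; rewrite d0 lexx.
Qed.

(** [sg] is 1 or -1, the direction in which [f - h] passes through its value at [t]. Weak
    inequalities suffice, since the perturbation of [f] later makes them strict. *)
Definition sign_change (R : realType) (f h : C01 R) (t sg r : R) : Prop :=
  [/\ 0 < t - r, t + r < 1 & forall x, `|x - t| < r ->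
    (x <= t -> sg * (ev f x - ev h x - (ev f t - ev h t)) <= 0) /\
    (t <= x -> 0 <= sg * (ev f x - ev h x - (ev f t - ev h t)))].

Lemma sign_changeS (R : realType) (f h : C01 R) (t sg r r' : R) :
  r' <= r -> sign_change f h t sg r -> sign_change f h t sg r'.
Proof.
move=> rr' [? ? H]; split; [lra|lra|] => x xt; apply: H.
exact: lt_le_trans rr'.
Qed.

(** Crossings being finite in number, [f - h - m] has no other zero near [t] and keeps a sign on
    each side. Equal signs would make [t] a local extremum. *)
Lemma crossing_sign_change (R : realType) (f h : C01 R) (t : R) :
  finite_set (cr f h) -> ~ cr f h 0 -> ~ cr f h 1 ->
  (forall t : I01 R, cr f h (\val t) -> ~ local_extremum (f \- h) t) ->
  cr f h t -> exists2 sg : R, sg = 1 \/ sg = -1 &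
    exists2 r : R, 0 < r & sign_change f h t sg r.
Proof.
move=> fin n0 n1 next crt; have [/andP[t0 t1] [m mE]] := (crP f h t).1 crt.
have {}t0 : 0 < t by rewrite lt_neqAle t0 andbT; apply/eqP => te; rewrite -te in crt.
have {}t1 : t < 1 by rewrite lt_neqAle t1 andbT; apply/eqP => te; rewrite te in crt.
have [d d0 iso] := finite_isolated t fin.
have [||r [r0 rd rt r1]] := @exists_min3 R d (t / 2) ((1 - t) / 2) d0; [lra|lra|].
pose u x := ev f x - ev h x - m%:~R.
have cu : continuous u.
  move=> x; apply: cvgB; last exact: cvg_cst.
  by apply: cvgB; exact: continuous_ev.
have u0 x : `|x - t| < r -> x != t -> u x != 0.
  move=> xr xt; apply/negP; rewrite subr_eq0 => /eqP uE.
  have crx : cr f h x.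
    apply/crP; split; last by exists m.
    by move: xr; rewrite ltr_norml => /andP[? ?]; apply/andP; split; lra.
  by have := iso _ crx xt; rewrite leNgt (lt_le_trans xr rd).
have ut : u t = 0 by rewrite /u mE subrr.
have tv : \val (clamp01 t) = t by rewrite val_clamp01// !ltW.
have {}next : ~ (forall x, `|x - t| < r -> u x <= 0) /\
              ~ (forall x, `|x - t| < r -> 0 <= u x).
  have := next (clamp01 t); rewrite tv => /(_ crt)/not_orP[N1 N2]; split=> H.
    apply: N1; apply/nbhs_I01P; exists r => // w; rewrite tv => /H.
    by rewrite /u ev_val /= -/(ev f t) -/(ev h t) mE ev_val subr_le0.
  apply: N2; apply/nbhs_I01P; exists r => // w; rewrite tv => /H.
  by rewrite /u ev_val /= -/(ev f t) -/(ev h t) mE ev_val subr_ge0.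
have nbl x : t - r < x < t -> `|x - t| < r /\ x != t.
  move=> /andP[x1 x2]; split; last by rewrite lt_eqF.
  by rewrite ltr_norml; apply/andP; split; lra.
have nbr x : t < x < t + r -> `|x - t| < r /\ x != t.
  move=> /andP[x1 x2]; split; last by rewrite gt_eqF.
  by rewrite ltr_norml; apply/andP; split; lra.
have L := @const_sign R u (t - r) t cu (fun x xt => let: conj a b := nbl x xt in u0 x a b).
have Rg := @const_sign R u t (t + r) cu (fun x xt => let: conj a b := nbr x xt in u0 x a b).
have split3 x : `|x - t| < r -> [\/ t - r < x < t, x = t | t < x < t + r].
  rewrite ltr_norml => /andP[? ?]; have [xt|tx|->] := ltgtP x t.
  - by apply: Or31; apply/andP; split; lra.
  - by apply: Or33; apply/andP; split; lra.
  - exact: Or32.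
have uE x : ev f x - ev h x - (ev f t - ev h t) = u x by rewrite mE.
case: L Rg => [Lp|Ln] [Rp|Rn].
- case: next => _ []; move=> x /split3[/Lp/ltW//|->|/Rp/ltW//].
  by rewrite ut.
- exists (-1); first by right.
  exists r => //; split; [lra|lra|] => x /split3 H; rewrite uE mulN1r oppr_le0 oppr_ge0.
  by case: H => [H|->|H]; rewrite ?ut//; split=> ?; [exact/ltW/Lp|
    move: H => /andP[? ?]; lra|move: H => /andP[? ?]; lra|exact/ltW/Rn].
- exists 1; first by left.
  exists r => //; split; [lra|lra|] => x /split3 H; rewrite uE mul1r.
  by case: H => [H|->|H]; rewrite ?ut//; split=> ?; [exact/ltW/Ln|
    move: H => /andP[? ?]; lra|move: H => /andP[? ?]; lra|exact/ltW/Rp].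
- case: next => [] []; move=> x /split3[/Ln/ltW//|->|/Rn/ltW//].
  by rewrite ut.
Qed.

Lemma crossing_margin (R : realType) (f h : C01 R) (eta : R) : 0 < eta ->
  exists2 d : R, 0 < d & forall x e, 0 < e <= d -> 0 <= x <= 1 ->
    (forall t, cr f h t -> eta <= `|x - t|) ->
    forall m : int, e <= `|ev f x - ev h x - m%:~R|.
Proof.
move=> eta0.
have [|d d0 H] := @compact01_unif R (fun e x =>
    (forall t, cr f h t -> eta <= `|x - t|) ->
    forall m : int, e <= `|ev f x - ev h x - m%:~R|).
  (* Around a crossing the radius [eta] works because the points considered there violate the
     premise. *)
  move=> x x01; have [crx|ncr] := pselect (cr f h x).
    exists eta => // y e _ yx _ /(_ _ crx); by rewrite leNgt yx.
  have [d d0 H] := not_cr_near x01 ncr.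
  by exists d => // y e y01 yx ed _ m; apply: H.
exists (d / 2) => [|x e /andP[e0 ed] x01]; first by rewrite divr_gt0.
by apply: H => //; apply/andP; split; lra.
Qed.

(** The map sending [t] to the unique point of [B] within [eta] is onto [B], and strictly increasing
    because the points of [A] are [2 * eta] apart. So it carries the sorted list of [A] to that of
    [B]. *)
Lemma sim_of_matching (R : realType) (A B : set R) (e eta : R) :
  finite_set A ->
  (forall t t', A t -> A t' -> t != t' -> 2 * eta <= `|t - t'|) ->
  (forall t, A t -> exists u, [/\ B u, `|u - t| < eta, `|u - t| <= e &
     forall v, B v -> `|v - t| < eta -> v = u]) ->
  (forall u, B u -> exists2 t, A t & `|u - t| < eta) ->
  sim e A B.
Proof.
move=> /finite_seqP[s0 AE] sep H1 H2.
have AP t : A t <-> t \in s0 by rewrite AE.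
have /choice[phi phiH] : forall t, exists u, A t -> [/\ B u, `|u - t| < eta,
    `|u - t| <= e & forall v, B v -> `|v - t| < eta -> v = u].
  by move=> t; have [/H1[u uH]|] := pselect (A t); [exists u|exists 0].
pose s := sort <=%R (undup s0).
have sP t : (t \in s) = (t \in s0) by rewrite mem_sort mem_undup.
have ss : sorted <%R s by rewrite sort_lt_sorted undup_uniq.
exists s, (map phi s); split.
- by split => //; apply/seteqP; split=> t /=; rewrite sP => /AP.
- split.
    suff hom : {in mem s &, {homo phi : x y / x < y}}.
      by apply: (homo_sorted_in hom _ ss); apply/allP.
    move=> x y xs ys xy.
    have Ax : A x by apply/AP; rewrite -sP.
    have Ay : A y by apply/AP; rewrite -sP.
    have := sep _ _ Ax Ay ltac:(by rewrite lt_eqF).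
    have [_ + _ _] := phiH _ Ax; have [_ + _ _] := phiH _ Ay.
    rewrite (@ltr0_norm _ (x - y)) ?subr_lt0// !ltr_norml.
    by move=> /andP[? ?] /andP[? ?] ?; lra.
  apply/seteqP; split=> u /=.
    move=> Bu; have [t At ut] := H2 _ Bu; have [_ _ _ un] := phiH _ At.
    by apply/mapP; exists t; [rewrite sP; exact/AP|exact: un].
  by move=> /mapP[t]; rewrite sP => /AP At ->; have [] := phiH _ At.
- by rewrite size_map.
- move=> i si; rewrite (nth_map 0)//.
  have /AP At : s`_i \in s0 by rewrite -sP mem_nth.
  by have [_ _ + _] := phiH _ At; rewrite distrC.
Qed.

(* The perturbed interpolant stays below [h + m] up to the cell of [t], is
   steeper than [h] on the middle third of that cell, and stays above
   afterwards. *)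
Lemma steep_crossing_pos (R : realType) (F h G : R -> R) (b : nat -> R)
    (k : nat) (t m tau eta K : R) :
  0 < t - eta -> t + eta < 1 -> F t - h t = m -> 0 <= K -> 0 < tau ->
  k.+1%:R^-1 < eta -> 20 * (K + 1) * k.+1%:R^-1 <= tau ->
  continuous (fun x => G x - h x) ->
  (forall x, `|x - t| < eta -> (x <= t -> F x - h x - m <= 0) /\
                               (t <= x -> 0 <= F x - h x - m)) ->
  (forall x y : R, 0 <= x <= 1 -> 0 <= y <= 1 -> `|x - y| <= k.+1%:R^-1 ->
     `|F x - F y| <= tau / 20) ->
  (forall x y : R, 0 <= x <= 1 -> 0 <= y <= 1 -> `|h x - h y| <= K * `|x - y|) ->
  (forall i, (i <= k.+1)%N -> `|i%:R / k.+1%:R - t| <= 2 * eta ->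
     `|b i - (F (i%:R / k.+1%:R) +
              tau * (if t < i%:R / k.+1%:R then 1 else -1))| <= tau / 20) ->
  (forall (i : nat) (l : R), (i <= k)%N -> 0 <= l <= 1 ->
     `|G ((i%:R + l) / k.+1%:R) - ((1 - l) * b i + l * b i.+1)| <= tau / 20) ->
  (forall (i : nat) (l l' : R), (i <= k)%N -> 3^-1 <= l -> l <= l' -> l' <= 2 / 3 ->
     `|G ((i%:R + l') / k.+1%:R) - G ((i%:R + l) / k.+1%:R) -
       (b i.+1 - b i) * (l' - l)| <= (l' - l) * k.+1%:R^-1) ->
  exists u : R, [/\ `|u - t| <= k.+1%:R^-1, 0 <= u <= 1, G u - h u = m &
    forall x, `|x - t| < eta -> G x - h x = m -> x = u].
Proof.
move=> t0 t1 Ft K0 tau0 neta tauK cGh sgn oscF lip node appG slope.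
have n0 : 0 < k.+1%:R :> R by [].
move: {-1}(k.+1%:R^-1 : R) (erefl (k.+1%:R^-1 : R)) neta tauK oscF => nu nuE neta tauK oscF.
have nu0 : 0 < nu by rewrite -nuE invr_gt0.
have eta0 : 0 < eta by apply: lt_trans neta.
have lnuP (l : R) : 0 <= l <= 1 -> 0 <= l * nu <= nu.
  move=> /andP[l0 l1]; rewrite (mulr_ge0 l0 (ltW nu0)) /=.
  by apply: ler_piMl => //; exact: ltW.
have K1nu : K * nu <= tau / 20 by lra.
have t01 : 0 <= t <= 1 by apply/andP; split; lra.
pose p (i : nat) : R := i%:R / k.+1%:R.
have node01 i : (i <= k.+1)%N -> 0 <= p i <= 1.
  by move=> ik; rewrite divr_ge0//= ler_pdivrMr// mul1r ler_nat.
have cellS i : p i.+1 = p i + nu.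
  by rewrite /p -nuE -natr1 mulrDl mul1r.
have cellx i (l : R) : ((i%:R + l) / k.+1%:R : R) = p i + l * nu.
  by rewrite /p -nuE mulrDl.
have cell01 i (l : R) : (i <= k)%N -> 0 <= l <= 1 -> 0 <= p i + l * nu <= 1.
  by move=> ik l01; rewrite -cellx; exact: cell_in01.
have {}node i : (i <= k.+1)%N -> `|p i - t| <= 2 * eta ->
     `|b i - (F (p i) + tau * (if t < p i then 1 else -1))| <= tau / 20 := node i.
have {}appG i (l : R) : (i <= k)%N -> 0 <= l <= 1 ->
     `|G (p i + l * nu) - ((1 - l) * b i + l * b i.+1)| <= tau / 20.
  by rewrite -cellx; exact: appG.
have {}slope i l l' : (i <= k)%N -> 3^-1 <= l -> l <= l' -> l' <= 2 / 3 ->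
     `|G (p i + l' * nu) - G (p i + l * nu) - (b i.+1 - b i) * (l' - l)| <=
     (l' - l) * nu.
  by rewrite -!cellx -nuE; exact: slope.
have cmono i j : (i <= j)%N -> p i <= p j.
  by move=> ij; rewrite ler_pM2r ?invr_gt0// ler_nat.
have pk : p k.+1 = 1 by rewrite /p divff// gt_eqF.
have [c ck [c0 c1]] : exists2 c, (c <= k.+1)%N & 0 <= t - p c /\ t - p c < nu.
  have [c ck /andP[c0 c1]] := @grid_cell R k t t01.
  by exists c => //; rewrite -nuE.
have segc (x : R) : 0 <= x <= 1 -> exists i : nat, exists l : R,
    [/\ (i <= k)%N, 0 <= l <= 1 & x = p i + l * nu].
  move=> /(@segment_cell R k)[i [l [? ? xE]]]; exists i, l; split=> //.
  by rewrite xE cellx.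
clearbody p; clear cellx nuE n0.
have {}ck : (c <= k)%N.
  rewrite leqNgt; apply/negP => kc; have : (c = k.+1)%N by apply/eqP; rewrite eqn_leq ck.
  by move=> cE; move: c0; rewrite cE pk; lra.
(* Node [c] is not to the right of [t] and node [c.+1] is, so they are shifted by [- tau] and [tau].
   The error [tau / 10] is the rounding [tau / 20] of the node plus the oscillation [tau / 20] of
   [F] over a cell. *)
have bc : b c <= F t - tau + tau / 10 /\ F t - tau - tau / 10 <= b c.
  have := node c (leqW ck); rewrite ifF; last by apply/negbTE; rewrite -leNgt; lra.
  rewrite ler0_norm; last by lra.
  move=> /(_ ltac:(lra)); rewrite ler_norml => /andP[? ?].
  have := oscF (p c) t (node01 _ (leqW ck)) t01.
  rewrite ler0_norm; last by lra.
  by move=> /(_ ltac:(lra)); rewrite ler_norml => /andP[? ?]; split; lra.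
have bc1 : b c.+1 <= F t + tau + tau / 10 /\ F t + tau - tau / 10 <= b c.+1.
  have := node c.+1 ck; rewrite ifT; last by rewrite cellS; lra.
  rewrite gtr0_norm; last by rewrite cellS; lra.
  move=> /(_ ltac:(rewrite cellS; lra)); rewrite ler_norml => /andP[? ?].
  have := oscF (p c.+1) t (node01 c.+1 ck) t01.
  rewrite gtr0_norm; last by rewrite cellS; lra.
  move=> /(_ ltac:(rewrite cellS; lra)).
  by rewrite ler_norml => /andP[? ?]; split; lra.
have hcell (l : R) : 0 <= l <= 1 -> `|h (p c + l * nu) - h t| <= tau / 20.
  move=> /andP[l0 l1].
  have lnu := lnuP l ltac:(by rewrite l0).
  move/andP: lnu => [lnu0 lnu1].
  apply: (le_trans (lip _ _ (cell01 c l ck ltac:(by rewrite l0)) t01)).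
  apply: le_trans K1nu; apply: ler_wpM2l => //.
  by rewrite ler_norml; apply/andP; split; lra.
(* The interpolant runs from about [F t - tau] to about [F t + tau]. The error [tau / 5] collects
   [tau / 10] from the nodes, [tau / 20] from [G] and [tau / 20] from [h]. *)
have cellc (l : R) : 0 <= l <= 1 ->
    G (p c + l * nu) - h (p c + l * nu) - m <=
      (2 * l - 1) * tau + tau / 5 /\
    (2 * l - 1) * tau - tau / 5 <=
      G (p c + l * nu) - h (p c + l * nu) - m.
  move=> l01; have := appG c l ck l01; have := hcell _ l01.
  have := convex_mono l01 bc.1 bc1.1; have := convex_mono l01 bc.2 bc1.2.
  move: (G _) (h (p c + _)) Ft => Gx hx Ft.
  clear -Ft; rewrite !ler_norml => ? ? /andP[? ?] /andP[? ?].
  by split; lra.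
have third01 : 0 <= (3^-1 : R) <= 1 by apply/andP; split; lra.
have third01' : 0 <= (2 / 3 : R) <= 1 by apply/andP; split; lra.
(* Outside the middle third the main term has absolute value at least [tau / 3], which exceeds the
   error [tau / 5]. *)
have below (l : R) : 0 <= l <= 3^-1 ->
    G (p c + l * nu) - h (p c + l * nu) < m.
  move=> /andP[l0 l1]; have [+ _] := cellc l ltac:(apply/andP; split; lra).
  have : (2 * l - 1) * tau <= - (3^-1 * tau) by rewrite -mulNr ler_pM2r//; lra.
  by move: (G _ - _) => D; clear -tau0; lra.
have above (l : R) : 2 / 3 <= l <= 1 ->
    m < G (p c + l * nu) - h (p c + l * nu).
  move=> /andP[l0 l1]; have [_ +] := cellc l ltac:(apply/andP; split; lra).
  have : 3^-1 * tau <= (2 * l - 1) * tau by rewrite ler_pM2r//; lra.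
  by move: (G _ - _) => D; clear -tau0; lra.
(* The nodes rise by at least [tau] across the cell, while [h] and the slope error of [G] account
   for at most [(K + 1) * nu] per unit of [l], which is less than [tau]. *)
have steep l l' : 3^-1 <= l -> l < l' -> l' <= 2 / 3 ->
    G (p c + l * nu) - h (p c + l * nu) <
    G (p c + l' * nu) - h (p c + l' * nu).
  move=> l3 ll l3'; have := slope c l l' ck l3 (ltW ll) l3'.
  have := lip (p c + l' * nu) (p c + l * nu)
    (cell01 c l' ck ltac:(apply/andP; split; lra)) (cell01 c l ck ltac:(apply/andP; split; lra)).
  rewrite (_ : p c + l' * nu - _ = (l' - l) * nu); last by ring.
  rewrite normrM (gtr0_norm nu0).
  rewrite (@gtr0_norm _ (l' - l)) ?subr_gt0// !ler_norml => /andP[h1 h2] /andP[g1 g2].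
  have db : tau <= b c.+1 - b c.
    by move: bc bc1 => [e1 e2] [e3 e4]; clear -e1 e2 e3 e4 tau0; lra.
  have dpos : 0 < l' - l by rewrite subr_gt0.
  have d1 : tau * (l' - l) <= (b c.+1 - b c) * (l' - l) by rewrite ler_pM2r.
  have d2 : (K + 1) * nu * (l' - l) < tau * (l' - l).
    by rewrite ltr_pM2r//; clear -tauK tau0 K0 nu0; nra.
  move: (G _) (h _) h1 h2 g1 g2 => Gx hx; move: (G _) (h _) => Gy hy.
  by clear -d1 d2; lra.
have crossc : exists2 l : R, 3^-1 <= l <= 2 / 3 &
    G (p c + l * nu) - h (p c + l * nu) = m.
  pose psi (l : R) := p c + l * nu.
  have cpsi : {within `[3^-1, 2 / 3], continuous (fun l => G (psi l) - h (psi l))}.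
    apply: continuous_subspaceT => l.
    apply: (@continuous_comp _ _ _ psi (fun x => G x - h x)); last exact: cGh.
    by apply: cvgD; [exact: cvg_cst|apply: cvgMl; exact: cvg_id].
  have [||l] := @IVT R _ _ _ m _ cpsi; first by lra.
    have b3 := ltW (below 3^-1 ltac:(apply/andP; split; lra)).
    have a3 := ltW (above (2 / 3) ltac:(apply/andP; split; lra)).
    by rewrite ge_min le_max b3 a3 orbT.
  by rewrite in_itv /= => l3 lE; exists l.
have [l l3 lE] := crossc.
have l01 : 0 <= l <= 1 by move/andP: l3 => [? ?]; apply/andP; split; lra.
exists (p c + l * nu); split=> //.
- have lnu := lnuP l l01.
  move/andP: lnu => [? ?]; rewrite ler_norml; apply/andP; split; lra.
- exact: cell01.
move=> x xt Dx; have x01 : 0 <= x <= 1.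
  by move: xt; rewrite ltr_norml => /andP[? ?]; apply/andP; split; lra.
have [i [q [ik q01 xE]]] := segc x x01.
have qnu := lnuP q q01.
move/andP: qnu => [qnu0 qnu1].
have xE' := xE.
have Gx := appG i q ik q01; rewrite -xE in Gx.
have near j : (j = i \/ j = i.+1) -> `|p j - x| <= nu.
  by case=> ->; rewrite ?cellS xE' ler_norml; apply/andP; split; lra.
have nearF j : (j = i \/ j = i.+1) -> `|F (p j) - F x| <= tau / 20.
  move=> ji; apply: oscF => //; last exact: near.
  by apply: node01; case: ji => -> //; exact: leqW.
(* The reason for prescribing the nodes up to distance [2 * eta]: [x] is within [eta] of [t], and
   the nodes of its cell within [nu < eta] of [x]. *)
have neart j : (j = i \/ j = i.+1) -> `|p j - t| <= 2 * eta.
  move=> /near; move: xt; rewrite ltr_norml !ler_norml => /andP[? ?] /andP[? ?].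
  by apply/andP; split; lra.
have nodej j : (j = i \/ j = i.+1) -> `|b j - (F (p j) +
      tau * (if t < p j then 1 else -1))| <= tau / 20.
  by move=> ji; apply: node; [case: ji => -> //; exact: leqW|exact: neart].
(* In a cell before that of [t] both nodes lie at least [tau - tau / 10] below [F x], and [F - h] is
   at most [m] there, so [G - h] stays below [m]; symmetrically after. Only the cell of [t] remains,
   where monotonicity on the middle third gives uniqueness. *)
have [ic|ci|ic] := ltngtP i c.
- have xlt : x <= t.
    have := cmono i.+1 c ic; rewrite cellS; clear -xE' qnu1 c0; lra.
  have bj j : (j = i \/ j = i.+1) -> b j <= F x - tau + tau / 10.
    move=> ji; have jc : p j <= t.
      have : (j <= c)%N by case: ji => -> //; exact: ltnW.
      by move=> /cmono; clear -c0; lra.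
    have := nodej _ ji; rewrite ifF; last by apply/negbTE; rewrite -leNgt.
    have := nearF _ ji; rewrite !ler_norml; clear; move=> /andP[? ?] /andP[? ?]; lra.
  have := convex_mono q01 (bj i (or_introl erefl)) (bj i.+1 (or_intror erefl)).
  rewrite convex_idem => bx; have [/(_ xlt) sg _] := sgn x xt.
  by exfalso; move: Gx; rewrite ler_norml => /andP[e1 e2]; clear -e1 e2 bx sg Dx tau0; lra.
- have xlt : t <= x.
    have := cmono c.+1 i ci; rewrite cellS; clear -xE' qnu0 c1; lra.
  have bj j : (j = i \/ j = i.+1) -> F x + tau - tau / 10 <= b j.
    move=> ji; have jc : t < p j.
      have : (c.+1 <= j)%N by case: ji => -> //; exact: ltnW.
      by move=> /cmono; rewrite cellS; clear -c1; lra.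
    have := nodej _ ji; rewrite ifT//.
    have := nearF _ ji; rewrite !ler_norml; clear; move=> /andP[? ?] /andP[? ?]; lra.
  have := convex_mono q01 (bj i (or_introl erefl)) (bj i.+1 (or_intror erefl)).
  rewrite convex_idem => bx; have [_ /(_ xlt) sg] := sgn x xt.
  by exfalso; move: Gx; rewrite ler_norml => /andP[e1 e2]; clear -e1 e2 bx sg Dx tau0; lra.
- rewrite xE ic in Dx *.
  move/andP: l3 => [l3 l3']; move/andP: q01 => [q0 q1].
  have q3 : 3^-1 < q.
    by rewrite ltNge; apply/negP => qq; have := below q ltac:(by rewrite q0); rewrite Dx ltxx.
  have q3' : q < 2 / 3.
    by rewrite ltNge; apply/negP => qq; have := above q ltac:(by rewrite q1 andbT); rewrite Dx ltxx.
  have [ql|lq|-> //] := ltgtP q l.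
    by have := steep q l (ltW q3) ql l3'; rewrite Dx lE ltxx.
  by have := steep l q l3 lq (ltW q3'); rewrite Dx lE ltxx.
Qed.

(** A downward crossing becomes an upward one when [F], [h], [G], [b] and [m] change sign; the
    remaining hypotheses are symmetric. *)
Lemma steep_crossing (R : realType) (F h G : R -> R) (b : nat -> R)
    (k : nat) (t m tau eta K sg : R) : sg = 1 \/ sg = -1 ->
  0 < t - eta -> t + eta < 1 -> F t - h t = m -> 0 <= K -> 0 < tau ->
  k.+1%:R^-1 < eta -> 20 * (K + 1) * k.+1%:R^-1 <= tau ->
  continuous (fun x => G x - h x) ->
  (forall x, `|x - t| < eta -> (x <= t -> sg * (F x - h x - m) <= 0) /\
                               (t <= x -> 0 <= sg * (F x - h x - m))) ->
  (forall x y : R, 0 <= x <= 1 -> 0 <= y <= 1 -> `|x - y| <= k.+1%:R^-1 ->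
     `|F x - F y| <= tau / 20) ->
  (forall x y : R, 0 <= x <= 1 -> 0 <= y <= 1 -> `|h x - h y| <= K * `|x - y|) ->
  (forall i, (i <= k.+1)%N -> `|i%:R / k.+1%:R - t| <= 2 * eta ->
     `|b i - (F (i%:R / k.+1%:R) +
        tau * (sg * if t < i%:R / k.+1%:R then 1 else -1))| <= tau / 20) ->
  (forall (i : nat) (l : R), (i <= k)%N -> 0 <= l <= 1 ->
     `|G ((i%:R + l) / k.+1%:R) - ((1 - l) * b i + l * b i.+1)| <= tau / 20) ->
  (forall (i : nat) (l l' : R), (i <= k)%N -> 3^-1 <= l -> l <= l' -> l' <= 2 / 3 ->
     `|G ((i%:R + l') / k.+1%:R) - G ((i%:R + l) / k.+1%:R) -
       (b i.+1 - b i) * (l' - l)| <= (l' - l) * k.+1%:R^-1) ->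
  exists u : R, [/\ `|u - t| <= k.+1%:R^-1, 0 <= u <= 1, G u - h u = m &
    forall x, `|x - t| < eta -> G x - h x = m -> x = u].
Proof.
move=> sgE t0 t1 Ft K0 tau0 neta tauK cGh sgn oscF lip node appG slope.
case: sgE => sgE; subst sg.
  apply: (@steep_crossing_pos R F h G b k t m tau eta K) => //.
    by move=> x /sgn; rewrite mul1r.
  by move=> i ik /(node i ik); rewrite mul1r.
have [] := @steep_crossing_pos R (fun x => - F x) (fun x => - h x)
  (fun x => - G x) (fun i => - b i) k t (- m) tau eta K t0 t1 _ K0 tau0 neta tauK.
- by rewrite -Ft; ring.
- move=> x; rewrite (_ : (fun _ => _) = (fun x => - (G x - h x))); last first.
    by apply/funext => y; ring.
  by apply: cvgN; exact: cGh.
- move=> x /sgn; rewrite (_ : - F x - _ - _ = -1 * (F x - h x - m)) //; ring.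
- move=> x y x01 y01 xy; rewrite -opprD normrN; exact: oscF.
- move=> x y x01 y01; rewrite -opprD normrN; exact: lip.
- move=> i ik it; have := node i ik it; rewrite mulN1r mulrN => H.
  rewrite -normrN (_ : - (_ - _) = b i - (F (i%:R / k.+1%:R) -
    tau * (if t < i%:R / k.+1%:R then 1 else -1)))//; ring.
- move=> i l ik l01; rewrite !mulrN -!opprD normrN; exact: appG.
- move=> i l l' ik l1 l2 l3; have := slope i l l' ik l1 l2 l3.
  rewrite (_ : - _ - - _ - _ = - (G ((i%:R + l') / k.+1%:R) - G ((i%:R + l) / k.+1%:R) -
       (b i.+1 - b i) * (l' - l))) ?normrN//; ring.
move=> u [ut u01 uE uU]; exists u; split=> //.
  by apply: oppr_inj; rewrite -uE; ring.
by move=> x xt xE; apply: uU => //; rewrite -xE; ring.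
Qed.

(** * Interpolants on a regular grid *)

Definition hat (R : realType) (u : R) : R := Num.max 0 (1 - `|u|).

(** Continuous, piecewise linear, with value [b i] at [i / (k + 1)] for
    [i <= k + 1]. *)
Definition grid_pl (R : realType) (k : nat) (b : nat -> R) (x : R) : R :=
  \sum_(i < k.+2) b i * hat (k.+1%:R * x - i%:R).

(** The slope is prescribed on the middle third of each cell only, so that the
    condition survives a small displacement of the knots. *)
Definition near_pl (R : realType) (k : nat) (b : nat -> R) (r : R) :
    set (C01 R) :=
  [set g | (forall x : I01 R, `|g x - grid_pl k b (\val x)| <= r) /\
    forall (i : nat) (x y : I01 R), (i <= k)%N ->
      i%:R + 3^-1 <= k.+1%:R * \val x <= i%:R + 2 / 3 ->
      i%:R + 3^-1 <= k.+1%:R * \val y <= i%:R + 2 / 3 ->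
      `|g y - g x - k.+1%:R * (b i.+1 - b i) * (\val y - \val x)| <=
        `|\val y - \val x|].

Lemma hat_out (R : realType) (u : R) : 1 <= `|u| -> hat u = 0.
Proof. by move=> u1; rewrite /hat max_l// subr_le0. Qed.

Lemma hat_in (R : realType) (u : R) : `|u| <= 1 -> hat u = 1 - `|u|.
Proof. by move=> u1; rewrite /hat max_r// subr_ge0. Qed.

(** On cell [i] only the hats centred at nodes [i] and [i.+1] can be nonzero. *)
Lemma grid_plE (R : realType) (k : nat) (b : nat -> R) (i : nat) (l : R) :
  (i <= k)%N -> 0 <= l <= 1 ->
  grid_pl k b ((i%:R + l) / k.+1%:R) = (1 - l) * b i + l * b i.+1.
Proof.
move=> ik /andP[l0 l1]; rewrite /grid_pl mulrCA divff ?mulr1 ?pnatr_eq0//.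
have ik2 : (i < k.+2)%N by rewrite ltnS leqW.
rewrite (bigD1 (Ordinal ik2)) //= (bigD1 (Ordinal (ik : (i.+1 < k.+2)%N))) /=; last first.
  by apply/eqP => /(congr1 val) /= /eqP; rewrite gtn_eqF.
rewrite big1 ?addr0 => [|j /andP[j1 j2]].
  rewrite addrAC subrr add0r hat_in ger0_norm//.
  rewrite -natr1 opprD addrACA subrr add0r hat_in ler0_norm ?subr_le0//; last by lra.
  by ring.
rewrite hat_out ?mulr0//.
have {}j1 : (val j != i)%N by apply: contra j1 => /eqP ji; apply/eqP/val_inj.
have {}j2 : (val j != i.+1)%N by apply: contra j2 => /eqP ji; apply/eqP/val_inj.
have [ji|ij] := leqP j i.
  have {}ji : (j.+1 <= i)%N by rewrite ltn_neqAle j1.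
  have : j.+1%:R <= i%:R :> R by rewrite ler_nat.
  rewrite -natr1 => ?; rewrite ger0_norm; lra.
have {}ij : (i.+2 <= j)%N by rewrite ltn_neqAle eq_sym j2.
have : i.+2%:R <= j%:R :> R by rewrite ler_nat.
by rewrite -addn2 natrD => ?; rewrite ler0_norm; lra.
Qed.

Lemma near_pl_val (R : realType) (k : nat) (b : nat -> R) (r : R) (g : C01 R)
    (i : nat) (l : R) : near_pl k b r g -> (i <= k)%N -> 0 <= l <= 1 ->
  `|ev g ((i%:R + l) / k.+1%:R) - ((1 - l) * b i + l * b i.+1)| <= r.
Proof.
move=> [H _] ik l01; rewrite -(grid_plE b ik l01).
by rewrite -{2}(val_clamp01 (cell_in01 ik l01)); exact: H.
Qed.

Lemma near_pl_slope (R : realType) (k : nat) (b : nat -> R) (r : R) (g : C01 R)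
    (i : nat) (l l' : R) : near_pl k b r g -> (i <= k)%N ->
  3^-1 <= l -> l <= l' -> l' <= 2 / 3 ->
  `|ev g ((i%:R + l') / k.+1%:R) - ev g ((i%:R + l) / k.+1%:R) -
       (b i.+1 - b i) * (l' - l)| <= (l' - l) * k.+1%:R^-1.
Proof.
move=> [_ H] ik l1 l2 l3; have n0 : k.+1%:R != 0 :> R by rewrite pnatr_eq0.
have l01 : 0 <= l <= 1 by apply/andP; split; lra.
have l01' : 0 <= l' <= 1 by apply/andP; split; lra.
have vE q : 0 <= q <= 1 -> \val (clamp01 ((i%:R + q) / k.+1%:R)) = (i%:R + q) / k.+1%:R.
  by move=> q01; rewrite val_clamp01// cell_in01.
have := H i (clamp01 ((i%:R + l) / k.+1%:R)) (clamp01 ((i%:R + l') / k.+1%:R)) ik.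
rewrite !vE// ![k.+1%:R * (_ / _)]mulrCA divff// !mulr1 !lerD2l.
rewrite l1 (le_trans l2 l3) (le_trans l1 l2) l3 => /(_ isT isT).
rewrite -mulrBl (_ : _ + l' - _ = l' - l); last by ring.
rewrite normrM (ger0_norm (_ : 0 <= l' - l)) ?subr_ge0// ger0_norm ?invr_ge0//.
by rewrite [X in _ - X](_ : _ = (b i.+1 - b i) * (l' - l)) //; field.
Qed.

Lemma cell_node_dist (R : realType) (k i j : nat) (l : R) : 0 <= l <= 1 ->
  j = i \/ j = i.+1 ->
  `|j%:R / k.+1%:R - (i%:R + l) / k.+1%:R| <= k.+1%:R^-1.
Proof.
move=> /andP[l0 l1] ji; rewrite -mulrBl normrM [X in _ * X]ger0_norm ?invr_ge0//.
rewrite -[leRHS]mul1r ler_pM2r ?invr_gt0//.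
by case: ji => ->; rewrite ler_norml -?natr1; apply/andP; split; lra.
Qed.

Lemma exists_rat_near (R : realType) (x e : R) : 0 < e ->
  exists q : rat, `|ratr q - x| <= e.
Proof.
move=> e0; have [q] := @rat_in_itvoo R (x - e) (x + e) ltac:(lra).
rewrite in_itv /= => /andP[q1 q2]; exists q.
by rewrite ler_norml; apply/andP; split; lra.
Qed.

Lemma common_lipschitz (R : realType) (H : set (C01 R)) : finite_set H ->
  (forall h, H h -> lipschitz01 h) ->
  exists2 K : R, 0 <= K & forall h, H h -> forall x y : R,
    0 <= x <= 1 -> 0 <= y <= 1 -> `|ev h x - ev h y| <= K * `|x - y|.
Proof.
move=> finH lipH.
(* The parameter is the inverse of a Lipschitz constant, so that taking the smallest parameter
   amounts to taking the largest constant. *)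
have [|d d0 Hd] := @finite_uniform R (C01 R) H (fun h e =>
    forall s t : I01 R, `|h s - h t| <= e^-1 * `|\val s - \val t|) finH.
  move=> h /lipH[k kH]; exists (`|k| + 1)^-1 => [|e /andP[e0 ek] s t].
    by rewrite invr_gt0; apply: ltr_wpDl.
  apply: (le_trans (kH s t)); apply: ler_wpM2r => //.
  have : `|k| + 1 <= e^-1.
    by rewrite -[leLHS]invrK lef_pV2// posrE// invr_gt0; apply: ltr_wpDl.
  by have := ler_norm k; lra.
exists d^-1 => [|h Hh x y x01 y01]; first by rewrite invr_ge0 ltW.
have := Hd h d Hh; rewrite d0 lexx => /(_ isT (clamp01 x) (clamp01 y)).
by rewrite !val_clamp01.
Qed.

Lemma approx_crossings (R : realType) (f : C01 R) (H : set (C01 R)) (e : R) :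
  finite_set H -> (forall h, H h -> lipschitz01 h) ->
  (forall h, H h -> [/\ finite_set (cr f h), ~ cr f h 0, ~ cr f h 1 &
     forall t : I01 R, cr f h (\val t) -> ~ local_extremum (f \- h) t]) ->
  (forall h h', H h -> H h' -> h <> h' -> cr f h `&` cr f h' = set0) ->
  0 < e ->
  exists (k : nat) (s : seq rat) (q : nat), forall g : C01 R,
    near_pl k (fun i => ratr s`_i) q.+1%:R^-1 g ->
    supnorm (f \- g) < e /\ forall h, H h -> sim e (cr f h) (cr g h).
Proof.
move=> finH lipH trH disj e0.
have [K K0 lip] := common_lipschitz finH lipH.
pose W : set R := \bigcup_(h in H) cr f h.
have finW : finite_set W by apply: bigcup_finite => // h /trH[].
(* By [disj] a point of [W] is a crossing of [f] with one element of [H] only, so its direction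
   depends on the point alone. Outside [W] the value 0 is a default. *)
have /choice[sg sgP] : forall t, exists sg : R, W t -> (sg = 1 \/ sg = -1) /\
    exists2 r : R, 0 < r & forall h, H h -> cr f h t -> sign_change f h t sg r.
  move=> t; have [[h Hh crt]|] := pselect (W t); last by exists 0.
  have [fin n0 n1 next] := trH _ Hh.
  have [sg sgE [r r0 rH]] := crossing_sign_change fin n0 n1 next crt.
  exists sg => _; split=> //; exists r => // h' Hh' crt'.
  have [->//|hh] := pselect (h' = h).
  have : (cr f h' `&` cr f h) t by [].
  by rewrite disj.
have [|eta1 eta10 etaH] := @finite_uniform R R W (fun t r =>
    forall h, H h -> cr f h t -> sign_change f h t (sg t) r) finW.
  move=> t /sgP[_ [r r0 rH]]; exists r => // r' /andP[_ r'r] h Hh crt.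
  exact: sign_changeS (rH _ Hh crt).
(* With crossings [5 * eta] apart, a node cannot lie within [2 * eta] of two of them, so the sign of
   its shift is well defined. *)
have [|eta2 eta20 sepW] := @finite_uniform R R W (fun t r =>
    forall t', W t' -> t' != t -> 5 * r <= `|t' - t|) finW.
  move=> t Wt; have [d d0 dH] := finite_isolated t finW.
  exists (d / 5) => [|r /andP[r0 rd] t' Wt' tt']; first by rewrite divr_gt0.
  by apply: le_trans (dH _ Wt' tt'); lra.
(* Within [eta] of a crossing, [f] and [h] each move by at most 1/8, and [g] is within
   [2 * tau <= 1/8] of [f]. So [g - h] differs from its integer target by less than 1, and a
   crossing of [g] and [h] there has that same integer value. *)
have [eta3 eta30 osc] := @ev_unif_cont R f 8^-1 ltac:(by rewrite invr_gt0).
have K10 : 0 < K + 1 by lra.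
have [a [a0 a1 a2 a3]] := exists_min3 eta10 eta20 eta30.
have [||eta [eta0 etaa etaK etae]] := @exists_min3 R a ((8 * (K + 1))^-1) e a0.
  - by rewrite invr_gt0 mulr_gt0.
  - by [].
have Keta : K * eta <= 8^-1.
  apply: (@le_trans _ _ (K * (8 * (K + 1))^-1)); first by rewrite ler_wpM2l.
  by rewrite ler_pdivrMr ?mulr_gt0//; lra.
have [|delta delta0 margin] := @finite_uniform R (C01 R) H (fun h d =>
    forall x, 0 <= x <= 1 -> (forall t, cr f h t -> eta <= `|x - t|) ->
    forall m : int, d <= `|ev f x - ev h x - m%:~R|) finH.
  move=> h Hh; have [d d0 dH] := @crossing_margin R f h eta eta0.
  by exists d => // d' d'd x x01 xt m; apply: dH.
(* As [g] stays within [2 * tau] of [f]: [delta / 4] excludes crossings of [g] farther than [eta]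
   from those of [f], [e / 8] gives the distance in sup norm, and 1/16 fixes the integer value. *)
have [|||tau [tau0 taud taue tau1]] :=
  @exists_min3 R (delta / 4) (e / 8) 16^-1.
  - by rewrite divr_gt0.
  - by rewrite divr_gt0.
  - by rewrite invr_gt0.
have [om om0 oscf] := @ev_unif_cont R f (tau / 20) ltac:(by rewrite divr_gt0).
have [||n0 [n00 n1 n2 n3]] := @exists_min3 R om eta (tau / (20 * (K + 1))) om0.
  - by [].
  - by rewrite divr_gt0// mulr_gt0.
have [k kn] := exists_natSinv_lt n00.
have nuom : k.+1%:R^-1 < om by apply: lt_le_trans n1.
have nueta : k.+1%:R^-1 < eta by apply: lt_le_trans n2.
have nutau : 20 * (K + 1) * k.+1%:R^-1 <= tau.
  by rewrite -ler_pdivlMl ?mulr_gt0// mulrC; apply/ltW/(lt_le_trans kn).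
clear kn n1 n2 n3 n00 n0.
(* Pattern of the shifts in units of [tau]: near a crossing [t] it is [- sg t] up to [t] and [sg t]
   after it, elsewhere the default 0. *)
have /choice[s sP] : forall x : R, exists s : R, `|s| <= 1 /\ forall t, W t ->
    `|x - t| <= 2 * eta -> s = sg t * if t < x then 1 else -1.
  move=> x; have [[t [Wt xt]]|nW] := pselect (exists t, W t /\ `|x - t| <= 2 * eta);
    last first.
    exists 0; rewrite normr0; split=> // t Wt xt.
    by exfalso; apply: nW; exists t.
  exists (sg t * if t < x then 1 else -1); split.
    by have [[] -> _] := sgP _ Wt; rewrite normrM ?normrN normr1 mul1r;
      case: ifP => _; rewrite ?normrN normr1.
  move=> t' Wt' xt'; suff -> : t' = t by [].
  apply/eqP/contraT => tt'; have := sepW t eta Wt _ t' Wt' tt'.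
  rewrite eta0 (le_trans etaa a2) => /(_ isT).
  move: xt xt'; rewrite !ler_norml ler_normr => /andP[? ?] /andP[? ?] /orP[?|?]; lra.
have /choice[bq bqP] : forall i : nat, exists q : rat,
    `|ratr q - (ev f (i%:R / k.+1%:R) + tau * s (i%:R / k.+1%:R))| <= tau / 20.
  by move=> i; apply: exists_rat_near; rewrite divr_gt0.
have [q qtau] := @exists_natSinv_lt R (tau / 20) ltac:(by rewrite divr_gt0).
exists k, (mkseq bq k.+2), q => g gH.
pose b i : R := ratr (mkseq bq k.+2)`_i.
have bP i : (i <= k.+1)%N ->
    `|b i - (ev f (i%:R / k.+1%:R) + tau * s (i%:R / k.+1%:R))| <= tau / 20.
  by move=> ik; rewrite /b nth_mkseq.
have appG (i : nat) (l : R) : (i <= k)%N -> 0 <= l <= 1 ->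
   `|ev g ((i%:R + l) / k.+1%:R) - ((1 - l) * b i + l * b i.+1)| <= tau / 20.
  move=> ik l01; apply: (@le_trans _ _ q.+1%:R^-1); last exact: ltW.
  exact: near_pl_val gH ik l01.
have slope (i : nat) (l l' : R) : (i <= k)%N -> 3^-1 <= l -> l <= l' -> l' <= 2 / 3 ->
  `|ev g ((i%:R + l') / k.+1%:R) - ev g ((i%:R + l) / k.+1%:R) -
       (b i.+1 - b i) * (l' - l)| <= (l' - l) * k.+1%:R^-1.
  by move=> ik l1 l2 l3; exact: near_pl_slope gH ik l1 l2 l3.
clearbody b; clear gH bqP.
have nu0 : 0 < k.+1%:R^-1 :> R by rewrite invr_gt0.
have node01 i : (i <= k.+1)%N -> 0 <= (i%:R / k.+1%:R : R) <= 1.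
  by move=> ik; rewrite divr_ge0//= ler_pdivrMr// mul1r ler_nat.
have fg (x : R) : 0 <= x <= 1 -> `|ev g x - ev f x| <= 2 * tau.
  move=> x01; have [i [l [ik l01 xE]]] := @segment_cell R k x x01.
  have bj j : (j = i \/ j = i.+1) -> `|b j - ev f x| <= tau + tau / 10.
    move=> ji; have jk : (j <= k.+1)%N by case: ji => ->; [exact: leqW|].
    have jx : `|j%:R / k.+1%:R - x| < om.
      by apply: le_lt_trans nuom; rewrite xE; exact: cell_node_dist.
    have [s1 _] := sP (j%:R / k.+1%:R).
    have ts : `|tau * s (j%:R / k.+1%:R)| <= tau.
      by rewrite normrM gtr0_norm// ger_pMr.
    have := oscf _ _ (node01 _ jk) x01 jx; have := bP j jk; move: ts.
    rewrite !ler_norml ltr_norml; move: (tau * _) => ts; clear.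
    by move=> /andP[? ?] /andP[? ?] /andP[? ?]; apply/andP; split; lra.
  have := convex_dist l01 (bj i (or_introl erefl)) (bj i.+1 (or_intror erefl)).
  have := appG i l ik l01; rewrite -xE !ler_norml; clear -tau0.
  by move=> /andP[? ?] /andP[? ?]; apply/andP; split; lra.
split.
  apply: (@le_lt_trans _ _ (2 * tau)); last by lra.
  apply: supnorm_le => t; rewrite distrC -!(ev_val _ t).
  exact: fg (I01_bound t).
move=> h Hh; have [fin n0 n1 next] := trH _ Hh.
have Wcr t : cr f h t -> W t by exists h.
apply: (@sim_of_matching R (cr f h) (cr g h) e eta) => //.
- move=> t t' /Wcr Wt /Wcr Wt' tt'.
  have := sepW t' eta Wt' _ t Wt tt'; rewrite eta0 (le_trans etaa a2) => /(_ isT).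
  by move: (`|_|) => z; clear -eta0; lra.
- move=> t crt; have Wt := Wcr _ crt.
  have [t01 [m mE]] := (crP f h t).1 crt.
  have [sgE _] := sgP _ Wt.
  have [|sc1 sc2 sc3] := etaH t eta Wt _ h Hh crt.
    by rewrite eta0 (le_trans etaa a1).
  have [|||||||u [ut u01 uE uU]] := @steep_crossing R (ev f) (ev h) (ev g) b k t m%:~R tau eta K
    (sg t) sgE sc1 sc2 mE K0 tau0 nueta nutau.
  + by move=> x; apply: cvgB; exact: continuous_ev.
  + by move=> x /sc3; rewrite mE.
  + by move=> x y x01 y01 xy; apply/ltW/oscf => //; apply: le_lt_trans nuom.
  + exact: lip.
  + move=> i ik it; have [_ /(_ _ Wt it) <-] := sP (i%:R / k.+1%:R).
    exact: bP.
  + exact: appG.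
  + exact: slope.
  exists u; split.
  + by apply/crP; split=> //; exists m.
  + exact: le_lt_trans nueta.
  + by apply: (le_trans ut); apply: ltW; apply: lt_le_trans etae.
  + move=> v /crP[v01 [m' m'E]] vt; apply: uU => //.
    rewrite m'E; congr (_%:~R); apply: (@intr_dist_lt1 R).
    have fv : `|ev f v - ev f t| < 8^-1.
      apply: osc => //; apply: (lt_le_trans vt); exact: le_trans a3.
    have hv : `|ev h v - ev h t| <= 8^-1.
      apply: (le_trans (lip h Hh v t v01 t01)); apply: le_trans Keta.
      by rewrite ler_wpM2l// ltW.
    have gv := fg v v01.
    rewrite -m'E -mE; move: fv hv gv; rewrite !ltr_norml !ler_norml.
    clear -tau1 tau0; move=> /andP[? ?] /andP[? ?] /andP[? ?].
    by apply/andP; split; lra.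
- move=> u /crP[u01 [m mE]]; apply: contrapT => nt.
  have {}nt t : cr f h t -> eta <= `|u - t|.
    by move=> crt; rewrite leNgt; apply/negP => ut; apply: nt; exists t.
  have := margin h delta Hh _ u u01 nt m; rewrite delta0 lexx => /(_ isT).
  have := fg u u01; rewrite -mE (_ : _ - _ - _ = - (ev g u - ev f u)); last by ring.
  by rewrite normrN; move: (`|_|) => z; clear -taud tau0; lra.
Qed.

(** * Borel sets of continuous functions *)

Lemma closed_measurable (R : realType) (A : set (C01 R)) :
  (forall g : C01 R, ~ A g -> exists2 e : R, 0 < e &
     forall g' : C01 R, supnorm (g \- g') < e -> ~ A g') ->
  measurable (A : set (C01_borel R)).
Proof.
move=> H; rewrite -[A]setCK; apply: (@measurableC _ (C01_borel R)).
exact: sub_sigma_algebra.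
Qed.

(** Covers Lipschitz bounds, affinity and closeness to an interpolant at once. The index type may be
    uncountable: such a set is closed for the sup norm, and a violated bound stays violated under a
    small perturbation of [g]. *)
Lemma measurable_linear_bound (R : realType) (I : Type) (C : I -> Prop)
    (a b c d r : I -> R) (x y z : I -> I01 R) :
  measurable ([set g : C01 R | forall i, C i ->
    `|a i * g (x i) + b i * g (y i) + c i * g (z i) + d i| <= r i] :
    set (C01_borel R)).
Proof.
apply: closed_measurable => g /existsNP[i /not_implyP[Ci]].
move=> /negP; rewrite -ltNge => gi.
pose l (g : C01 R) := a i * g (x i) + b i * g (y i) + c i * g (z i) + d i.
pose M := `|a i| + `|b i| + `|c i| + 1.
have M0 : 0 < M by rewrite ltr_wpDl// !addr_ge0.
exists ((`|l g| - r i) / M) => [|g' gg']; first by rewrite divr_gt0// subr_gt0.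
apply/existsNP; exists i; apply/not_implyP; split=> //; apply/negP; rewrite -ltNge.
have ll : `|l g - l g'| <= M * supnorm (g \- g').
  rewrite (_ : l g - l g' = a i * (g (x i) - g' (x i)) +
    b i * (g (y i) - g' (y i)) + c i * (g (z i) - g' (z i))); last by rewrite /l; ring.
  apply: (le_trans (ler_normD _ _)); apply: (le_trans (lerD (ler_normD _ _) (lexx _))).
  rewrite !normrM /M !mulrDl mul1r -[leLHS]addr0 lerD//; last first.
    exact: le_trans (le_supnorm g g' (x i)).
  by rewrite !lerD// ler_wpM2l// le_supnorm.
have : M * supnorm (g \- g') < `|l g| - r i by rewrite mulrC -ltr_pdivlMr.
have := lerB_dist (l g) (l g'); rewrite -/(l g') => h1 h2; lra.
Qed.

Lemma measurable_ev (R : realType) (t : I01 R) :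
  measurable_fun [set: C01_borel R] (fun g : C01_borel R => (g : C01 R) t).
Proof.
apply: (measurability _ (RGenOInfty.measurableE R)) => _ [_ [c ->] <-].
rewrite setTI; apply: sub_sigma_algebra => g /=; rewrite in_itv /= andbT => cg.
exists (g t - c) => [|g' gg']; first by rewrite subr_gt0.
rewrite in_itv /= andbT; have := le_supnorm g g' t.
by rewrite ler_norml => /andP[_ h]; lra.
Qed.

Definition lip_le (R : realType) (L : R) : set (C01 R) :=
  [set g | forall s t : I01 R, `|g s - g t| <= L * `|\val s - \val t|].

Lemma measurable_lip_le (R : realType) (L : R) :
  measurable (lip_le L : set (C01_borel R)).
Proof.
rewrite (_ : lip_le L = [set g : C01 R | forall i : I01 R * I01 R, True ->
   `|1 * g i.1 + (-1) * g i.2 + 0 * g i.1 + 0| <= L * `|\val i.1 - \val i.2|]).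
  exact: (@measurable_linear_bound R (I01 R * I01 R) (fun=> True) (cst 1)
    (cst (-1)) (cst 0) (cst 0) (fun i => L * `|\val i.1 - \val i.2|) fst snd fst).
apply/seteqP; split=> g gH.
  by move=> [s t] _ /=; rewrite mul1r mulN1r mul0r !addr0.
by move=> s t; have := gH (s, t) I; rewrite /= mul1r mulN1r mul0r !addr0.
Qed.

Lemma measurable_affine_on (R : realType) (a b : R) :
  measurable ([set g | affine_on g a b] : set (C01_borel R)).
Proof.
pose J := (I01 R * I01 R * I01 R)%type.
pose C (i : J) := [/\ a <= \val i.1.1 <= b, a <= \val i.1.2 <= b & a <= \val i.2 <= b].
rewrite (_ : [set g | _] = [set g : C01 R | forall i : J, C i ->
   `|(\val i.1.2 - \val i.2) * g i.1.1 + (\val i.2 - \val i.1.1) * g i.1.2 +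
     (\val i.1.1 - \val i.1.2) * g i.2 + 0| <= 0]).
  exact: (@measurable_linear_bound R J C (fun i => \val i.1.2 - \val i.2)
    (fun i => \val i.2 - \val i.1.1) (fun i => \val i.1.1 - \val i.1.2) (cst 0)
    (cst 0) (fun i => i.1.1) (fun i => i.1.2) snd).
apply/seteqP; split=> g gH.
  move=> [[x y] z] [/= xab yab zab]; rewrite normr_le0; apply/eqP.
  have := gH x y z xab yab zab => /= h.
  move: (sval x) (sval y) (sval z) h => x' y' z' h.
  by rewrite (_ : _ + _ = (g y - g x) * (z' - x') - (g z - g x) * (y' - x'));
    [rewrite h subrr|ring].
move=> x y z xab yab zab; have := gH (x, y, z) (And3 xab yab zab).
rewrite /= normr_le0 => /eqP; move: (sval x) (sval y) (sval z) => x' y' z' h.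
by move: (g x) (g y) (g z) h => gx gy gz; clear; lra.
Qed.

Lemma measurable_near_pl (R : realType) (k : nat) (b : nat -> R) (r : R) :
  measurable (near_pl k b r : set (C01_borel R)).
Proof.
pose J := (nat * I01 R * I01 R)%type.
pose C (i : J) := [/\ (i.1.1 <= k)%N,
  i.1.1%:R + 3^-1 <= k.+1%:R * \val i.1.2 <= i.1.1%:R + 2 / 3 &
  i.1.1%:R + 3^-1 <= k.+1%:R * \val i.2 <= i.1.1%:R + 2 / 3].
rewrite (_ : near_pl k b r = [set g : C01 R | forall x : I01 R, True ->
     `|1 * g x + 0 * g x + 0 * g x + (- grid_pl k b (\val x))| <= r] `&`
   [set g : C01 R | forall i : J, C i ->
     `|1 * g i.2 + (-1) * g i.1.2 + 0 * g i.2 +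
       (- (k.+1%:R * (b i.1.1.+1 - b i.1.1) * (\val i.2 - \val i.1.2)))| <=
     `|\val i.2 - \val i.1.2|]).
  apply: (@measurableI _ (C01_borel R)).
    exact: (@measurable_linear_bound R (I01 R) (fun=> True) (cst 1) (cst 0) (cst 0)
      (fun x => - grid_pl k b (\val x)) (cst r) id id id).
  exact: (@measurable_linear_bound R J C (cst 1) (cst (-1)) (cst 0)
    (fun i => - (k.+1%:R * (b i.1.1.+1 - b i.1.1) * (\val i.2 - \val i.1.2)))
    (fun i => `|\val i.2 - \val i.1.2|) snd (fun i => i.1.2) snd).
apply/seteqP; split=> g [g1 g2]; split.
- by move=> x _; rewrite mul1r !mul0r !addr0.
- by move=> [[i x] y] [/= ik xi yi]; rewrite mul1r mulN1r mul0r addr0; exact: g2.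
- by move=> x; have := g1 x I; rewrite mul1r !mul0r !addr0.
- move=> i x y ik xi yi; have := g2 (i, x, y) (And3 ik xi yi) => /=.
  by rewrite mul1r mulN1r mul0r addr0.
Qed.

(** * Outer bounds on probabilities *)

Lemma lee_natSinv (R : realType) (x : \bar R) (a K : R) :
  (forall M : nat, (x <= (a + K / M.+1%:R)%:E)%E) -> (x <= a%:E)%E.
Proof.
move=> H; apply/lee_addgt0Pr => e e0.
have [M Me] := @exists_natSinv_lt R (e / (`|K| + 1)) ltac:(by rewrite divr_gt0// ltr_wpDl).
apply: (le_trans (H M)); rewrite -EFinD lee_fin lerD2l.
apply: (@le_trans _ _ ((`|K| + 1) * M.+1%:R^-1)).
  by rewrite ler_wpM2r ?invr_ge0//; have := ler_norm K; lra.
by rewrite mulrC -ler_pdivlMr ?ltr_wpDl// ltW.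
Qed.

(** A bound on the outer probability of [A], witnessed by one measurable superset. *)
Definition outer_le (d : measure_display) (T : measurableType d) (R : realType)
    (P : probability T R) (A : set T) (c : \bar R) : Prop :=
  exists2 U, measurable U /\ A `<=` U & (P U <= c)%E.

Lemma outer_leS (d : measure_display) (T : measurableType d) (R : realType)
    (P : probability T R) (A B : set T) (c c' : \bar R) :
  A `<=` B -> (c <= c')%E -> outer_le P B c -> outer_le P A c'.
Proof.
move=> AB cc' [U [mU BU] PU]; exists U; last exact: le_trans cc'.
by split=> //; exact: subset_trans BU.
Qed.

Lemma outer_le_measurable (d : measure_display) (T : measurableType d)
    (R : realType) (P : probability T R) (A : set T) (c : \bar R) :
  measurable A -> (P A <= c)%E -> outer_le P A c.
Proof. by move=> mA PA; exists A; [split|]. Qed.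

Lemma measurable_outer_le (d : measure_display) (T : measurableType d)
    (R : realType) (P : probability T R) (A : set T) (c : \bar R) :
  measurable A -> outer_le P A c -> (P A <= c)%E.
Proof.
move=> mA [U [mU AU]]; apply: le_trans; apply: le_measure => //; exact/mem_set.
Qed.

Lemma outer_le_bigcup (d : measure_display) (T : measurableType d)
    (R : realType) (P : probability T R) (A : nat -> set T) (c : nat -> \bar R) :
  (forall n, outer_le P (A n) (c n)) ->
  outer_le P (\bigcup_n A n) (\sum_(n <oo) c n)%E.
Proof.
move=> H; have /choice[U UH] : forall n, exists U, [/\ measurable U, A n `<=` U & (P U <= c n)%E].
  by move=> n; have [U [mU AU] PU] := H n; exists U.
have mU : measurable (\bigcup_n U n) by apply: bigcupT_measurable => n; have [] := UH n.
exists (\bigcup_n U n).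
  by split=> // w [n _ Aw]; exists n => //; have [_ AU _] := UH n; exact: AU.
apply: (@le_trans _ _ (\sum_(n <oo) P (U n))%E).
  by apply: measure_sigma_subadditive => // n; have [] := UH n.
by apply: lee_nneseries => // n _; have [] := UH n.
Qed.

Lemma outer_leU (d : measure_display) (T : measurableType d)
    (R : realType) (P : probability T R) (A B : set T) (a b : \bar R) :
  outer_le P A a -> outer_le P B b -> outer_le P (A `|` B) (a + b)%E.
Proof.
move=> [U [mU AU] PU] [V [mV BV] PV]; exists (U `|` V).
  by split; [exact: measurableU|exact: setUSS].
by apply: (le_trans (measureU2 _ mU mV)); exact: leeD.
Qed.

Lemma outer_le_set0 (d : measure_display) (T : measurableType d)
    (R : realType) (P : probability T R) : outer_le P set0 0%E.
Proof. by exists set0; [split|rewrite measure0]. Qed.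

Lemma outer_le_bigcup_nat (d : measure_display) (T : measurableType d)
    (R : realType) (P : probability T R) (A : nat -> set T) (n : nat) (c : R) :
  (forall i, (i < n)%N -> outer_le P (A i) c%:E) ->
  outer_le P (\bigcup_(i in `I_n) A i) (n%:R * c)%:E.
Proof.
elim: n => [|n IH] H; first by rewrite II0 bigcup_set0 mul0r; exact: outer_le_set0.
rewrite IIS bigcup_setU bigcup_set1 -natr1 mulrDl mul1r EFinD.
apply: outer_leU; last exact: H.
by apply: IH => i ni; apply: H; exact: ltnW.
Qed.

Lemma outer_le_negligible (d : measure_display) (T : measurableType d)
    (R : realType) (P : probability T R) (A : set T) :
  P.-negligible A -> outer_le P A 0%E.
Proof. by move=> [U [mU PU AU]]; exists U; [split|rewrite PU]. Qed.

Lemma negligible_outer_le (d : measure_display) (T : measurableType d)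
    (R : realType) (P : probability T R) (A : set T) (K : R) :
  (forall n : nat, outer_le P A (K / n.+1%:R)%:E) -> P.-negligible A.
Proof.
move=> H; have /choice[U UH] : forall n, exists U,
    [/\ measurable U, A `<=` U & (P U <= (K / n.+1%:R)%:E)%E].
  by move=> n; have [U [mU AU] PU] := H n; exists U.
have mU : measurable (\bigcap_n U n) by apply: bigcapT_measurable => n; have [] := UH n.
exists (\bigcap_n U n); split=> //; last first.
  by move=> w Aw n _; have [_ AU _] := UH n; exact: AU.
have PU n : (P (\bigcap_n U n) <= (K / n.+1%:R)%:E)%E.
  have [mUn _ PUn] := UH n; apply: le_trans PUn; apply: le_measure; rewrite ?inE//.
  exact: bigcap_inf.
apply/eqP; rewrite eq_le measure_ge0 andbT.
by apply: (@lee_natSinv R _ 0 K) => n; rewrite add0r.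
Qed.

(* Conditioning on a countably valued [D] without conditional probabilities. *)
Lemma outer_le_cond (d : measure_display) (T : measurableType d)
    (R : realType) (P : probability T R) (I : countType) (D : T -> I)
    (S E : set T) (c : R) : measurable S ->
  (forall i, measurable (D @^-1` [set i])) ->
  (forall i, outer_le P (S `&` D @^-1` [set i] `&` E)
                        (P (S `&` D @^-1` [set i]) * c%:E)%E) ->
  0 <= c -> outer_le P (S `&` E) (P S * c%:E)%E.
Proof.
move=> mS mD H c0.
pose A n := S `&` (choice.pickle \o D) @^-1` [set n].
have mA n : measurable (A n).
  apply: measurableI => //; have [[i iE]|nE] := pselect (exists i : I, choice.pickle i = n).
    rewrite (_ : _ @^-1` _ = D @^-1` [set i])//.
    apply/seteqP; split=> w /=; last by move=> ->.
    by move=> Dw; apply: (pcan_inj choice.pickleK); rewrite Dw.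
  rewrite (_ : _ @^-1` _ = set0)//; apply/seteqP; split=> w //= Dw.
  by apply: nE; exists (D w).
have HA n : outer_le P (A n `&` E) (P (A n) * c%:E)%E.
  have [[i iE]|nE] := pselect (exists i : I, choice.pickle i = n).
    rewrite (_ : A n = S `&` D @^-1` [set i])//; rewrite /A; congr (_ `&` _).
    apply/seteqP; split=> w /=; last by move=> ->.
    by move=> Dw; apply: (pcan_inj choice.pickleK); rewrite Dw.
  rewrite (_ : A n = set0) ?set0I ?measure0 ?mul0e; first exact: outer_le_set0.
  by apply/seteqP; split=> w // [_ /= Dw]; apply: nE; exists (D w).
have := outer_le_bigcup HA; apply: outer_leS.
  by move=> w [Sw Ew]; exists (choice.pickle (D w)).
under eq_eseriesr do rewrite muleC.
rewrite nneseriesZl// muleC lee_wpmul2r ?lee_fin//.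
have <- : \bigcup_n A n = S.
  by apply/seteqP; split=> [w [n _ []]//|w Sw]; exists (choice.pickle (D w)).
rewrite measure_semi_bigcup//; last exact: bigcupT_measurable.
by move=> i j _ _ [w [[_ /= <-] [_ /= <-]]].
Qed.

Lemma mutually_independent_split (d : measure_display) (T : measurableType d)
    (R : realType) (P : probability T R) (I : choiceType) (F : I -> set (set T))
    (J : {fset I}) (l : I) (E : I -> set T) :
  mutually_independent P F -> l \notin J ->
  (forall i, i \in J -> F i (E i)) -> F l (E l) ->
  P (\bigcap_(i in [set` J]) E i `&` E l) =
    (P (\bigcap_(i in [set` J]) E i) * P (E l))%E.
Proof.
move=> ind lJ FJ Fl; rewrite (ind J E FJ).
rewrite (_ : _ `&` _ = \bigcap_(i in [set` (l |` J)%fset]) E i); last first.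
  apply/seteqP; split=> [w [wJ wl] i /=|w wJ].
    by rewrite !inE => /orP[/eqP ->//|iJ]; exact: wJ.
  split=> [i /= iJ|]; apply: wJ => /=; first by rewrite !inE iJ orbT.
  by rewrite !inE eqxx.
rewrite ind; last first.
  by move=> i; rewrite !inE => /orP[/eqP ->//|iJ]; exact: FJ.
by rewrite big_fsetU1//= muleC.
Qed.

(** * Polylines *)

Lemma nth_knots_last (R : realType) (n : nat) (x : nat -> R) :
  (knots n x)`_n.+1 = 1.
Proof. by rewrite /knots /= nth_rcons size_sort size_mkseq ltnn eqxx. Qed.

Lemma nth_knots_mid (R : realType) (n : nat) (x : nat -> R) (i : nat) :
  (i < n)%N -> (knots n x)`_i.+1 = (sort <=%R (mkseq x n))`_i.
Proof. by move=> ni; rewrite /knots /= nth_rcons size_sort size_mkseq ni. Qed.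

Lemma nth_knots_mem (R : realType) (n : nat) (x : nat -> R) (i : nat) :
  (i < n)%N -> exists2 j, (j < n)%N & (knots n x)`_i.+1 = x j.
Proof.
move=> ni; rewrite nth_knots_mid//.
have : (sort <=%R (mkseq x n))`_i \in mkseq x n.
  by rewrite -(mem_sort <=%R) mem_nth// size_sort size_mkseq.
by move=> /mapP[j]; rewrite mem_iota add0n => /andP[_ jn] ->; exists j.
Qed.

Lemma polyline_point (R : realType) (n : nat) (x y : nat -> R) (g : C01 R)
    (i : nat) (s : R) : graph g = polyline n x y -> (i <= n)%N -> 0 <= s <= 1 ->
  let u := (1 - s) * (knots n x)`_i + s * (knots n x)`_i.+1 in
  0 <= u <= 1 /\ ev g u = (1 - s) * y i + s * y i.+1.
Proof.
move=> gE ni s01 u.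
have : polyline n x y (u, (1 - s) * y i + s * y i.+1).
  by exists i; split=> //; exists s; split.
rewrite -gE => -[t _ /= [tE <-]]; rewrite -tE; split; first exact: I01_bound.
exact: ev_val.
Qed.

Lemma polyline_cover (R : realType) (n : nat) (x y : nat -> R) (g : C01 R)
    (u : R) : graph g = polyline n x y -> 0 <= u <= 1 ->
  exists i (s : R), [/\ (i <= n)%N, 0 <= s <= 1 &
    u = (1 - s) * (knots n x)`_i + s * (knots n x)`_i.+1].
Proof.
move=> gE u01; have : graph g (u, ev g u).
  by exists (clamp01 u) => //; rewrite val_clamp01.
rewrite gE => -[i [ni [s [s01 [uE _]]]]]; exists i, s; split=> //.
Qed.

Lemma polyline_knot (R : realType) (n : nat) (x y : nat -> R) (g : C01 R)
    (i : nat) : graph g = polyline n x y -> (i <= n.+1)%N ->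
  0 <= (knots n x)`_i <= 1 /\ ev g (knots n x)`_i = y i.
Proof.
move=> gE; rewrite leq_eqVlt => /orP[/eqP ->|].
  have := polyline_point gE (leqnn n) (_ : 0 <= 1 <= 1); rewrite lexx ler01.
  by move=> /(_ isT) /=; rewrite subrr !mul0r !mul1r !add0r.
rewrite ltnS => ni; have := polyline_point gE ni (_ : 0 <= 0 <= 1).
by rewrite lexx ler01 => /(_ isT) /=; rewrite subr0 !mul0r !mul1r !addr0.
Qed.

Lemma polyline_sorted (R : realType) (n : nat) (x y : nat -> R) (g : C01 R)
    (i : nat) : graph g = polyline n x y -> (i <= n)%N ->
  (knots n x)`_i <= (knots n x)`_i.+1.
Proof.
move=> gE ni; have [/andP[k0 _] _] := polyline_knot gE (ni : (i.+1 <= n.+1)%N).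
case: i ni k0 => [//|i ni k0].
have [/andP[_ k1] _] := polyline_knot gE (leqW ni).
have [in_|ni'] := ltnP i.+1 n; last first.
  have nE : n = i.+1 by apply/eqP; rewrite eqn_leq ni ni'.
  by subst n; rewrite nth_knots_last.
rewrite !nth_knots_mid//.
have /(sortedP 0) : sorted <=%R (sort <=%R (mkseq x n)) by apply: sort_sorted; exact: le_total.
by apply; rewrite size_sort size_mkseq.
Qed.

(** The bound on the slope by any Lipschitz constant of [g] serves to control the effect of rounding
    the knots. A segment between equal knots gets slope 0. *)
Lemma polyline_affine (R : realType) (n : nat) (x y : nat -> R) (g : C01 R)
    (i : nat) : graph g = polyline n x y -> (i <= n)%N ->
  exists sl : R,
    (forall u, (knots n x)`_i <= u <= (knots n x)`_i.+1 ->
      ev g u = y i + sl * (u - (knots n x)`_i)) /\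
    (forall L : R, 0 <= L -> lip_le L g -> `|sl| <= L).
Proof.
move=> gE ni.
have [p01 pE] := polyline_knot gE (leqW ni).
have [q01 qE] := polyline_knot gE (ni : (i.+1 <= n.+1)%N).
have pq := polyline_sorted gE ni.
have pt s := @polyline_point R n x y g i s gE ni.
move: (knots n x)`_i (knots n x)`_i.+1 p01 pE q01 qE pq pt => p q p01 pE q01 qE pq pt.
have [pq'|pq'] := eqVneq p q.
  exists 0; split=> [u|L L0 _]; last by rewrite normr0.
  by rewrite -pq' => /le_anti <-; rewrite mul0r addr0.
have qp : 0 < q - p by rewrite subr_gt0 lt_neqAle pq'.
have qp' : q - p != 0 by rewrite gt_eqF.
exists ((y i.+1 - y i) / (q - p)); split=> [u /andP[pu uq]|L L0 lL].
  pose s := (u - p) / (q - p).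
  have s01 : 0 <= s <= 1.
    by rewrite divr_ge0 ?subr_ge0 ?(ltW qp)//= ler_pdivrMr// mul1r lerB.
  have [_] := pt s s01.
  rewrite (_ : (1 - s) * p + s * q = u); last by rewrite /s; field.
  by move=> ->; rewrite /s; field.
rewrite normrM normfV (gtr0_norm qp) ler_pdivrMr// -qE -pE.
have := lL (clamp01 q) (clamp01 p).
by rewrite (val_clamp01 q01) (val_clamp01 p01) (gtr0_norm qp).
Qed.

Lemma lip_concat (R : realType) (u : R -> R) (a b c K L : R) : a <= b -> b <= c ->
  (forall x y, a <= x <= b -> a <= y <= b -> `|u x - u y| <= K * `|x - y|) ->
  (forall x y, b <= x <= c -> b <= y <= c -> `|u x - u y| <= L * `|x - y|) ->
  0 <= K -> 0 <= L ->
  forall x y, a <= x <= c -> a <= y <= c -> `|u x - u y| <= (K + L) * `|x - y|.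
Proof.
move=> ab bc uK uL K0 L0.
suff W x y : x <= y -> a <= x <= c -> a <= y <= c ->
    `|u x - u y| <= (K + L) * `|x - y|.
  move=> x y xa ya; have [xy|/ltW xy] := leP x y; first exact: W.
  by rewrite distrC (distrC x); exact: W.
move=> xy /andP[ax xc] /andP[ay yc].
have KL z : 0 <= z -> K * z <= (K + L) * z by move=> z0; rewrite ler_wpM2r// lerDl.
have LK z : 0 <= z -> L * z <= (K + L) * z by move=> z0; rewrite ler_wpM2r// lerDr.
have [yb|by_] := leP y b.
  by apply: le_trans (KL _ (normr_ge0 _)); apply: uK; rewrite ?ax ?ay ?yb ?(le_trans xy yb).
have [bx|xb] := leP b x.
  apply: le_trans (LK _ (normr_ge0 _)); apply: uL; first by rewrite bx.
  by rewrite (ltW by_).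
have H1 := uK x b; rewrite ax (ltW xb) ab lexx in H1; have {}H1 := H1 isT isT.
have H2 := uL b y; rewrite (ltW by_) yc bc lexx in H2; have {}H2 := H2 isT isT.
rewrite (_ : u x - u y = (u x - u b) + (u b - u y)); last by ring.
apply: (le_trans (ler_normD _ _)); apply: (le_trans (lerD H1 H2)).
rewrite !ler0_norm ?subr_le0 ?(ltW xb) ?(ltW by_)// !opprB.
by clear -K0 L0 xb by_; nra.
Qed.

(** The sum of the absolute slopes is a Lipschitz constant. It is rounded up to an integer so that a
    countable union of Borel sets contains all polylines. *)
Lemma polyline_lipschitz (R : realType) (n : nat) (x y : nat -> R) (g : C01 R) :
  graph g = polyline n x y -> exists L : nat, lip_le L%:R g.
Proof.
move=> gE; pose a i := (knots n x)`_i.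
have H i : (i <= n.+1)%N -> exists2 L : R, 0 <= L & forall u v, 0 <= u <= a i ->
    0 <= v <= a i -> `|ev g u - ev g v| <= L * `|u - v|.
  elim: i => [_|i IH ni].
    by exists 0 => // u v; rewrite /a /= => /le_anti <- /le_anti <-; rewrite !subrr normr0 mulr0.
  have [L L0 LH] := IH (leqW ni).
  have [sl [slH _]] := polyline_affine gE ni.
  have [/andP[ai0 _] _] := polyline_knot gE (leqW ni).
  exists (L + `|sl|); first by rewrite addr_ge0.
  apply: (@lip_concat R (ev g) 0 (a i) (a i.+1)) => //.
    exact: polyline_sorted gE ni.
  move=> u v ui vi; rewrite !slH// (_ : _ - _ = sl * (u - v)) ?normrM//; ring.
have [L L0 LH] := H n.+1 (leqnn _); rewrite /a nth_knots_last in LH.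
exists (Num.truncn L).+1 => s t.
apply: (@le_trans _ _ (L * `|\val s - \val t|)).
  by rewrite -!(ev_val g); apply: LH; exact: I01_bound.
by rewrite ler_wpM2r// ltW// truncnS_gt.
Qed.

(** Two points of the window that lie on no common segment are separated by an interior knot, which
    is some [x i] in the window. *)
Lemma polyline_affine_on (R : realType) (n : nat) (x y : nat -> R) (g : C01 R)
    (a b : R) : graph g = polyline n x y ->
  (forall i, (i < n)%N -> ~ (a <= x i <= b)) -> affine_on g a b.
Proof.
move=> gE nx.
have knots_out i : (0 < i)%N -> (i <= n)%N -> ~ (a <= (knots n x)`_i <= b).
  by case: i => // i _ ni; have [j jn ->] := nth_knots_mem x ni; exact: nx.
have seg (u v : R) : 0 <= u <= 1 -> 0 <= v <= 1 -> a <= u <= b -> a <= v <= b ->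
    forall i, (i <= n)%N -> (knots n x)`_i <= u <= (knots n x)`_i.+1 ->
    (knots n x)`_i <= v <= (knots n x)`_i.+1.
  move=> /andP[u0 u1] /andP[v0 v1] /andP[au ub] /andP[av vb] i ni /andP[iu ui].
  apply/andP; split; rewrite leNgt; apply/negP => vi.
    case: i ni iu ui vi => [|i] ni iu ui vi; first by move: vi; rewrite /= ltNge v0.
    by apply: (knots_out i.+1) => //; apply/andP; split; lra.
  move: ni; rewrite leq_eqVlt => /orP[/eqP ni|ni].
    by move: vi; rewrite ni nth_knots_last; lra.
  by apply: (knots_out i.+1) => //; apply/andP; split; lra.
move=> u v w uab vab wab.
have [i [s [ni /andP[s0 s1] uE]]] := polyline_cover gE (I01_bound u).
have ui : (knots n x)`_i <= \val u <= (knots n x)`_i.+1.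
  have := polyline_sorted gE ni; rewrite uE => pq.
  by move: (nth _ _ i) (nth _ _ i.+1) pq => p q pq; apply/andP; split; nra.
have vi := seg _ _ (I01_bound u) (I01_bound v) uab vab i ni ui.
have wi := seg _ _ (I01_bound u) (I01_bound w) uab wab i ni ui.
have [sl [slH _]] := polyline_affine gE ni.
rewrite -!(ev_val g) (slH _ ui) (slH _ vi) (slH _ wi).
by move: (\val u) (\val v) (\val w) => u' v' w'; ring.
Qed.

(** * The law of the random polyline *)

Lemma normal_prob_itv_le (R : realType) (a b : R) : a <= b ->
  (normal_prob 0 1 `[a, b] <= (normal_peak 1 * (b - a))%:E)%E.
Proof.
move=> ab; rewrite /normal_prob.
apply: (@le_trans _ _ (\int[lebesgue_measure]_(x in `[a, b]) (normal_peak (1 : R))%:E)%E).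
  apply: ge0_le_integral => //=.
  - by move=> x _; rewrite lee_fin normal_pdf_ge0.
  - apply/measurable_EFinP; apply: measurable_funTS; exact: measurable_normal_pdf.
  - by move=> x _; rewrite lee_fin normal_pdf_ub// oner_eq0.
rewrite integral_cst//= lebesgue_measure_itv /= lte_fin.
case: ltP => _; first by rewrite -EFinD -EFinM.
by rewrite mule0 lee_fin mulr_ge0 ?normal_peak_ge0// subr_ge0.
Qed.

Lemma normal_prob_itv_gt0 (R : realType) (a b : R) : a < b ->
  exists2 c : R, 0 < c & (c%:E <= normal_prob 0 1 `[a, b])%E.
Proof.
move=> ab; have o0 : 1 != 0 :> R by rewrite oner_eq0.
have cp : {within `[a, b], continuous (@normal_pdf R 0 1)}.
  by apply: continuous_subspaceT; exact: continuous_normal_pdf.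
have [z _ zH] := EVT_min (ltW ab) cp.
have z0 : 0 < normal_pdf 0 1 z.
  by rewrite normal_pdfE// mulr_gt0 ?normal_peak_gt0// expR_gt0.
exists (normal_pdf 0 1 z * (b - a)); first by rewrite mulr_gt0// subr_gt0.
rewrite /normal_prob.
apply: (@le_trans _ _ (\int[lebesgue_measure]_(x in `[a, b]) (normal_pdf 0 1 z)%:E)%E).
  by rewrite integral_cst//= lebesgue_measure_itv /= lte_fin ab -EFinD -EFinM.
apply: ge0_le_integral => //=.
- by move=> x _; rewrite lee_fin normal_pdf_ge0.
- apply/measurable_EFinP; apply: measurable_funTS; exact: measurable_normal_pdf.
Qed.

Lemma uniform_prob_itv_le (R : realType) (a b : R) : a <= b ->
  (uniform_prob (@ltr01 R) `[a, b] <= (b - a)%:E)%E.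
Proof.
move=> ab; rewrite /uniform_prob.
apply: (@le_trans _ _ (\int[lebesgue_measure]_(x in `[a, b]) (1 : R)%:E)%E).
  apply: ge0_le_integral => //=.
  - by move=> x _; rewrite lee_fin uniform_pdf_ge0.
  - apply/measurable_EFinP; apply: measurable_funTS; exact: measurable_uniform_pdf.
  - move=> x _; rewrite lee_fin /uniform_pdf subr0 invr1; by case: ifP.
rewrite integral_cst//= lebesgue_measure_itv /= lte_fin mul1e.
by case: ltP => _; rewrite -?EFinD// lee_fin subr_ge0.
Qed.

Lemma uniform_prob_itv_ge (R : realType) (a b : R) : 0 <= a -> a < b -> b <= 1 ->
  ((b - a)%:E <= uniform_prob (@ltr01 R) `[a, b])%E.
Proof.
move=> a0 ab b1; rewrite /uniform_prob.
apply: (@le_trans _ _ (\int[lebesgue_measure]_(x in `[a, b]) (1 : R)%:E)%E).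
  by rewrite integral_cst//= lebesgue_measure_itv /= lte_fin ab mul1e -EFinD.
apply: ge0_le_integral => //=.
- apply/measurable_EFinP; apply: measurable_funTS; exact: measurable_uniform_pdf.
- move=> x; rewrite in_itv /= => /andP[ax xb]; rewrite lee_fin /uniform_pdf subr0 invr1.
  by rewrite (le_trans a0 ax) (le_trans xb b1).
Qed.

Lemma poisson_pmf1S (R : realType) (k : nat) :
  k.+1%:R * poisson_pmf (1 : R) k.+1 = poisson_pmf 1 k.
Proof.
rewrite /poisson_pmf ltr01 !expr1n !mul1r factS natrM invfM mulrA mulrA.
by rewrite divff ?mul1r// pnatr_eq0.
Qed.

(** The identity [(k + 1) p(k + 1) = p(k)] shifts the sum for the mean onto the total mass. *)
Lemma poisson_mean1 (R : realType) :
  (\sum_(k <oo) (k%:R * poisson_pmf (1 : R) k)%:E =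
   \sum_(k <oo) (poisson_pmf (1 : R) k)%:E)%E.
Proof.
have f0 k : (0 <= (k%:R * poisson_pmf (1 : R) k)%:E)%E.
  by rewrite lee_fin mulr_ge0// poisson_pmf_ge0.
rewrite [LHS]nneseries_recl// mulr0n mul0r add0e -nneseries_addn//.
by apply: eq_eseriesr => k _; rewrite addn1 poisson_pmf1S.
Qed.

Lemma sigma_of_preimage (d d' : measure_display) (T : measurableType d)
    (T' : measurableType d') (X : T -> T') (B : set T') :
  measurable B -> sigma_of X (X @^-1` B).
Proof. by move=> mB; exists B => //; rewrite setTI. Qed.

(** * Rounding to cells and the density of a value *)

Definition gfloor (R : realType) (M : nat) (r : R) : int := Num.floor (M.+1%:R * r).

Lemma gfloor_itv (R : realType) (M : nat) (r : R) (z : int) :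
  gfloor M r = z <-> z%:~R / M.+1%:R <= r /\ r < z%:~R / M.+1%:R + M.+1%:R^-1.
Proof.
have M0 : 0 < M.+1%:R :> R by [].
rewrite -[X in _ / _ + X]mul1r -mulrDl ler_pdivrMr// ltr_pdivlMr// [r * _]mulrC.
split=> [<-|[h1 h2]].
  by rewrite -[1]/(1%:~R) -rmorphD; split; [exact: floor_le_tmp|exact: floorD1_gt].
by apply: floor_def; rewrite h1 rmorphD.
Qed.

Lemma measurable_gfloor (R : realType) (M : nat) (z : int) :
  measurable ((@gfloor R M) @^-1` [set z]).
Proof.
rewrite (_ : _ @^-1` _ = `[z%:~R / M.+1%:R, z%:~R / M.+1%:R + M.+1%:R^-1[%classic).
  exact: measurable_itv.
apply/seteqP; split=> r /=; rewrite in_itv /=.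
  by move=> /gfloor_itv[-> ->].
by move=> /andP[? ?]; apply/gfloor_itv.
Qed.

(** Once the cell of [Y] is known, [a * Y] is known up to [M.+1%:R^-1], so [Z] is confined to an
    interval of length [(hi - lo + M.+1%:R^-1) / b], where [b^-1 <= 2]. The cell of [Y] together
    with [S] is independent of [Z]. *)
Lemma linear_combination_bound (d : measure_display) (T : measurableType d)
    (R : realType) (P : probability T R) (Y Z : {RV P >-> R}) (S : set T)
    (kap a b lo hi : R) (M : nat) : measurable S -> 0 <= kap ->
  (forall A B : set R, measurable A -> measurable B ->
     P (S `&` Y @^-1` A `&` Z @^-1` B) = (P (S `&` Y @^-1` A) * P (Z @^-1` B))%E) ->
  (forall u v : R, u <= v -> (P (Z @^-1` `[u, v]) <= (kap * (v - u))%:E)%E) ->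
  0 <= a <= 1 -> 2^-1 <= b -> lo <= hi ->
  outer_le P (S `&` [set w | lo <= a * Y w + b * Z w <= hi])
    (P S * (2 * kap * (hi - lo + M.+1%:R^-1))%:E)%E.
Proof.
move=> mS kap0 ind dens /andP[a0 a1] b2 lohi.
have b0 : 0 < b by lra.
have mD i : measurable ((gfloor M \o Y) @^-1` [set i]).
  rewrite comp_preimage -[_ @^-1` (_ @^-1` _)]setTI.
  by apply: (@measurable_funPT _ _ _ _ Y) => //; exact: measurable_gfloor.
have [iM M0 iME] : exists2 iM : R, 0 < iM & M.+1%:R^-1 = iM.
  by exists (M.+1%:R^-1) => //; rewrite invr_gt0.
rewrite iME.
apply: (outer_le_cond mS mD); last by rewrite mulr_ge0 ?mulr_ge0//; clear -lohi M0; lra.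
move=> z; pose Az := (@gfloor R M) @^-1` [set z].
pose u := (lo - a * (z%:~R * iM) - iM) / b.
pose v := (hi - a * (z%:~R * iM)) / b.
have uv : u <= v by rewrite /u /v ler_pM2r ?invr_gt0//; lra.
have mZ : measurable (Z @^-1` `[u, v]).
  by rewrite -[_ @^-1` _]setTI; apply: (@measurable_funPT _ _ _ _ Z) => //; exact: measurable_itv.
have sub : S `&` (gfloor M \o Y) @^-1` [set z] `&` [set w | lo <= a * Y w + b * Z w <= hi]
    `<=` S `&` Y @^-1` Az `&` Z @^-1` `[u, v].
  move=> w [[Sw /= Dw] /andP[w1 w2]]; split=> //=; rewrite in_itv /=.
  have /gfloor_itv := Dw; rewrite iME => -[f1 f2].
  have h1 : a * (z%:~R * iM) <= a * Y w by rewrite ler_wpM2l.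
  have h2 : a * Y w <= a * (z%:~R * iM) + iM.
    have : a * (Y w - z%:~R * iM) <= 1 * iM.
      by apply: ler_pM => //; rewrite ?subr_ge0//; lra.
    by rewrite mulrBr mul1r; lra.
  by rewrite /u /v ler_pdivrMr// ler_pdivlMr// ![Z w * b]mulrC; apply/andP; split; lra.
apply: (outer_leS sub (lexx _)); apply: outer_le_measurable.
  by apply: measurableI => //; apply: measurableI => //; exact: mD.
rewrite ind//; last exact: measurable_gfloor.
apply: lee_wpmul2l => //; apply: (le_trans (dens _ _ uv)); rewrite lee_fin.
rewrite -mulrA [X in _ <= X]mulrCA ler_wpM2l// /u /v -mulrBl.
rewrite (_ : _ - _ - _ = hi - lo + iM); last by ring.
by rewrite mulrC ler_wpM2r//; [lra|rewrite -[2]invrK lef_pV2 ?posrE ?invr_gt0].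
Qed.

Definition cell_of (R : realType) (M : nat) (r : R) : R :=
  (gfloor M r)%:~R / M.+1%:R.

Lemma cell_of_bound (R : realType) (M : nat) (r : R) :
  cell_of M r <= r < cell_of M r + M.+1%:R^-1.
Proof. by have /gfloor_itv[-> ->] := erefl (gfloor M r). Qed.

Lemma cell_of_mono (R : realType) (M : nat) :
  {homo (@cell_of R M) : x y / x <= y}.
Proof.
move=> x y xy; rewrite /cell_of ler_pM2r ?invr_gt0// ler_int.
by apply: le_floor; rewrite ler_pM2l.
Qed.

(** Rounding down is monotone, hence commutes with sorting. The end knots 0 and 1 are not
    rounded. *)
Lemma knots_cell (R : realType) (M n : nat) (x : nat -> R) (i : nat) :
  (i <= n.+1)%N ->
  (knots n (fun i => cell_of M (x i)))`_i <= (knots n x)`_i <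
  (knots n (fun i => cell_of M (x i)))`_i + M.+1%:R^-1.
Proof.
have M0 : 0 < M.+1%:R^-1 :> R by rewrite invr_gt0.
case: i => [_|i]; first by rewrite /= lexx add0r.
rewrite ltnS leq_eqVlt => /orP[/eqP ->|ni].
  by rewrite !nth_knots_last lexx ltrDl.
rewrite !nth_knots_mid//.
have -> : sort <=%R (mkseq (fun i => cell_of M (x i)) n) =
    map (cell_of M) (sort <=%R (mkseq x n)).
  apply: (@sorted_eq _ <=%R); [exact: le_trans|exact: le_anti| | |].
  - by apply: sort_sorted; exact: le_total.
  - apply: (homo_sorted (@cell_of_mono R M)).
    by apply: sort_sorted; exact: le_total.
  - rewrite perm_sort perm_sym.
    rewrite (_ : mkseq (fun i => cell_of M (x i)) n = map (cell_of M) (mkseq x n)); last first.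
      by rewrite /mkseq -map_comp.
    by apply: perm_map; rewrite perm_sort.
rewrite (nth_map 0) ?size_sort ?size_mkseq//; exact: cell_of_bound.
Qed.

Lemma eq_knots (R : realType) (n : nat) (x x' : nat -> R) :
  (forall i, (i < n)%N -> x i = x' i) -> knots n x = knots n x'.
Proof.
move=> xx'; rewrite /knots; congr (_ :: rcons (sort _ _) _).
rewrite /mkseq; apply/eq_in_map => i; rewrite mem_iota add0n => /andP[_]; exact: xx'.
Qed.

(** The left knot is rounded down to [p] and the right one up to [q], so [c] lies between them and
    [p < q]. The weight [t] depends on the cells only. The error is the slope times
    [(1 - t) * (a - p) + t * (b - q)], with [a] and [b] the true knots, and both offsets are at most
    one cell. *)
Lemma polyline_cell_value (R : realType) (n : nat) (x y : nat -> R) (g : C01 R)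
    (M : nat) (L : R) (c : I01 R) (i : nat) : graph g = polyline n x y ->
  0 <= L -> lip_le L g -> (i <= n)%N ->
  (knots n x)`_i <= \val c <= (knots n x)`_i.+1 ->
  let p := (knots n (fun i => cell_of M (x i)))`_i in
  let q := (knots n (fun i => cell_of M (x i)))`_i.+1 + M.+1%:R^-1 in
  let t := (\val c - p) / (q - p) in
  0 <= t <= 1 /\ `|(1 - t) * y i + t * y i.+1 - g c| <= L / M.+1%:R.
Proof.
move=> gE L0 lL ni ci p q.
have M0 : 0 < M.+1%:R^-1 :> R by rewrite invr_gt0.
have [sl [slH slL]] := polyline_affine gE ni.
have {slL}slL := slL L L0 lL.
have /andP[p1 p2] := knots_cell M x (leqW ni).
have /andP[q1 q2] := knots_cell M x (ni : (i.+1 <= n.+1)%N).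
have kk := polyline_sorted gE ni.
have [_ yi1] := polyline_knot gE (ni : (i.+1 <= n.+1)%N).
rewrite -/p in p1 p2; rewrite -/q in q2.
have {q1}q1 : q - M.+1%:R^-1 <= (knots n x)`_i.+1 by rewrite /q addrK.
have gc := slH _ ci; rewrite ev_val in gc.
have := slH (knots n x)`_i.+1; rewrite kk lexx yi1 => /(_ isT) {slH} yi.
rewrite gc yi; clear gc yi yi1.
move: (M.+1%:R^-1) M0 p2 q1 => nu M0 p2 q1.
clearbody p q.
move: (\val c) (knots n x)`_i (knots n x)`_i.+1 ci kk p1 p2 q1 q2 =>
  c' a b /andP[ac cb] ab pa ap qb bq t.
have pq : 0 < q - p by lra.
have t01 : 0 <= t <= 1.
  by rewrite /t divr_ge0 ?ler_pdivrMr ?mul1r//=; lra.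
split=> //.
have cE : c' = (1 - t) * p + t * q by rewrite /t; field; rewrite gt_eqF.
rewrite [X in `|X|](_ : _ = sl * ((1 - t) * (a - p) + t * (b - q))); last first.
  rewrite (_ : sl * (c' - a) = sl * ((1 - t) * p + t * q - a)); first by ring.
  by rewrite -cE.
rewrite normrM; apply: ler_pM => //.
have := @convex_dist R t (a - p) (b - q) 0 nu t01; rewrite !subr0.
by apply; rewrite ler_norml; apply/andP; split; lra.
Qed.

Definition PL_index (k : nat) : {fset option (nat + nat)} :=
  [fset j in None :: map (fun i => Some (inl i)) (iota 0 k)]%fset.

Lemma PL_indexP (k : nat) (j : option (nat + nat)) :
  j \in PL_index k <-> j = None \/ exists2 i, (i < k)%N & j = Some (inl i).
Proof.
rewrite /PL_index !inE /=; split.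
  case/orP => [/eqP ->|/mapP[i]]; first by left.
  by rewrite mem_iota add0n => /andP[_ ik] ->; right; exists i.
case=> [->//|[i ik ->]]; apply/orP; right; apply/mapP; exists i => //.
by rewrite mem_iota.
Qed.

Lemma RV_preimage_measurable (d d' : measure_display) (T : measurableType d)
    (T' : measurableType d') (X : {mfun T >-> T'}) (B : set T') :
  measurable B -> measurable (X @^-1` B).
Proof.
by move=> mB; rewrite -[_ @^-1` _]setTI; apply: (@measurable_funPT _ _ _ _ X).
Qed.

Definition cell_event (d : measure_display) (T : measurableType d)
    (R : realType) (P : probability T R) (n : {RV P >-> nat})
    (x : nat -> {RV P >-> R}) (M k : nat) (m : seq int)
    (Y : nat -> set T) (j : option (nat + nat)) : set T :=
  match j with
  | None => n @^-1` [set k]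
  | Some (inl i) => x i @^-1` (@gfloor R M @^-1` [set m`_i])
  | Some (inr i) => Y i
  end.

(** The independence hypothesis of [linear_combination_bound], with [S] the event that [n] and the
    cells of the first [k] abscissas are given. *)
Lemma cell_event_indep (d : measure_display) (T : measurableType d)
    (R : realType) (P : probability T R) (n : {RV P >-> nat})
    (x y : nat -> {RV P >-> R}) (g : {RV P >-> C01_borel R}) (M k : nat)
    (m : seq int) (j j' : nat) (A B : set R) :
  PL_construction n x y g -> j != j' -> measurable A -> measurable B ->
  let S := \bigcap_(i in [set` PL_index k])
             cell_event n x M k m (fun=> setT) i in
  P (S `&` y j @^-1` A `&` y j' @^-1` B) =
    (P (S `&` y j @^-1` A) * P (y j' @^-1` B))%E.
Proof.
move=> [_ _ _ ind _] jj mA mB S.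
pose Y i := if i == j then y j @^-1` A else y j' @^-1` B.
pose E := cell_event n x M k m Y.
pose J := (Some (inr j) |` PL_index k)%fset.
have nP z : Some (inr z) \notin PL_index k.
  by apply/negP => /PL_indexP[//|[i _]].
have SE : S `&` y j @^-1` A = \bigcap_(i in [set` J]) E i.
  apply/seteqP; split=> [w [Sw Aw] i /=|w H].
    rewrite in_fset1U => /orP[/eqP ->|iJ]; first by rewrite /E /= /Y eqxx.
    by have := Sw i iJ; case/PL_indexP: iJ => [->//|[z _ ->]].
  split=> [i /= iJ|]; last first.
    by have := H (Some (inr j)); rewrite /= in_fset1U eqxx => /(_ isT); rewrite /E /= /Y eqxx.
  by have := H i; rewrite /= in_fset1U iJ orbT => /(_ isT); case/PL_indexP: iJ => [->//|[z _ ->]].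
have jE : y j' @^-1` B = E (Some (inr j')) by rewrite /E /= /Y eq_sym (negbTE jj).
rewrite SE jE; apply: (mutually_independent_split ind).
- rewrite in_fset1U negb_or nP andbT; apply/eqP => -[] /eqP; by rewrite eq_sym (negbTE jj).
- move=> i; rewrite in_fset1U => /orP[/eqP ->|/PL_indexP[->|[z _ ->]]] /=.
  + by rewrite /Y eqxx; exact: sigma_of_preimage.
  + exact: sigma_of_preimage.
  + by apply: sigma_of_preimage; exact: measurable_gfloor.
- by rewrite -jE; exact: sigma_of_preimage.
Qed.

Lemma cell_event_measurable (d : measure_display) (T : measurableType d)
    (R : realType) (P : probability T R) (n : {RV P >-> nat})
    (x : nat -> {RV P >-> R}) (M k : nat) (m : seq int) :
  measurable (\bigcap_(i in [set` PL_index k])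
             cell_event n x M k m (fun=> setT) i).
Proof.
apply: fin_bigcap_measurable; first exact: finite_fset.
move=> i /PL_indexP[->|[z _ ->]] /=; first exact: RV_preimage_measurable.
by apply: RV_preimage_measurable; exact: measurable_gfloor.
Qed.

(* Given the cells of the [x i], the value at [c] is, up to [L / (M + 1)], a
   fixed convex combination of [y j] and [y j.+1]. *)
Lemma PL_segment_bound (d : measure_display) (T : measurableType d)
    (R : realType) (P : probability T R) (n : {RV P >-> nat})
    (x y : nat -> {RV P >-> R}) (g : {RV P >-> C01_borel R}) (M k j : nat)
    (c : I01 R) (lo hi L : R) :
  PL_construction n x y g -> 0 <= L -> lo <= hi -> (j <= k)%N ->
  outer_le P (n @^-1` [set k] `&` [set w |
      [/\ graph (g w) = polyline (n w) (fun i => x i w) (fun i => y i w),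
        lip_le L (g w), lo <= (g w : C01 R) c <= hi &
        (knots k (fun i => x i w))`_j <= \val c <= (knots k (fun i => x i w))`_j.+1]])
    (P (n @^-1` [set k]) *
      (2 * normal_peak 1 * (hi - lo + (2 * L + 1) / M.+1%:R))%:E)%E.
Proof.
move=> con L0 lohi jk; have [_ _ hy _ _] := con.
have M0 : 0 < M.+1%:R^-1 :> R by rewrite invr_gt0.
have ydens z (u v : R) : u <= v ->
    (P (y z @^-1` `[u, v]) <= (normal_peak 1 * (v - u))%:E)%E.
  move=> uv; have := hy z `[u, v]%classic (measurable_itv _).
  by rewrite /distribution /pushforward => ->; exact: normal_prob_itv_le.
pose D w := [seq gfloor M (x i w) | i <- iota 0 k].
have DE m w : D w = m <-> size m = k /\ forall i, (i < k)%N -> gfloor M (x i w) = m`_i.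
  split=> [<-|[sm mH]].
    rewrite size_map size_iota; split=> // i ik.
    by rewrite (nth_map 0%N) ?size_iota// nth_iota.
  apply: (@eq_from_nth _ 0); first by rewrite size_map size_iota.
  move=> i; rewrite size_map size_iota => ik.
  by rewrite (nth_map 0%N) ?size_iota// nth_iota// add0n mH.
pose S m := \bigcap_(i in [set` PL_index k]) cell_event n x M k m (fun=> setT) i.
have SE m : size m = k -> n @^-1` [set k] `&` D @^-1` [set m] = S m.
  move=> sm; apply/seteqP; split=> [w [/= nw /DE[_ Dw]] i /= /PL_indexP[->//|[z zk ->]] /=|w H].
    exact: Dw.
  split; first by apply: (H None); apply/PL_indexP; left.
  apply/DE; split=> // i ik; apply: (H (Some (inl i))).
  by apply/PL_indexP; right; exists i.
have D0 m : size m <> k -> D @^-1` [set m] = set0.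
  by move=> sm; apply/seteqP; split=> w // /DE[].
have c0 : 0 <= 2 * normal_peak 1 * (hi - lo + (2 * L + 1) / M.+1%:R) :> R.
  rewrite !mulr_ge0 ?normal_peak_ge0// addr_ge0 ?subr_ge0//.
  by rewrite divr_ge0// addr_ge0 ?mulr_ge0.
apply: (@outer_le_cond _ _ _ _ _ D) => //.
- exact: RV_preimage_measurable.
- move=> m; have [sm|sm] := pselect (size m = k); last by rewrite D0.
  rewrite (_ : _ @^-1` _ = \bigcap_(i in `I_k) (x i @^-1` (@gfloor R M @^-1` [set m`_i]))).
    apply: fin_bigcap_measurable; first exact: finite_II.
    by move=> i _; apply: RV_preimage_measurable; exact: measurable_gfloor.
  apply/seteqP; split=> [w /DE[_ Dw] i /= ik|w H]; first exact: Dw.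
  by apply/DE; split=> // i ik; exact: H.
- move=> m; have [sm|sm] := pselect (size m = k); last first.
    by rewrite D0// setI0 set0I measure0 mul0e; exact: outer_le_set0.
  rewrite SE//.
  pose xd (i : nat) : R := (m`_i)%:~R / M.+1%:R.
  pose p := (knots k xd)`_j; pose q := (knots k xd)`_j.+1 + M.+1%:R^-1.
  pose t := (\val c - p) / (q - p).
  have key w : S m w -> graph (g w) = polyline (n w) (fun i => x i w) (fun i => y i w) ->
      lip_le L (g w) ->
      (knots k (fun i => x i w))`_j <= \val c <= (knots k (fun i => x i w))`_j.+1 ->
      0 <= t <= 1 /\ `|(1 - t) * y j w + t * y j.+1 w - (g w : C01 R) c| <= L / M.+1%:R.
    rewrite -SE// => -[/= nw /DE[_ Dw]]; rewrite nw => gE lL cj.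
    have xdE : knots k xd = knots k (fun i => cell_of M (x i w)).
      by apply: eq_knots => i ik; rewrite /xd /cell_of Dw.
    rewrite /t /p /q xdE; exact: (polyline_cell_value M gE L0 lL jk cj).
  (* If the weight computed from the cells is not in [0,1], [key] shows that the event is empty. *)
  have [t01|nt] := pselect (0 <= t <= 1); last first.
    have := outer_le_set0 P; apply: outer_leS.
      by move=> w [Sw [gE lL _ cj]]; have [] := key w Sw gE lL cj.
    by rewrite mule_ge0// lee_fin c0.
  have sub : S m `&` [set w |
      [/\ graph (g w) = polyline (n w) (fun i => x i w) (fun i => y i w),
        lip_le L (g w), lo <= (g w : C01 R) c <= hi &
        (knots k (fun i => x i w))`_j <= \val c <= (knots k (fun i => x i w))`_j.+1]] `<=`
     S m `&` [set w | lo - L / M.+1%:R <= (1 - t) * y j w + t * y j.+1 w <=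
       hi + L / M.+1%:R].
    move=> w [Sw [gE lL /andP[l1 l2] cj]]; split=> //=.
    have [_] := key w Sw gE lL cj; rewrite ler_norml => /andP[h1 h2].
    by clear -l1 l2 h1 h2; move: (L / _) h1 h2 => z h1 h2; apply/andP; split; lra.
  have mS : measurable (S m) by exact: cell_event_measurable.
  have LM0 : 0 <= L / M.+1%:R by rewrite divr_ge0.
  have lohi' : lo - L / M.+1%:R <= hi + L / M.+1%:R.
    by rewrite lerD// (le_trans _ LM0)// oppr_le0.
  (* The term [2 * L] comes from widening the interval at both ends by the rounding error, the term
     1 from the cell of the variable conditioned upon. *)
  have cE : 2 * normal_peak 1 * (hi + L / M.+1%:R - (lo - L / M.+1%:R) + M.+1%:R^-1) =
      2 * normal_peak 1 * (hi - lo + (2 * L + 1) / M.+1%:R) :> R.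
    by move: (M.+1%:R^-1 : R) => z; ring.
  apply: (outer_leS sub (lexx _)); rewrite -cE; move/andP: (t01) => [t0 t1].
  (* The normal variable with the larger weight is the one whose density is used; the other is
     discretized. *)
  have [t2|t2] := leP 2^-1 t.
    apply: (@linear_combination_bound _ _ _ P (y j) (y j.+1)) => //.
    + exact: normal_peak_ge0.
    + by move=> A B mA mB; apply: (cell_event_indep M k m con) => //; rewrite neq_ltn ltnSn.
    + exact: ydens.
    + by clear -t0 t1; apply/andP; split; lra.
  under eq_set do rewrite [(1 - t) * _ + _]addrC.
  apply: (@linear_combination_bound _ _ _ P (y j.+1) (y j)) => //.
  + exact: normal_peak_ge0.
  + by move=> A B mA mB; apply: (cell_event_indep M k m con) => //; rewrite neq_ltn ltnSn orbT.
  + exact: ydens.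
  + by clear -t2; lra.
Qed.

(** The total mass is read off from the events [n = k], which partition the probability space. *)
Lemma PL_sum_pmf (d : measure_display) (T : measurableType d)
    (R : realType) (P : probability T R) (n : {RV P >-> nat})
    (x y : nat -> {RV P >-> R}) (g : {RV P >-> C01_borel R}) :
  PL_construction n x y g -> (\sum_(k <oo) (poisson_pmf (1 : R) k)%:E = 1)%E.
Proof.
move=> [hn _ _ _ _]; under eq_eseriesr do rewrite -hn.
rewrite -(@probability_setT _ _ _ P).
have <- : \bigcup_k (n @^-1` [set k]) = setT.
  by apply/seteqP; split=> w // _; exists (n w).
rewrite measure_semi_bigcup//.
- by move=> k; exact: RV_preimage_measurable.
- by move=> i j _ _ [w [/= <- <-]].
- by apply: bigcupT_measurable => k; exact: RV_preimage_measurable.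
Qed.

Lemma PL_sum_mean (d : measure_display) (T : measurableType d)
    (R : realType) (P : probability T R) (n : {RV P >-> nat})
    (x y : nat -> {RV P >-> R}) (g : {RV P >-> C01_borel R}) (c : R) :
  PL_construction n x y g -> 0 <= c ->
  (\sum_(k <oo) (k%:R * (poisson_pmf (1 : R) k * c))%:E = c%:E)%E.
Proof.
move=> con c0; under eq_eseriesr do rewrite mulrA mulrC EFinM.
rewrite nneseriesZl; last by move=> k _; rewrite lee_fin mulr_ge0// poisson_pmf_ge0.
by rewrite poisson_mean1 (PL_sum_pmf con) mule1.
Qed.

Lemma PL_density_lip (d : measure_display) (T : measurableType d)
    (R : realType) (P : probability T R) (n : {RV P >-> nat})
    (x y : nat -> {RV P >-> R}) (g : {RV P >-> C01_borel R}) (M : nat)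
    (c : I01 R) (lo hi L : R) :
  PL_construction n x y g -> 0 <= L -> lo <= hi ->
  outer_le P [set w |
      [/\ graph (g w) = polyline (n w) (fun i => x i w) (fun i => y i w),
        lip_le L (g w) & lo <= (g w : C01 R) c <= hi]]
    (2 * (2 * normal_peak 1 * (hi - lo + (2 * L + 1) / M.+1%:R)))%:E.
Proof.
move=> con L0 lohi; set C := 2 * normal_peak 1 * _.
have C0 : 0 <= C.
  rewrite !mulr_ge0 ?normal_peak_ge0// addr_ge0 ?subr_ge0//.
  by rewrite divr_ge0// addr_ge0 ?mulr_ge0.
have pC0 k : 0 <= poisson_pmf 1 k * C by rewrite mulr_ge0// poisson_pmf_ge0.
set E := [set w | _]; have [hn _ _ _ _] := con.
have H k : outer_le P (n @^-1` [set k] `&` E) (k.+1%:R * (poisson_pmf 1 k * C))%:E.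
  pose B j := n @^-1` [set k] `&` [set w |
      [/\ graph (g w) = polyline (n w) (fun i => x i w) (fun i => y i w),
        lip_le L (g w), lo <= (g w : C01 R) c <= hi &
        (knots k (fun i => x i w))`_j <= \val c <= (knots k (fun i => x i w))`_j.+1]].
  have HB : outer_le P (\bigcup_(j in `I_k.+1) B j) (k.+1%:R * (poisson_pmf 1 k * C))%:E.
    apply: outer_le_bigcup_nat => j jk.
    have := @PL_segment_bound _ _ _ P n x y g M k j c lo hi L con L0 lohi jk.
    by rewrite (hn k : P _ = _) -EFinM.
  move: HB; apply: outer_leS => // w [/= nw [gE lL lg]].
  have [i [s [ni s01 cE]]] := polyline_cover gE (I01_bound c).
  rewrite nw in ni; exists i; first by rewrite /= ltnS.
  split=> //; split=> //; have := polyline_sorted gE (_ : (i <= n w)%N).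
  rewrite nw => /(_ ni); rewrite cE nw.
  by move: (nth _ _ i) (nth _ _ i.+1) => p q pq; move/andP: s01 => [s0 s1]; apply/andP; split; nra.
have := outer_le_bigcup H; apply: outer_leS.
  by move=> w Ew; exists (n w).
rewrite (_ : 2 * C = C + C); last by ring.
under eq_eseriesr do rewrite -natr1 mulrDl mul1r EFinD.
rewrite nneseriesD; last 2 first.
- by move=> k _ _; rewrite lee_fin; apply: mulr_ge0 => //; exact: pC0.
- by move=> k _ _; rewrite lee_fin; exact: pC0.
rewrite (PL_sum_mean con C0) EFinD leeD2l//.
under eq_eseriesr do rewrite mulrC EFinM.
rewrite nneseriesZl; last by move=> k _; rewrite lee_fin poisson_pmf_ge0.
by rewrite (PL_sum_pmf con) mule1.
Qed.

(* One factor [2] is the mean number [E (n + 1)] of segments, the other comes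
   from the larger of the two convex weights being at least [1/2]. *)
Lemma PL_density (d : measure_display) (T : measurableType d)
    (R : realType) (P : probability T R) (n : {RV P >-> nat})
    (x y : nat -> {RV P >-> R}) (g : {RV P >-> C01_borel R})
    (c : I01 R) (lo hi : R) :
  PL_construction n x y g -> lo <= hi ->
  (P [set w | lo <= (g w : C01 R) c <= hi]%R <= (4 * normal_peak 1 * (hi - lo))%:E)%E.
Proof.
move=> con lohi; have [_ _ _ _ ae] := con.
(* For each fixed [L] the mesh error vanishes as [M] grows; the events increase with [L], and
   continuity from below concludes. *)
pose E (L : nat) := [set w | lo <= (g w : C01 R) c <= hi] `&` g @^-1` (lip_le L%:R).
have mF : measurable [set w | lo <= (g w : C01 R) c <= hi].
  rewrite (_ : [set w | _] = g @^-1` ((fun f : C01_borel R => (f : C01 R) c) @^-1` `[lo, hi])).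
    apply: RV_preimage_measurable; rewrite -[_ @^-1` _]setTI.
    by apply: measurable_ev => //; exact: measurable_itv.
  by apply/seteqP; split=> w /=; rewrite in_itv.
have mE L : measurable (E L).
  by apply: measurableI => //; apply: RV_preimage_measurable; exact: measurable_lip_le.
have PE L : (P (E L) <= (4 * normal_peak 1 * (hi - lo))%:E)%E.
  apply: (@lee_natSinv R _ _ (4 * normal_peak 1 * (2 * L%:R + 1))) => M.
  apply: measurable_outer_le => //.
  have := outer_leU (PL_density_lip M c con (ler0n R L) lohi) (outer_le_negligible ae).
  apply: outer_leS => [w [wc lL]|].
    by have [gE|ngE] := pselect (graph (g w) = polyline (n w) (fun i => x i w) (fun i => y i w));
      [left|right].
  by rewrite adde0 lee_fin le_eqVlt; apply/orP; left; apply/eqP; field.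
have ndE : nondecreasing_seq E.
  move=> L L' LL'; apply/subsetPset => w [wc lL]; split=> // s t.
  by apply: (le_trans (lL s t)); rewrite ler_wpM2r// ler_nat.
have mU : measurable (\bigcup_L E L) by exact: bigcupT_measurable.
have PU : (P (\bigcup_L E L) <= (4 * normal_peak 1 * (hi - lo))%:E)%E.
  have cv := @nondecreasing_cvg_mu _ _ _ P _ mE mU ndE.
  rewrite -(cvg_lim _ cv)//; apply: lime_le; first by apply/cvg_ex; eexists; exact: cv.
  by apply: nearW.
apply: measurable_outer_le => //.
have := outer_leU (outer_le_measurable mU PU) (outer_le_negligible ae).
apply: outer_leS; last by rewrite adde0.
move=> w wc.
have [gE|ngE] := pselect (graph (g w) = polyline (n w) (fun i => x i w) (fun i => y i w));
  last by right.
by left; have [L lL] := polyline_lipschitz gE; exists L.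
Qed.

Lemma PL_lipschitz (d : measure_display) (T : measurableType d)
    (R : realType) (P : probability T R) (n : {RV P >-> nat})
    (x y : nat -> {RV P >-> R}) (g : {RV P >-> C01_borel R}) :
  PL_construction n x y g -> P (g @^-1` ~` \bigcup_(L : nat) lip_le L%:R) = 0%E.
Proof.
move=> [_ _ _ _ ae]; apply/eqP; rewrite eq_le measure_ge0 andbT.
apply: measurable_outer_le.
  apply: RV_preimage_measurable; apply: measurableC.
  by apply: bigcupT_measurable => L; exact: measurable_lip_le.
have := outer_le_negligible ae; apply: outer_leS => // w nl gE; apply: nl.
by have [L lL] := polyline_lipschitz gE; exists L.
Qed.

(** Some [x i] with [i < n] must fall in the window. The expected number of these is [(b - a)] times
    the mean of [n], which is 1. *)
Lemma PL_not_affine (d : measure_display) (T : measurableType d)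
    (R : realType) (P : probability T R) (n : {RV P >-> nat})
    (x y : nat -> {RV P >-> R}) (g : {RV P >-> C01_borel R}) (a b : R) :
  PL_construction n x y g -> a <= b ->
  (P (g @^-1` ~` [set f | affine_on f a b]) <= (b - a)%:E)%E.
Proof.
move=> con ab; have [hn hx _ ind ae] := con.
apply: measurable_outer_le.
  by apply: RV_preimage_measurable; apply: measurableC; exact: measurable_affine_on.
have ba0 : 0 <= b - a by rewrite subr_ge0.
have H k : outer_le P (\bigcup_(i in `I_k) (n @^-1` [set k] `&` x i @^-1` `[a, b]))
    (k%:R * (poisson_pmf 1 k * (b - a)))%:E.
  apply: outer_le_bigcup_nat => i ik; apply: outer_le_measurable.
    by apply: measurableI; apply: RV_preimage_measurable => //; exact: measurable_itv.
  pose E (j : option (nat + nat)) : set T := if j is None then n @^-1` [set k]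
    else x i @^-1` `[a, b].
  have := @mutually_independent_split _ _ _ P _ _ [fset None]%fset (Some (inl i)) E ind.
  rewrite /E set_fset1 bigcap_set1 /= => -> //.
  - rewrite (hn k : P _ = _) (hx i _ (measurable_itv _) : P _ = _) EFinM.
    by apply: lee_wpmul2l; [rewrite lee_fin poisson_pmf_ge0|exact: uniform_prob_itv_le].
  - by rewrite in_fset1.
  - by move=> j; rewrite in_fset1 => /eqP ->; exact: sigma_of_preimage.
  - by apply: sigma_of_preimage; exact: measurable_itv.
have := outer_leU (outer_le_bigcup H) (outer_le_negligible ae).
apply: outer_leS; last by rewrite adde0 (PL_sum_mean con ba0).
move=> w naff.
have [gE|ngE] := pselect (graph (g w) = polyline (n w) (fun i => x i w) (fun i => y i w));
  last by right.
left; exists (n w) => //; apply: contrapT => nx; apply: naff.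
apply: (polyline_affine_on gE) => i ni xi; apply: nx; by exists i => //; split=> //=; rewrite in_itv.
Qed.

(** * Probability of being close to an interpolant *)

Lemma hat_lip (R : realType) (u v : R) : `|hat u - hat v| <= `|u - v|.
Proof.
have uv := lerB_dist u v; have vu := lerB_dist v u; rewrite (distrC v) in vu.
rewrite /hat; move: (`|u|) (`|v|) (`|u - v|) (normr_ge0 (u - v)) uv vu => a b c c0 uv vu.
rewrite ler_norml; case: (leP 0 (1 - a)) => ?; case: (leP 0 (1 - b)) => ?;
  by apply/andP; split; lra.
Qed.

Lemma grid_pl_lip (R : realType) (k : nat) (b : nat -> R) (u v : R) :
  `|grid_pl k b u - grid_pl k b v| <=
  (\sum_(i < k.+2) `|b i|) * (k.+1%:R * `|u - v|).
Proof.
rewrite /grid_pl -sumrB mulr_suml; apply: (le_trans (ler_norm_sum _ _ _)).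
apply: ler_sum => i _; rewrite -mulrBr normrM ler_wpM2l//.
apply: (le_trans (hat_lip _ _)); rewrite (_ : _ - _ = k.+1%:R * (u - v)); last by ring.
by rewrite normrM ger0_norm.
Qed.

(** Displacements below half the mesh keep the abscissas in order, so sorting leaves them in
    place. *)
Lemma knots_near_grid (R : realType) (k : nat) (x : nat -> R) (del : R) (i : nat) :
  2 * del < k.+1%:R^-1 -> 0 <= del ->
  (forall i, (i < k)%N -> `|x i - i.+1%:R / k.+1%:R| <= del) ->
  (i <= k.+1)%N -> `|(knots k x)`_i - i%:R / k.+1%:R| <= del.
Proof.
move=> dk d0 xd.
have xs : sort <=%R (mkseq x k) = mkseq x k.
  apply: sorted_sort; first exact: le_trans.
  apply/(sortedP 0) => j; rewrite size_mkseq => jk.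
  rewrite !nth_mkseq//; last exact: ltnW.
  have := xd _ (ltnW jk); have := xd _ jk; rewrite !ler_norml.
  rewrite -[j.+2%:R]natr1 mulrDl mul1r.
  move: (j.+1%:R / k.+1%:R : R) (k.+1%:R^-1 : R) dk => p nu dk /andP[? ?] /andP[? ?].
  by lra.
case: i => [_|i]; first by rewrite /= mul0r subr0 normr0.
rewrite ltnS leq_eqVlt => /orP[/eqP ->|ik].
  by rewrite nth_knots_last divff ?pnatr_eq0// subrr normr0.
by rewrite nth_knots_mid// xs nth_mkseq//; exact: xd.
Qed.

Lemma box_near_pl (R : realType) (k : nat) (b : nat -> R) (r : R) : 0 < r ->
  exists del : R, [/\ 0 < del, del <= k.+1%:R^-1 &
  forall (x y : nat -> R) (g : C01 R), graph g = polyline k x y ->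
    (forall i, (i < k)%N -> `|x i - i.+1%:R / k.+1%:R| <= del) ->
    (forall i, (i <= k.+1)%N -> `|y i - b i| <= del) -> near_pl k b r g].
Proof.
move=> r0; pose B : R := \sum_(i < k.+2) `|b i|.
have B0 : 0 <= B by rewrite sumr_ge0.
have bB i : (i <= k.+1)%N -> `|b i| <= B.
  move=> ik; rewrite /B (bigD1 (Ordinal (ik : (i < k.+2)%N)))//= lerDl.
  by rewrite sumr_ge0.
have N0 : 0 < k.+1%:R :> R by [].
have nu0 : 0 < k.+1%:R^-1 :> R by rewrite invr_gt0.
have BN : 0 <= B * k.+1%:R by rewrite mulr_ge0.
have h1 : 0 < 1 + B * k.+1%:R by rewrite ltr_wpDr.
have h2 : 0 < 6 * (1 + 2 * (B * k.+1%:R)) by rewrite mulr_gt0// ltr_wpDr// mulr_ge0.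
(* The first bound controls values: [del] from the ordinates plus [B * k.+1%:R * del] from the
   displaced abscissa. The second controls slopes: an increment error
   [2 * del * (1 + 2 * B * k.+1%:R)] has to be at most a third of the mesh, which bounds the segment
   length from below. *)
have [del [del0 d1 d2]] := exists_min2 (divr_gt0 r0 h1) (divr_gt0 nu0 h2).
rewrite ler_pdivlMr// in d1; rewrite ler_pdivlMr// in d2.
have nuE : k.+1%:R * k.+1%:R^-1 = 1 :> R by rewrite divff// gt_eqF.
have d3 : 6 * del <= k.+1%:R^-1.
  apply: le_trans d2; rewrite mulrC ler_pM2l// ler_peMr//.
  by rewrite lerDl mulr_ge0.
exists del; split=> //; first by move: (k.+1%:R^-1 : R) del0 d3; clear; move=> *; lra.
move=> x y g gE xd yd.
have kd i : (i <= k.+1)%N -> `|(knots k x)`_i - i%:R / k.+1%:R| <= del.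
  by apply: knots_near_grid => //; [move: (k.+1%:R^-1 : R) del0 d3; clear; move=> *; lra|exact: ltW].
split=> [u|i u v ik ui vi].
  have [i [s [ik s01 uE]]] := polyline_cover gE (I01_bound u).
  have [_ gu] := polyline_point gE ik s01; rewrite -uE ev_val in gu.
  (* The point of the undisturbed grid with the same parameter [s]: abscissas and ordinates are then
     convex combinations with equal weights, and each differs by at most [del]. *)
  pose ut := (i%:R + s) / k.+1%:R : R.
  have uut : `|\val u - ut| <= del.
    rewrite uE /ut (_ : _ - _ = (1 - s) * ((knots k x)`_i - i%:R / k.+1%:R) +
      s * ((knots k x)`_i.+1 - i.+1%:R / k.+1%:R) - 0); last first.
      by rewrite -natr1; field; rewrite gt_eqF.
    by apply: convex_dist => //; rewrite subr0 kd// leqW.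
  have gp : `|g u - grid_pl k b ut| <= del.
    rewrite gu grid_plE// (_ : _ - _ = (1 - s) * (y i - b i) +
      s * (y i.+1 - b i.+1) - 0); last by ring.
    by apply: convex_dist => //; rewrite subr0 yd// leqW.
  have := grid_pl_lip k b ut (\val u); rewrite -/B distrC => lp.
  have lp' : `|grid_pl k b ut - grid_pl k b (\val u)| <= B * (k.+1%:R * del).
    by rewrite distrC; apply: (le_trans lp); rewrite ler_wpM2l// ler_wpM2l// distrC.
  apply: (le_trans (ler_distD (grid_pl k b ut) _ _)).
  apply: (le_trans (lerD gp lp')); apply: le_trans d1.
  by rewrite le_eqVlt; apply/orP; left; apply/eqP; ring.
have [sl [slH _]] := polyline_affine gE ik.
have /ler_normlP[k3 k4] := kd i (leqW ik).
have kk := kd i.+1 ik; rewrite -natr1 mulrDl mul1r in kk.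
have /ler_normlP[k1 k2] := kk.
have inseg (w : I01 R) : i%:R + 3^-1 <= k.+1%:R * \val w <= i%:R + 2 / 3 ->
    (knots k x)`_i <= \val w <= (knots k x)`_i.+1.
  move=> /andP[w1 w2].
  have w1' : i%:R / k.+1%:R + 3^-1 * k.+1%:R^-1 <= \val w.
    by rewrite -mulrDl ler_pdivrMr// mulrC.
  have w2' : \val w <= i%:R / k.+1%:R + 2 / 3 * k.+1%:R^-1.
    by rewrite -mulrDl ler_pdivlMr// mulrC.
  move: (\val w) (i%:R / k.+1%:R : R) (k.+1%:R^-1 : R) (nth _ _ i) (nth _ _ i.+1)
    w1' w2' k1 k2 k3 k4 d3 del0 => w' p nu a a'; clear; move=> *.
  by apply/andP; split; lra.
rewrite -!(ev_val g) (slH _ (inseg _ ui)) (slH _ (inseg _ vi)).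
have seg1 : (knots k x)`_i <= (knots k x)`_i.+1 <= (knots k x)`_i.+1.
  by rewrite (polyline_sorted gE ik) lexx.
have [_ yi1] := polyline_knot gE (ik : (i.+1 <= k.+1)%N).
have := slH _ seg1; rewrite yi1 => slE.
have /ler_normlP[y1 y2] := yd i (leqW ik); have /ler_normlP[y3 y4] := yd i.+1 ik.
have /ler_normlP[b1 b2] := bB i (leqW ik); have /ler_normlP[b3 b4] := bB i.+1 ik.
rewrite [X in `|X|](_ : _ = (sl - k.+1%:R * (b i.+1 - b i)) * (\val v - \val u));
  last by ring.
rewrite normrM -[leRHS]mul1r ler_wpM2r//.
clear inseg seg1 slH ui vi yd kd xd.
pose Da := (knots k x)`_i.+1 - (knots k x)`_i.
have Da0 : k.+1%:R^-1 / 3 <= Da.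
  rewrite /Da; move: (i%:R / k.+1%:R : R) (k.+1%:R^-1 : R) (nth _ _ i) (nth _ _ i.+1)
    k1 k2 k3 k4 d3 del0; clear; move=> *; lra.
have Dap : 0 < Da by apply: lt_le_trans Da0; rewrite divr_gt0.
have Dan : `|Da - k.+1%:R^-1| <= 2 * del.
  rewrite /Da ler_norml; move: (i%:R / k.+1%:R : R) (k.+1%:R^-1 : R) (nth _ _ i) (nth _ _ i.+1)
    k1 k2 k3 k4; clear; move=> *; apply/andP; split; lra.
rewrite -(ler_pM2r Dap) mul1r -{1}(gtr0_norm Dap) -normrM.
apply: le_trans Da0.
rewrite (_ : _ * Da = (y i.+1 - y i - (b i.+1 - b i)) -
  k.+1%:R * (b i.+1 - b i) * (Da - k.+1%:R^-1)); last first.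
  rewrite slE -/Da; move: (k.+1%:R : R) N0 (Da) => N N0 D.
  by field; exact: lt0r_neq0.
apply: (le_trans (ler_normB _ _)).
have t1 : `|y i.+1 - y i - (b i.+1 - b i)| <= 2 * del.
  by rewrite ler_norml; move: y1 y2 y3 y4; clear; move=> *; apply/andP; split; lra.
have t2 : `|k.+1%:R * (b i.+1 - b i) * (Da - k.+1%:R^-1)| <=
    k.+1%:R * (2 * B) * (2 * del).
  rewrite normrM; apply: ler_pM => //; rewrite normrM (gtr0_norm N0) ler_pM2l//.
  by rewrite ler_norml; move: b1 b2 b3 b4; clear; move=> *; apply/andP; split; lra.
apply: (le_trans (lerD t1 t2)); rewrite ler_pdivlMr//; apply: le_trans d2.
by rewrite le_eqVlt; apply/orP; left; apply/eqP; ring.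
Qed.

Lemma prode_ge (R : realType) (I : choiceType) (s : seq I) (c : I -> R)
    (p : I -> \bar R) : (forall i, 0 < c i) ->
  (forall i, i \in s -> ((c i)%:E <= p i)%E) ->
  ((\prod_(i <- s) c i)%:E <= \prod_(i <- s) p i)%E.
Proof.
move=> c0; elim: s => [|i s IH] H; first by rewrite !big_nil.
rewrite !big_cons EFinM; apply: lee_pmul.
- by rewrite lee_fin ltW.
- by rewrite lee_fin; apply: prodr_ge0 => j _; exact: ltW.
- by apply: H; rewrite mem_head.
- by apply: IH => j js; apply: H; rewrite in_cons js orbT.
Qed.

(** It suffices that [n = k] and that finitely many independent coordinates fall in small intervals.
    The bound [c] is fixed before the probability space, so it serves all the [f i] at once. *)
Lemma PL_near_pl_gt0 (R : realType) (k : nat) (b : nat -> R) (r : R) : 0 < r ->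
  exists2 c : R, 0 < c & forall (d : measure_display) (T : measurableType d)
    (P : probability T R) (n : {RV P >-> nat})
    (x y : nat -> {RV P >-> R}) (g : {RV P >-> C01_borel R}),
    PL_construction n x y g -> (c%:E <= P (g @^-1` near_pl k b r))%E.
Proof.
move=> r0; have [del [del0 delk box]] := box_near_pl k b r0.
have nu0 : 0 < k.+1%:R^-1 :> R by rewrite invr_gt0.
have /choice[cy cyP] : forall i : nat, exists c : R, 0 < c /\
    (c%:E <= normal_prob 0 1 `[(b i - del)%R, (b i + del)%R])%E.
  move=> i; have [|c c0 cP] := @normal_prob_itv_gt0 R (b i - del) (b i + del); first by lra.
  by exists c.
pose s : seq (option (nat + nat)) := None :: map (fun i => Some (inl i)) (iota 0 k) ++
  map (fun i => Some (inr i)) (iota 0 k.+2).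
pose J : {fset option (nat + nat)} := [fset j in s]%fset.
have PJ j : (j \in J) = (j \in s) by apply/idP/idP; rewrite /J in_fset.
have JP j : j \in J -> [\/ j = None, exists2 i, (i < k)%N & j = Some (inl i) |
    exists2 i, (i < k.+2)%N & j = Some (inr i)].
  rewrite PJ in_cons mem_cat => /or3P[/eqP ->|/mapP[i]|/mapP[i]]; first exact: Or31.
    by rewrite mem_iota add0n => /andP[_ ik] ->; apply: Or32; exists i.
  by rewrite mem_iota add0n => /andP[_ ik] ->; apply: Or33; exists i.
(* The value [2 * del] is the uniform probability of the interval around an interior node, which
   lies in [0,1] because [del] is at most the mesh. *)
pose cc (j : option (nat + nat)) : R := match j with
  | None => poisson_pmf 1 k | Some (inl _) => 2 * del | Some (inr i) => cy i end.
have cc0 j : 0 < cc j.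
  case: j => [[i|i]|] /=; first by rewrite mulr_gt0.
    by have [] := cyP i.
  by rewrite /poisson_pmf ltr01 expr1n mul1r mulr_gt0 ?expR_gt0// invr_gt0 ltr0n fact_gt0.
exists (\prod_(j <- J) cc j); first by apply: prodr_gt0.
move=> d T P n x y g con; have [hn hx hy ind ae] := con.
pose E (j : option (nat + nat)) : set T := match j with
  | None => n @^-1` [set k]
  | Some (inl i) => x i @^-1` `[i.+1%:R / k.+1%:R - del, i.+1%:R / k.+1%:R + del]
  | Some (inr i) => y i @^-1` `[b i - del, b i + del] end.
have mE j : measurable (E j).
  by case: j => [[i|i]|]; apply: RV_preimage_measurable => //; exact: measurable_itv.
have PE j : j \in J -> ((cc j)%:E <= P (E j))%E.
  move=> /JP[->|[i ik ->]|[i ik ->]] /=.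
  - by rewrite (hn k : P _ = _).
  - rewrite (hx i _ (measurable_itv _) : P _ = _).
    rewrite (_ : 2 * del = (i.+1%:R / k.+1%:R + del) - (i.+1%:R / k.+1%:R - del)); last by ring.
    apply: uniform_prob_itv_ge; [| by rewrite ltrD2l gtrN|].
      rewrite subr_ge0; apply: (le_trans delk).
      by rewrite -[leLHS]mul1r ler_pM2r// ler1n.
    have oneE : k%:R / k.+1%:R + k.+1%:R^-1 = 1 :> R.
      by rewrite -[X in _ + X]mul1r -mulrDl natr1 divff ?pnatr_eq0.
    rewrite -[leRHS]oneE; by apply: lerD => //; rewrite ler_pM2r// ler_nat.
  - by rewrite (hy i _ (measurable_itv _) : P _ = _); have [] := cyP i.
have := @prode_ge R _ J cc (fun j => P (E j)) cc0 PE.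
rewrite -(ind J E); last first.
  by move=> j /JP[->|[i ik ->]|[i ik ->]]; apply: sigma_of_preimage => //; exact: measurable_itv.
move/le_trans; apply.
have mB : measurable (\bigcap_(i in [set` J]) E i).
  by apply: fin_bigcap_measurable => //; exact: finite_fset.
have mN : measurable (g @^-1` near_pl k b r).
  by apply: RV_preimage_measurable; exact: measurable_near_pl.
apply: (measurable_outer_le mB).
have := outer_leU (outer_le_measurable mN (lexx _)) (outer_le_negligible ae).
apply: outer_leS; last by rewrite adde0.
move=> w wB.
have [gE|ngE] := pselect (graph (g w) = polyline (n w) (fun i => x i w) (fun i => y i w));
  last by right.
left; have nw : n w = k by apply: (wB None); rewrite /= PJ mem_head.
rewrite nw in gE; apply: (box _ _ _ gE) => i ik.
  have : E (Some (inl i)) w.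
    apply: wB; rewrite /= PJ in_cons mem_cat; apply/orP; right; apply/orP; left.
    by apply/mapP; exists i => //; rewrite mem_iota.
  rewrite /= in_itv /= ler_norml; move: (i.+1%:R / k.+1%:R : R); clear.
  by move=> z /andP[? ?]; apply/andP; split; lra.
have : E (Some (inr i)) w.
  apply: wB; rewrite /= PJ in_cons mem_cat; apply/orP; right; apply/orP; right.
  by apply/mapP; exists i => //; rewrite mem_iota.
rewrite /= in_itv /= ler_norml; clear.
by move=> /andP[? ?]; apply/andP; split; lra.
Qed.

(** * Independent polylines *)

Lemma PL_law_density (d : measure_display) (T : measurableType d)
    (R : realType) (P : probability T R) (h : {RV P >-> C01_borel R})
    (c : I01 R) (lo hi : R) : is_PL_law (distribution P h) -> lo <= hi ->
  (P (h @^-1` [set g : C01 R | (lo <= g c <= hi)%R]) <=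
    (4 * normal_peak 1 * (hi - lo))%:E)%E.
Proof.
move=> [d' [T' [P' [n [x [y [g [con mu]]]]]]]] lohi.
have mA : measurable ([set g : C01 R | (lo <= g c <= hi)%R] : set (C01_borel R)).
  rewrite (_ : [set _ | _] = (fun f : C01_borel R => (f : C01 R) c) @^-1` `[lo, hi]).
    rewrite -[_ @^-1` _]setTI.
    by apply: measurable_ev => //; exact: measurable_itv.
  by apply/seteqP; split=> w /=; rewrite in_itv.
rewrite (mu _ mA : P _ = _); exact: PL_density con lohi.
Qed.

Lemma PL_law_not_affine (d : measure_display) (T : measurableType d)
    (R : realType) (P : probability T R) (h : {RV P >-> C01_borel R})
    (a b : R) : is_PL_law (distribution P h) -> a <= b ->
  (P (h @^-1` ~` [set f | affine_on f a b]) <= (b - a)%:E)%E.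
Proof.
move=> [d' [T' [P' [n [x [y [g [con mu]]]]]]]] ab.
have mA : measurable (~` [set f | affine_on f a b] : set (C01_borel R)).
  by apply: measurableC; exact: measurable_affine_on.
rewrite (mu _ mA : P _ = _); exact: PL_not_affine con ab.
Qed.

Lemma PL_law_lipschitz (d : measure_display) (T : measurableType d)
    (R : realType) (P : probability T R) (h : {RV P >-> C01_borel R}) :
  is_PL_law (distribution P h) ->
  P.-negligible (h @^-1` ~` \bigcup_(L : nat) lip_le L%:R).
Proof.
move=> [d' [T' [P' [n [x [y [g [con mu]]]]]]]].
have mA : measurable (~` \bigcup_(L : nat) lip_le L%:R : set (C01_borel R)).
  by apply: measurableC; apply: bigcupT_measurable => L; exact: measurable_lip_le.
apply/negligibleP; first exact: RV_preimage_measurable.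
exact: (etrans (mu _ mA) (PL_lipschitz con)).
Qed.

Lemma PL_law_near_pl (R : realType) (k : nat) (b : nat -> R) (r : R) : 0 < r ->
  exists2 c : R, 0 < c & forall (d : measure_display) (T : measurableType d)
    (P : probability T R) (h : {RV P >-> C01_borel R}),
    is_PL_law (distribution P h) -> (c%:E <= P (h @^-1` near_pl k b r))%E.
Proof.
move=> r0; have [c c0 H] := PL_near_pl_gt0 k b r0; exists c => // d T P h.
move=> [d' [T' [P' [n [x [y [g [con mu]]]]]]]].
rewrite (mu _ (measurable_near_pl k b r) : P _ = _); exact: H con.
Qed.

(** The misses are independent, each of probability at most [1 - c], so the first [n] functions all
    miss with probability at most [(1 - c) ^+ n]. *)
Lemma near_pl_hit (d : measure_display) (T : measurableType d)
    (R : realType) (P : probability T R) (f : nat -> {RV P >-> C01_borel R})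
    (k : nat) (b : nat -> R) (r : R) :
  mutually_independent P (fun i : nat => sigma_of (f i)) ->
  (forall i : nat, is_PL_law (distribution P (f i))) -> 0 < r ->
  P.-negligible [set w | forall i, ~ near_pl k b r (f i w)].
Proof.
move=> ind law r0; have [c c0 H] := PL_law_near_pl k b r0.
pose E i := f i @^-1` ~` near_pl k b r.
have mE i : measurable (E i).
  by apply: RV_preimage_measurable; apply: measurableC; exact: measurable_near_pl.
have PE i : (P (E i) <= (1 - c)%:E)%E.
  rewrite /E preimage_setC probability_setC; last first.
    exact: (@RV_preimage_measurable _ _ _ _ (f i) _ (measurable_near_pl k b r)).
  by rewrite EFinB; apply: leeB => //; exact: H.
have c1 : 0 <= 1 - c by rewrite -lee_fin (le_trans _ (PE 0%N)).
pose J n : {fset nat} := [fset i in iota 0 n]%fset.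
have JP n i : (i \in J n) = (i < n)%N by rewrite in_fset /= mem_iota.
have mJ n : measurable (\bigcap_(i in [set` J n]) E i).
  by apply: fin_bigcap_measurable => //; exact: finite_fset.
have PJ n : (P (\bigcap_(i in [set` J n]) E i) <= ((1 - c) ^+ n)%:E)%E.
  elim: n => [|n IH]; first by rewrite expr0; apply: probability_le1; exact: mJ.
  have -> : \bigcap_(i in [set` J n.+1]) E i = \bigcap_(i in [set` J n]) E i `&` E n.
    apply/seteqP; split=> [w H'|w [H1 H2] i /=].
      by split=> [i /= iJ|]; apply: H' => /=; rewrite JP// ltnS ltnW// -JP.
    by rewrite JP ltnS leq_eqVlt => /orP[/eqP ->//|iN]; apply: H1; rewrite /= JP.
  rewrite (mutually_independent_split ind).
  - by rewrite exprSr EFinM; apply: lee_pmul.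
  - by rewrite JP ltnn.
  - by move=> i _; apply: sigma_of_preimage; apply: measurableC; exact: measurable_near_pl.
  - by apply: sigma_of_preimage; apply: measurableC; exact: measurable_near_pl.
exists (\bigcap_i E i); split; first exact: bigcapT_measurable.
  have mI : measurable (\bigcap_i E i) by exact: bigcapT_measurable.
  have PI n : (P (\bigcap_i E i) <= ((1 - c) ^+ n)%:E)%E.
    apply: le_trans (PJ n); apply: le_measure; rewrite ?inE//.
    by move=> w wE i _; exact: wE.
  have PIf : P (\bigcap_i E i) \is a fin_num by exact: fin_num_measure.
  apply/eqP; rewrite eq_le measure_ge0 andbT leNgt; apply/negP.
  rewrite -(fineK PIf) lte_fin => p0.
  have /cvgrPdist_lt/(_ _ p0)[n _ /(_ n (leqnn n))] : (1 - c) ^+ n @[n --> \oo] --> 0.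
    by apply: cvg_expr; rewrite ger0_norm// ltrBlDr ltrDl.
  rewrite /= sub0r normrN ger0_norm ?exprn_ge0// => np.
  by have := PI n; rewrite -(fineK PIf) lee_fin leNgt np.
by move=> w wE i _; exact: wE.
Qed.

Lemma family_indep (d : measure_display) (T : measurableType d)
    (R : realType) (P : probability T R) (f : nat -> {RV P >-> C01_borel R})
    (J : {fset nat}) (l : nat) (G : nat -> set (C01_borel R)) (A : set (C01_borel R)) :
  mutually_independent P (fun i : nat => sigma_of (f i)) -> l \notin J ->
  (forall i, measurable (G i)) -> measurable A ->
  P (\bigcap_(i in [set` J]) (f i @^-1` G i) `&` f l @^-1` A) =
    (P (\bigcap_(i in [set` J]) (f i @^-1` G i)) * P (f l @^-1` A))%E.
Proof.
move=> ind lJ mG mA.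
pose E i := if i == l then f l @^-1` A else f i @^-1` G i.
have -> : \bigcap_(i in [set` J]) (f i @^-1` G i) = \bigcap_(i in [set` J]) E i.
  apply: eq_bigcapr => i /= iJ; rewrite /E ifF//; apply/negbTE.
  by apply: contraNneq lJ => <-.
have -> : f l @^-1` A = E l by rewrite /E eqxx.
apply: (mutually_independent_split ind) => //.
  move=> i iJ; rewrite /E ifF; first exact: sigma_of_preimage.
  by apply/negbTE; apply: contraNneq lJ => <-.
by rewrite /E eqxx; exact: sigma_of_preimage.
Qed.

(** * Near crossings at grid points *)

(** What remains of a congruence mod 1 at distance at most one mesh, in terms of the cells [a] and
    [b] of two values. The integer is at most [2 * L] because both functions are bounded by [L]; in
    the tolerance, each function contributes its variation [L] over a mesh and the two floors
    contribute 1. *)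
Definition near_mod (L N : nat) (a b : int) : Prop :=
  exists2 z : int, (`|z| <= (2 * L)%:Z)%R &
    (`|a - b - z * N.+1%:Z| <= (2 * L).+1%:Z)%R.

Lemma near_mod_of_congruent (R : realType) (L N : nat) (u v : C01 R) (t c : I01 R) (m : int) :
  lip_le L%:R u -> lip_le L%:R v -> (forall s, `|u s| <= L%:R) ->
  (forall s, `|v s| <= L%:R) -> u t - v t = m%:~R ->
  `|\val t - \val c| <= N.+1%:R^-1 ->
  near_mod L N (gfloor N (u c)) (gfloor N (v c)).
Proof.
move=> lu lv bu bv uvm tc.
have N0 : 0 < N.+1%:R :> R by [].
exists m.
  rewrite -(ler_int R) intr_norm -uvm; apply: (le_trans (ler_normB _ _)).
  by apply: (le_trans (lerD (bu t) (bv t))); rewrite -natrD addnn -mul2n.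
have dev (h : C01 R) : lip_le L%:R h -> `|N.+1%:R * h t - N.+1%:R * h c| <= L%:R.
  move=> lh; rewrite -mulrBr normrM (gtr0_norm N0).
  have := lh t c => /le_trans H; rewrite -ler_pdivlMl// mulrC; apply: H.
  by rewrite ler_wpM2l.
have fl (h : C01 R) : (gfloor N (h c))%:~R <= N.+1%:R * h c < (gfloor N (h c))%:~R + 1.
  by rewrite /gfloor -[1 in X in _ && X]/(1%:~R) -rmorphD floor_le_tmp floorD1_gt.
have du := dev u lu; have dv := dev v lv.
have /andP[fu1 fu2] := fl u; have /andP[fv1 fv2] := fl v.
have NE : N.+1%:R * u t - N.+1%:R * v t = N.+1%:R * m%:~R by rewrite -mulrBr uvm.
rewrite -(ler_int R) intr_norm !rmorphB rmorphM /=.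
rewrite (_ : (2 * L).+1%:Z%:~R = 2 * L%:R + 1 :> R); last first.
  by rewrite -[LHS]/((2 * L).+1%:R) -natr1 natrM.
rewrite (_ : N.+1%:Z%:~R = N.+1%:R :> R)//.
move: (N.+1%:R * u t) (N.+1%:R * v t) (N.+1%:R * u c) (N.+1%:R * v c) du dv fu1 fu2 fv1 fv2 NE.
move: (gfloor _ _)%:~R (gfloor _ _)%:~R (m%:~R : R) (N.+1%:R : R) (L%:R : R); clear.
move=> a b m N L ut vt uc vc; rewrite !ler_norml => /andP[? ?] /andP[? ?] *.
by apply/andP; split; lra.
Qed.

Lemma int_shift (L : nat) (z : int) : (`|z| <= (2 * L)%:Z)%R ->
  exists2 j : nat, z = j%:Z - (2 * L)%:Z & (j < (4 * L).+1)%N.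
Proof. by move=> zL; exists (absz (z + (2 * L)%:Z)); lia. Qed.

(* [near_mod L N a] confines the value to [4 L + 1] intervals of length
   [(4 L + 3) / (N + 1)], and [4 * normal_peak 1] bounds its density. *)
Definition mod_bound (R : realType) (L : nat) : R :=
  (4 * L).+1%:R * (4 * normal_peak 1 * (4 * L + 3)%:R).

Lemma mod_bound_ge0 (R : realType) (L : nat) : 0 <= mod_bound R L.
Proof. by rewrite !mulr_ge0 ?normal_peak_ge0. Qed.

Lemma near_mod_bound (d : measure_display) (T : measurableType d)
    (R : realType) (P : probability T R) (h : {RV P >-> C01_borel R})
    (U : set T) (c : I01 R) (L N : nat) (a : int) :
  is_PL_law (distribution P h) -> measurable U ->
  (forall A : set (C01_borel R), measurable A ->
     P (U `&` h @^-1` A) = (P U * P (h @^-1` A))%E) ->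
  outer_le P (U `&` [set w | near_mod L N a (gfloor N ((h w : C01 R) c))])
    (P U * (mod_bound R L / N.+1%:R)%:E)%E.
Proof.
move=> law mU ind; have N0 : 0 < N.+1%:R :> R by [].
(* The integer is [j - 2 * L]. The width [4 * L + 3] is twice the tolerance [2 * L + 1], plus 1 for
   the position of the value within its cell. *)
pose lo (j : nat) : R := (a%:~R - (j%:R - (2 * L)%:R) * N.+1%:R - (2 * L).+1%:R) / N.+1%:R.
pose hi (j : nat) : R := lo j + (4 * L + 3)%:R / N.+1%:R.
have lohi j : lo j <= hi j by rewrite lerDl divr_ge0.
pose A j := [set g : C01 R | (lo j <= g c <= hi j)%R].
have mA j : measurable (A j : set (C01_borel R)).
  rewrite (_ : A j = (fun f : C01_borel R => (f : C01 R) c) @^-1` `[lo j, hi j]).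
    rewrite -[_ @^-1` _]setTI.
    by apply: measurable_ev => //; exact: measurable_itv.
  by apply/seteqP; split=> w /=; rewrite in_itv.
have PUf : P U \is a fin_num by exact: fin_num_measure.
have := @outer_le_bigcup_nat _ _ _ P (fun j => U `&` h @^-1` A j) (4 * L).+1
  (fine (P U) * (4 * normal_peak 1 * ((4 * L + 3)%:R / N.+1%:R))).
set Q := outer_le _ _ _ => HQ; have {HQ} : Q.
  apply: HQ => j _; apply: outer_le_measurable.
    by apply: measurableI => //; exact: RV_preimage_measurable.
  rewrite ind// EFinM fineK//; apply: lee_wpmul2l => //.
  have := PL_law_density c law (lohi j).
  by rewrite /hi addrAC subrr add0r.
apply: outer_leS; last first.
  rewrite -{2}(fineK PUf) -EFinM lee_fin /mod_bound le_eqVlt; apply/orP; left; apply/eqP.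
  by move: (N.+1%:R^-1 : R) => nu; ring.
move=> w [Uw [z zL azb]].
have [j jz jL] := int_shift zL.
exists j => //; split=> //=.
have := erefl (gfloor N ((h w : C01 R) c)) => /gfloor_itv.
set b := gfloor _ _ => -[b1 b2].
have zE : z%:~R = j%:R - (2 * L)%:R :> R by rewrite jz rmorphB.
have : `|a%:~R - b%:~R - z%:~R * N.+1%:R| <= (2 * L).+1%:R :> R.
  by move: azb; rewrite -(ler_int R) intr_norm !rmorphB rmorphM /=.
rewrite /A /= /hi /lo zE.
rewrite ler_norml => /andP[h1 h2].
have b1' : b%:~R <= (h w : C01 R) c * N.+1%:R by rewrite -ler_pdivrMr.
have b2' : (h w : C01 R) c * N.+1%:R <= b%:~R + 1.
  by rewrite -ler_pdivlMr// mulrDl mul1r ltW.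
rewrite -mulrDl ler_pdivrMr// ler_pdivlMr//.
have -> : (4 * L + 3)%:R = 2 * (2 * L)%:R + 3 :> R.
  by rewrite natrD (_ : 4 * L = 2 * (2 * L))%N ?natrM// mulnA.
have e1 : (2 * L).+1%:R = (2 * L)%:R + 1 :> R by rewrite natr1.
rewrite e1 in h1 h2 *.
move: ((2 * L)%:R : R) (N.+1%:R : R) ((h w : C01 R) c * _) (a%:~R : R) (b%:~R : R) (j%:R : R)
  h1 h2 b1' b2'; clear; move=> *.
by apply/andP; split; lra.
Qed.

Lemma countable_preimage_measurable (d : measure_display) (T : measurableType d)
    (I : countType) (D : T -> I) (Q : set I) :
  (forall i, measurable (D @^-1` [set i])) -> measurable (D @^-1` Q).
Proof.
move=> mD.
pose B (n : nat) : set T := \bigcup_(i in [set i | Q i /\ choice.pickle i = n])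
  D @^-1` [set i].
have -> : D @^-1` Q = \bigcup_n B n.
  apply/seteqP; split=> [w Qw|w [n _ [i [Qi _] /= wi]]]; last by rewrite /= wi.
  by exists (choice.pickle (D w)) => //; exists (D w).
apply: bigcupT_measurable => n; have [[i [Qi ni]]|nQ] :=
    pselect (exists i, Q i /\ choice.pickle i = n).
  rewrite /B (_ : [set i | _] = [set i]) ?bigcup_set1//.
  apply/seteqP; split=> [j [_ jn]|j ->//].
  by apply: (pcan_inj (@choice.pickleK I)); rewrite jn.
rewrite /B (_ : [set i | _] = set0) ?bigcup_set0//.
by apply/seteqP; split=> // j jn; apply: nQ; exists j.
Qed.

Definition grid_cell_set (R : realType) (N : nat) (c : I01 R) (a : int) :
    set (C01_borel R) := [set g : C01_borel R | gfloor N ((g : C01 R) c) = a].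

Lemma measurable_grid_cell_set (R : realType) (N : nat) (c : I01 R) (a : int) :
  measurable (grid_cell_set N c a).
Proof.
rewrite (_ : grid_cell_set N c a =
  (fun f : C01_borel R => (f : C01 R) c) @^-1` (@gfloor R N @^-1` [set a]))//.
rewrite -[_ @^-1` (_ @^-1` _)]setTI.
by apply: measurable_ev => //; exact: measurable_gfloor.
Qed.

Definition near_event (d : measure_display) (T : measurableType d)
    (R : realType) (P : probability T R) (f : nat -> {RV P >-> C01_borel R})
    (L N : nat) (c : I01 R) (i j : nat) : set T :=
  [set w | near_mod L N (gfloor N ((f i w : C01 R) c))
                        (gfloor N ((f j w : C01 R) c))].

Lemma measurable_near_event (d : measure_display) (T : measurableType d)
    (R : realType) (P : probability T R) (f : nat -> {RV P >-> C01_borel R})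
    (L N : nat) (c : I01 R) (i j : nat) : measurable (near_event f L N c i j).
Proof.
apply: (@countable_preimage_measurable _ _ _
  (fun w => (gfloor N ((f i w : C01 R) c), gfloor N ((f j w : C01 R) c)))
  [set ab | near_mod L N ab.1 ab.2]).
move=> [a b]; rewrite (_ : _ @^-1` _ =
  f i @^-1` grid_cell_set N c a `&` f j @^-1` grid_cell_set N c b).
  by apply: measurableI; apply: RV_preimage_measurable; exact: measurable_grid_cell_set.
by apply/seteqP; split=> [w [<- <-]|w /= [-> ->]].
Qed.

(** Given the cell of [f i] at [c], the near crossing is a condition on [f j] alone. The event [A]
    about [f i] is carried along, later to be a kink. *)
Lemma event_near_bound (d : measure_display) (T : measurableType d)
    (R : realType) (P : probability T R) (f : nat -> {RV P >-> C01_borel R})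
    (L N : nat) (c : I01 R) (i j : nat) (A : set (C01_borel R)) :
  mutually_independent P (fun i : nat => sigma_of (f i)) ->
  (forall i : nat, is_PL_law (distribution P (f i))) -> i != j ->
  measurable A ->
  outer_le P (f i @^-1` A `&` near_event f L N c i j)
    (P (f i @^-1` A) * (mod_bound R L / N.+1%:R)%:E)%E.
Proof.
move=> ind law ij mA.
apply: (@outer_le_cond _ _ _ P _ (fun w => gfloor N ((f i w : C01 R) c))).
- exact: RV_preimage_measurable.
- move=> a; exact: (@RV_preimage_measurable _ _ _ _ (f i) _ (measurable_grid_cell_set N c a)).
- move=> a; pose G := A `&` grid_cell_set N c a.
  have mG : measurable G by apply: measurableI => //; exact: measurable_grid_cell_set.
  have -> : f i @^-1` A `&` (fun w => gfloor N ((f i w : C01 R) c)) @^-1` [set a] = f i @^-1` G.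
    by [].
  have H := @near_mod_bound _ _ _ P (f j) (f i @^-1` G) c L N a (law j).
  have {}H := H (@RV_preimage_measurable _ _ _ _ (f i) _ mG).
  suff /H : forall B : set (C01_borel R), measurable B ->
      P (f i @^-1` G `&` f j @^-1` B) = (P (f i @^-1` G) * P (f j @^-1` B))%E.
    by apply: outer_leS => // w [Gw nw]; split=> //; have [_ ga] := Gw; rewrite /= -ga.
  move=> B mB; have := @family_indep _ _ _ P f [fset i]%fset j (fun=> G) B ind.
  rewrite set_fset1 bigcap_set1; apply=> //.
  by rewrite in_fset1 eq_sym.
- by rewrite divr_ge0 ?mod_bound_ge0.
Qed.

Lemma pair_near_bound (d : measure_display) (T : measurableType d)
    (R : realType) (P : probability T R) (f : nat -> {RV P >-> C01_borel R})
    (L N : nat) (c : I01 R) (i j : nat) :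
  mutually_independent P (fun i : nat => sigma_of (f i)) ->
  (forall i : nat, is_PL_law (distribution P (f i))) -> i != j ->
  outer_le P (near_event f L N c i j) (mod_bound R L / N.+1%:R)%:E.
Proof.
move=> ind law ij; have := @event_near_bound _ _ _ P f L N c i j setT ind law ij measurableT.
by rewrite preimage_setT setTI probability_setT mul1e.
Qed.

(** Given the cells of [f i], [f j] and [f k], the second near crossing concerns [f l] alone and
    costs one factor; the first costs the other. The index [k] may be [i] or [j]. *)
Lemma triple_near_bound (d : measure_display) (T : measurableType d)
    (R : realType) (P : probability T R) (f : nat -> {RV P >-> C01_borel R})
    (L N : nat) (c : I01 R) (i j k l : nat) :
  mutually_independent P (fun i : nat => sigma_of (f i)) ->
  (forall i : nat, is_PL_law (distribution P (f i))) -> i != j ->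
  l != i -> l != j -> l != k ->
  outer_le P (near_event f L N c i j `&` near_event f L N c k l)
    (mod_bound R L / N.+1%:R * (mod_bound R L / N.+1%:R))%:E.
Proof.
move=> ind law ij li lj lk.
have C0 : 0 <= mod_bound R L / N.+1%:R by rewrite divr_ge0 ?mod_bound_ge0.
have mS := measurable_near_event f L N c i j.
pose F a w := gfloor N ((f a w : C01 R) c).
pose D w := (F i w, F j w, F k w).
have FE a z : F a @^-1` [set z] = f a @^-1` grid_cell_set N c z by [].
suff H : outer_le P (near_event f L N c i j `&` near_event f L N c k l)
    (P (near_event f L N c i j) * (mod_bound R L / N.+1%:R)%:E)%E.
  move: H; apply: outer_leS => //; rewrite [leRHS]EFinM; apply: lee_wpmul2r; first by rewrite lee_fin.
  by apply: (measurable_outer_le mS); exact: pair_near_bound.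
apply: (@outer_le_cond _ _ _ P _ D) => //.
  move=> [[a b] z]; rewrite (_ : _ @^-1` _ = F i @^-1` [set a] `&` F j @^-1` [set b] `&`
    F k @^-1` [set z]).
    by apply: measurableI; [apply: measurableI|]; rewrite FE;
      apply: RV_preimage_measurable; exact: measurable_grid_cell_set.
  by apply/seteqP; split=> [w [<- <- <-]|w /= [[wa wb] wz]]; last by rewrite /D wa wb wz.
move=> [[a b] z].
have [nab|nab] := pselect (near_mod L N a b); last first.
  rewrite (_ : near_event f L N c i j `&` _ = set0) ?set0I ?measure0 ?mul0e.
    exact: outer_le_set0.
  apply/seteqP; split=> // w [nw [wa wb _]]; apply: nab.
  by move: nw; rewrite /near_event /= -/(F i w) -/(F j w) wa wb.
(* An intersection rather than a case distinction, because [k] may coincide with [i] or [j] and then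
   carries two constraints. *)
pose G (q : nat) : set (C01_borel R) :=
  (if q == i then grid_cell_set N c a else setT) `&`
  (if q == j then grid_cell_set N c b else setT) `&`
  (if q == k then grid_cell_set N c z else setT).
have mG q : measurable (G q).
  by apply: measurableI; [apply: measurableI|]; case: ifP => _ //;
    exact: measurable_grid_cell_set.
pose J : {fset nat} := [fset i; j; k]%fset.
have lJ : l \notin J by rewrite !in_fsetU !in_fset1 !negb_or li lj lk.
have SE : near_event f L N c i j `&` D @^-1` [set (a, b, z)] =
    \bigcap_(q in [set` J]) (f q @^-1` G q).
  apply/seteqP; split=> [w [_ [wa wb wz]] q _|w H].
    by split; [split|] => /=; case: eqP => // ->.
  have [] := H i _; first by rewrite /= !in_fsetU !in_fset1 eqxx.
  rewrite eqxx => -[wi _] _.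
  have [] := H j _; first by rewrite /= !in_fsetU !in_fset1 eqxx orbT.
  rewrite eqxx => -[_ wj] _.
  have [] := H k _; first by rewrite /= !in_fsetU !in_fset1 eqxx !orbT.
  rewrite eqxx => _ wk.
  split; first by rewrite /near_event /= wi wj.
  by rewrite /= /D /F wi wj wk.
rewrite SE; have mI : measurable (\bigcap_(q in [set` J]) (f q @^-1` G q)).
  apply: fin_bigcap_measurable; first exact: finite_fset.
  by move=> q _; exact: RV_preimage_measurable.
have := @near_mod_bound _ _ _ P (f l) _ c L N z (law l) mI
  (fun B mB => family_indep ind lJ mG mB).
apply: outer_leS => // w [Iw nw]; split=> //=.
have [] := Iw k _; first by rewrite /= !in_fsetU !in_fset1 eqxx !orbT.
by rewrite eqxx => _ <-.
Qed.

(** * Almost sure absence of degenerate crossings *)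

Definition good (R : realType) (L : nat) (g : C01 R) : Prop :=
  lip_le L%:R g /\ forall s, `|g s| <= L%:R.

Lemma good_mono (R : realType) (L L' : nat) (g : C01 R) :
  (L <= L')%N -> good L g -> good L' g.
Proof.
move=> LL [lg bg]; have LL' : L%:R <= L'%:R :> R by rewrite ler_nat.
split=> [s t|s]; last exact: le_trans LL'.
by apply: (le_trans (lg s t)); rewrite ler_wpM2r.
Qed.

Lemma exists_good (R : realType) (g : C01 R) (L : nat) : lip_le L%:R g ->
  exists L', good L' g.
Proof.
move=> lg; have [M gM] := ev_bounded g.
exists (maxn L (Num.truncn M).+1); split=> [s t|s].
  by apply: (le_trans (lg s t)); rewrite ler_wpM2r// ler_nat leq_maxl.
apply: (le_trans (gM s)); apply: (@le_trans _ _ (Num.truncn M).+1%:R).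
  by rewrite ltW// truncnS_gt.
by rewrite ler_nat leq_maxr.
Qed.

Lemma negligible_good (d : measure_display) (T : measurableType d)
    (R : realType) (P : probability T R) (f : nat -> {RV P >-> C01_borel R})
    (s : seq nat) (A : set T) :
  (forall i : nat, is_PL_law (distribution P (f i))) ->
  (forall L : nat, P.-negligible (A `&` [set w | forall i, i \in s -> good L (f i w)])) ->
  P.-negligible A.
Proof.
move=> law H.
have N1 : P.-negligible (\bigcup_i (f i @^-1` ~` \bigcup_(L : nat) lip_le L%:R)).
  by apply: negligible_bigcup => i; exact: PL_law_lipschitz.
have N2 : P.-negligible (\bigcup_L (A `&` [set w | forall i, i \in s -> good L (f i w)])).
  exact: negligible_bigcup.
apply: negligibleS (negligibleU N1 N2) => w Aw.
have [lipw|nlip] := pselect (forall i, exists L : nat, lip_le L%:R (f i w)); last first.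
  by left; move/existsNP: nlip => [i ni]; exists i => // -[L _ lL]; apply: ni; exists L.
right; suff [L HL] : exists L, forall i, i \in s -> good L (f i w) by exists L.
elim: s {H N2} => [|i s [L HL]]; first by exists 0%N.
have [M] := lipw i; move=> /exists_good[L' gL'].
exists (maxn L L') => j; rewrite in_cons => /orP[/eqP ->|js].
  exact: good_mono (leq_maxr _ _) gL'.
exact: good_mono (leq_maxl _ _) (HL j js).
Qed.

Definition congruent_at (R : realType) (g h : C01 R) (t : I01 R) : Prop :=
  exists m : int, g t - h t = m%:~R.

Lemma good_near_event (d : measure_display) (T : measurableType d)
    (R : realType) (P : probability T R) (f : nat -> {RV P >-> C01_borel R})
    (L N : nat) (t c : I01 R) (i j : nat) (w : T) :
  good L (f i w) -> good L (f j w) -> congruent_at (f i w) (f j w) t ->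
  `|\val t - \val c| <= N.+1%:R^-1 -> near_event f L N c i j w.
Proof. by move=> [li bi] [lj bj] [m mE] tc; exact: near_mod_of_congruent mE tc. Qed.

Lemma grid_point (R : realType) (N : nat) (t : I01 R) :
  exists2 c, (c < N.+2)%N & 0 <= \val t - \val (clamp01 (c%:R / N.+1%:R)) <= N.+1%:R^-1.
Proof.
have [c cN /andP[c0 c1]] := @grid_cell R N (\val t) (I01_bound t).
exists c => //; rewrite val_clamp01; first by rewrite c0 ltW.
by rewrite divr_ge0//= ler_pdivrMr// mul1r ler_nat.
Qed.

(** A mesh [N.+1%:R^-1] has [N.+2] grid points, at most [2 * N.+1] of them: this is the factor 2. *)
Lemma grid_sum_le (R : realType) (N : nat) (C : R) : 0 <= C ->
  N.+2%:R * (N.+1%:R^-1 * (C / N.+1%:R)) <= 2 * C / N.+1%:R :> R.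
Proof.
move=> C0; rewrite mulrA [X in _ <= X](_ : _ = 2 * (C / N.+1%:R)); last by rewrite mulrA.
apply: ler_wpM2r; first by rewrite divr_ge0.
by rewrite ler_pdivrMr// -natrM ler_nat; lia.
Qed.

Lemma triple_crossing_null (d : measure_display) (T : measurableType d)
    (R : realType) (P : probability T R) (f : nat -> {RV P >-> C01_borel R})
    (i j k l : nat) :
  mutually_independent P (fun i : nat => sigma_of (f i)) ->
  (forall i : nat, is_PL_law (distribution P (f i))) -> i != j ->
  l != i -> l != j -> l != k ->
  P.-negligible [set w | exists t, congruent_at (f i w) (f j w) t /\
                                   congruent_at (f k w) (f l w) t].
Proof.
move=> ind law ij li lj lk; apply: (negligible_good (s := [:: i; j; k; l]) law) => L.
set C := mod_bound R L; have C0 : 0 <= C by exact: mod_bound_ge0.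
apply: (@negligible_outer_le _ _ _ _ _ (2 * (C * C))) => N.
have := @outer_le_bigcup_nat _ _ _ P
  (fun c => let c := clamp01 (c%:R / N.+1%:R) in
     near_event f L N c i j `&` near_event f L N c k l)
  N.+2 _ (fun c _ => triple_near_bound L N _ ind law ij li lj lk).
apply: outer_leS.
  move=> w [[t [tij tkl]] gw]; have [c cN /andP[c0 c1]] := grid_point N t.
  have tc : `|\val t - \val (clamp01 (c%:R / N.+1%:R))| <= N.+1%:R^-1 by rewrite ger0_norm.
  have gd q : q \in [:: i; j; k; l] -> good L (f q w) by exact: gw.
  exists c => //; split.
    by apply: (good_near_event _ _ tij tc); apply: gd; rewrite !inE eqxx ?orbT.
  by apply: (good_near_event _ _ tkl tc); apply: gd; rewrite !inE eqxx ?orbT.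
rewrite lee_fin; apply: le_trans (grid_sum_le N (mulr_ge0 C0 C0)).
by rewrite -/C le_eqVlt; apply/orP; left; apply/eqP; move: (N.+1%:R^-1 : R) => nu; ring.
Qed.

Lemma affine_onS (R : realType) (g : C01 R) (a b a' b' : R) :
  a <= a' -> b' <= b -> affine_on g a b -> affine_on g a' b'.
Proof.
move=> aa bb H x y z /andP[x1 x2] /andP[y1 y2] /andP[z1 z2].
by apply: H; rewrite (le_trans aa) ?(le_trans _ bb).
Qed.

Lemma kink_crossing_null (d : measure_display) (T : measurableType d)
    (R : realType) (P : probability T R) (f : nat -> {RV P >-> C01_borel R})
    (i j : nat) :
  mutually_independent P (fun i : nat => sigma_of (f i)) ->
  (forall i : nat, is_PL_law (distribution P (f i))) -> i != j ->
  P.-negligible [set w | exists t : I01 R, congruent_at (f i w) (f j w) t /\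
     forall e, 0 < e -> ~ affine_on (f i w) (\val t - e) (\val t + e)].
Proof.
move=> ind law ij; apply: (negligible_good (s := [:: i; j]) law) => L.
set C := mod_bound R L; have C0 : 0 <= C by exact: mod_bound_ge0.
apply: (@negligible_outer_le _ _ _ _ _ (2 * (3 * C))) => N.
have nu0 : 0 < N.+1%:R^-1 :> R by rewrite invr_gt0.
pose p (c : nat) : R := \val (clamp01 (c%:R / N.+1%:R : R)).
(* As [t] lies within one mesh to the right of [p c], this window contains the one of radius one
   mesh around [t]. Its three meshes are the origin of the factor 3. *)
pose A c : set (C01_borel R) := ~` [set g | affine_on g (p c - N.+1%:R^-1) (p c + 2 * N.+1%:R^-1)].
have mA c : measurable (A c) by apply: measurableC; exact: measurable_affine_on.
have := @outer_le_bigcup_nat _ _ _ P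
  (fun c => f i @^-1` A c `&` near_event f L N (clamp01 (c%:R / N.+1%:R)) i j) N.+2
  (3 * N.+1%:R^-1 * (C / N.+1%:R)).
set Q := outer_le _ _ _ => HQ; have {HQ} : Q.
  apply: HQ => c _; have := event_near_bound L N (clamp01 (c%:R / N.+1%:R)) ind law ij (mA c).
  apply: outer_leS => //; rewrite [leRHS]EFinM; apply: lee_wpmul2r.
    by rewrite lee_fin divr_ge0.
  apply: (le_trans (PL_law_not_affine (law i) _)).
    by move: (p c) (N.+1%:R^-1 : R) nu0; clear; move=> *; lra.
  by rewrite lee_fin le_eqVlt; apply/orP; left; apply/eqP; move: (N.+1%:R^-1 : R) => nu; ring.
apply: outer_leS.
  move=> w [[t [tij naff]] gw]; have [c cN] := grid_point N t.
  rewrite -/(p c) => /andP[c0 c1].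
  have tc : `|\val t - \val (clamp01 (c%:R / N.+1%:R))| <= N.+1%:R^-1 by rewrite ger0_norm.
  exists c => //; split; last first.
    by apply: (good_near_event _ _ tij tc); apply: gw; rewrite !inE eqxx ?orbT.
  move=> aff; apply: (naff _ nu0); apply: affine_onS aff.
    by move: (\val t) (p c) (N.+1%:R^-1 : R) c0 c1; clear; move=> *; lra.
  by move: (\val t) (p c) (N.+1%:R^-1 : R) c0 c1; clear; move=> *; lra.
rewrite lee_fin; apply: le_trans (grid_sum_le N (mulr_ge0 (ler0n R 3) C0)).
by rewrite le_eqVlt; apply/orP; left; apply/eqP; move: (N.+1%:R^-1 : R) => nu; ring.
Qed.

Lemma fixed_crossing_null (d : measure_display) (T : measurableType d)
    (R : realType) (P : probability T R) (f : nat -> {RV P >-> C01_borel R})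
    (i j : nat) (t : I01 R) :
  mutually_independent P (fun i : nat => sigma_of (f i)) ->
  (forall i : nat, is_PL_law (distribution P (f i))) -> i != j ->
  P.-negligible [set w | congruent_at (f i w) (f j w) t].
Proof.
move=> ind law ij; apply: (negligible_good (s := [:: i; j]) law) => L.
apply: (@negligible_outer_le _ _ _ _ _ (mod_bound R L)) => N.
have := pair_near_bound L N t ind law ij; apply: outer_leS => // w [wt gw].
apply: (good_near_event _ _ wt); rewrite ?subrr ?normr0 ?invr_ge0//.
  by apply: gw; rewrite mem_head.
by apply: gw; rewrite !inE eqxx orbT.
Qed.

Lemma negligible_bigcup_countable (d : measure_display) (T : measurableType d)
    (R : realType) (P : probability T R) (I : countType) (A : I -> set T) :
  (forall i, P.-negligible (A i)) -> P.-negligible (\bigcup_i A i).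
Proof.
move=> H; pose B n : set T := if choice.unpickle n is Some i then A i else set0.
have : P.-negligible (\bigcup_n B n).
  apply: negligible_bigcup => n; rewrite /B; case: choice.unpickle => [i|].
    exact: H.
  exact: negligible_set0.
apply: negligibleS => w [i _ Aw]; exists (choice.pickle i) => //.
by rewrite /B choice.pickleK.
Qed.

Lemma congruent_atC (R : realType) (g h : C01 R) (t : I01 R) :
  congruent_at g h t -> congruent_at h g t.
Proof. by move=> [m mE]; exists (- m); rewrite rmorphN /= -mE opprB. Qed.

Lemma cr_congruent (R : realType) (g h : C01 R) (x : R) :
  cr g h x -> 0 <= x <= 1 /\ congruent_at g h (clamp01 x).
Proof. by move=> /crP. Qed.

Lemma PL_regular_crossings (R : realType) (g h : C01 R) :
  ~ congruent_at g h (clamp01 0) -> ~ congruent_at g h (clamp01 1) ->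
  ~ (exists t, congruent_at g h t /\
      forall e, 0 < e -> ~ affine_on g (\val t - e) (\val t + e)) ->
  ~ (exists t, congruent_at h g t /\
      forall e, 0 < e -> ~ affine_on h (\val t - e) (\val t + e)) ->
  regular_crossings g h.
Proof.
move=> n0 n1 ng nh; split.
- by move=> /cr_congruent[_].
- by move=> /cr_congruent[_].
have aff (u v : C01 R) (t : R) :
    ~ (exists t, congruent_at u v t /\
      forall e, 0 < e -> ~ affine_on u (\val t - e) (\val t + e)) ->
    0 <= t <= 1 -> congruent_at u v (clamp01 t) ->
    exists2 e, 0 < e & affine_on u (t - e) (t + e).
  move=> nu t01 ct; apply: contrapT => H; apply: nu; exists (clamp01 t); split=> //.
  by move=> e e0; rewrite val_clamp01// => au; apply: H; exists e.
move=> t /cr_congruent[t01 ct].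
have [e e0 ae] := aff _ _ _ ng t01 ct.
have [r r0 ar] := aff _ _ _ nh t01 (congruent_atC ct).
have [q [q0 qe qr]] := exists_min2 e0 r0.
by exists q => //; split; [apply: affine_onS ae|apply: affine_onS ar]; lra.
Qed.

Theorem theorem7 (R : realType) (d : measure_display) (T : measurableType d)
    (P : probability T R) (f : nat -> {RV P >-> C01_borel R})
    (f_indep : mutually_independent P (fun i : nat => sigma_of (f i)))
    (f_law : forall i : nat, is_PL_law (distribution P (f i))) :
  {ae P, forall w : T, smoothly_dense [set f i w | i in [set: nat]]}.
Proof.
pose N1 := \bigcup_(p : nat * seq rat * nat)
  [set w | forall i, ~ near_pl p.1.1 (fun i => ratr p.1.2`_i) p.2.+1%:R^-1 (f i w)].
pose N2 := \bigcup_i (f i @^-1` ~` \bigcup_(L : nat) lip_le L%:R).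
pose N3 := \bigcup_(p : nat * nat * nat * nat)
  [set w | let: (i, j, k, l) := p in [/\ i != j, l != i, l != j & l != k] /\
    exists t, congruent_at (f i w) (f j w) t /\ congruent_at (f k w) (f l w) t].
pose N4 := \bigcup_(p : nat * nat) [set w | p.1 != p.2 /\
  exists t : I01 R, congruent_at (f p.1 w) (f p.2 w) t /\
     forall e, 0 < e -> ~ affine_on (f p.1 w) (\val t - e) (\val t + e)].
pose N5 := \bigcup_(p : nat * nat) [set w | p.1 != p.2 /\
  (congruent_at (f p.1 w) (f p.2 w) (clamp01 0) \/
   congruent_at (f p.1 w) (f p.2 w) (clamp01 1))].
have nN1 : P.-negligible N1.
  apply: negligible_bigcup_countable => -[[k s] q].
  by apply: near_pl_hit => //; rewrite invr_gt0.
have nN2 : P.-negligible N2.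
  by apply: negligible_bigcup => i; exact: PL_law_lipschitz.
have nN3 : P.-negligible N3.
  apply: negligible_bigcup_countable => -[[[i j] k] l].
  have [[ij li lj lk]|no] := pselect [/\ i != j, l != i, l != j & l != k].
    apply: negligibleS (triple_crossing_null f_indep f_law ij li lj lk).
    by move=> w [].
  by apply: negligibleS (negligible_set0 P) => w [].
have nN4 : P.-negligible N4.
  apply: negligible_bigcup_countable => -[i j].
  have [ij|ij] := pselect (is_true (i != j)); last first.
    by apply: negligibleS (negligible_set0 P) => w [].
  by apply: negligibleS (kink_crossing_null f_indep f_law ij) => w [].
have nN5 : P.-negligible N5.
  apply: negligible_bigcup_countable => -[i j].
  have [ij|ij] := pselect (is_true (i != j)); last first.
    by apply: negligibleS (negligible_set0 P) => w [].
  apply: negligibleS (negligibleU (fixed_crossing_null (clamp01 0) f_indep f_law ij)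
    (fixed_crossing_null (clamp01 1) f_indep f_law ij)).
  by move=> w [].
apply: negligibleS (negligibleU nN1 (negligibleU nN2 (negligibleU nN3
  (negligibleU nN4 nN5)))).
move=> w nsd; apply: contrapT => /not_orP[h1 /not_orP[h2 /not_orP[h3 /not_orP[h4 h5]]]].
apply: nsd; pose V : set (C01 R) := [set f i w | i in [set: nat]].
have hit k s q : exists2 g, V g & near_pl k (fun i => ratr s`_i) q.+1%:R^-1 g.
  apply: contrapT => H; apply: h1; exists (k, s, q) => // i fi.
  by apply: H; exists (f i w) => //; exists i.
have lipV g : V g -> lipschitz01 g.
  move=> [i _ <-]; apply: contrapT => H; apply: h2; exists i => // -[L _ lL].
  by apply: H; exists L%:R.
have reg i j : i != j -> regular_crossings (f i w) (f j w).
  move=> ij; apply: PL_regular_crossings.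
  - by move=> c; apply: h5; exists (i, j) => //; split=> //; left.
  - by move=> c; apply: h5; exists (i, j) => //; split=> //; right.
  - by move=> c; apply: h4; exists (i, j).
  - by move=> c; apply: h4; exists (j, i) => //; split=> //=; rewrite eq_sym.
have no3 i j k l t : i != j -> l != i -> l != j -> l != k ->
    congruent_at (f i w) (f j w) t -> ~ congruent_at (f k w) (f l w) t.
  by move=> ij li lj lk c1 c2; apply: h3; exists (i, j, k, l) => //; split=> //; exists t.
have neqi i j : f i w <> f j w -> i != j by move=> ij; apply/eqP => ijE; apply: ij; rewrite ijE.
have trV : transverse V.
  split=> [_ _ _ _ [i _ <-] [j _ <-] [k _ <-] [l _ <-] /neqi ij /neqi kl sneq|
           _ _ [i _ <-] [j _ <-] /neqi ij]; last first.
    have rij := reg _ _ ij; split.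
    - exact: regular_finite.
    - by case: rij.
    - by case: rij.
    - by move=> t; exact: regular_no_extremum.
  apply/seteqP; split=> // x [/cr_congruent[x01 c1] /cr_congruent[_ c2]].
  (* The pairs differ, so [k] or [l] is outside the first pair. That one takes the place of the free
     index, exchanging [k] and [l] if needed by the symmetry of congruence. *)
  have [li|li] := eqVneq l i; last first.
    have [lj|lj] := eqVneq l j; last first.
      by apply: (no3 i j k l) c1 c2 => //; rewrite eq_sym.
    have [ki|ki] := eqVneq k i; first by apply: sneq; rewrite ki lj.
    by apply: (no3 i j l k) c1 (congruent_atC c2) => //; rewrite -lj.
  have [kj|kj] := eqVneq k j; first by apply: sneq; rewrite kj li setUC.
  by apply: (no3 i j l k) c1 (congruent_atC c2) => //; rewrite -li.
have clause4 F (g : C01 R) (e : R) : finite_set F -> F `<=` V ->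
    transverse (F `|` [set g]) -> 0 < e ->
    exists h, [/\ V h, supnorm (g \- h) < e &
      forall u, F u -> u <> g -> sim e (cr g u) (cr h u)].
  move=> finF FV [tr1 tr2] e0.
  (* The function [g] may itself belong to [F], and its crossings with itself are not to be
     matched. *)
  have [||||k [s [q H]]] := @approx_crossings R g (F `\` [set g]) e _ _ _ _ e0.
  - exact: finite_setD.
  - by move=> u [Fu _]; apply/lipV/FV.
  - move=> u [Fu ug]; apply: tr2; [by right|by left|].
    by move=> gu; apply: ug.
  - move=> u v [Fu ug] [Fv vg] uv; apply: tr1;
      [by right|by left|by right|by left| by move=> gu; apply: ug| by move=> gv; apply: vg|].
    move=> E; have : [set g; v] u by rewrite -E; right.
    by case=> [|//]; exact: ug.
  have [h Vh hnear] := hit k s q; have [gh simh] := H h hnear.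
  by exists h; split=> // u Fu ug; apply: simh.
split; first exact: card_le_trans (card_image_le _ _) (countableP _).
split=> //.
(* Density is the last clause for the empty family, since a single function is transverse. *)
move=> g e e0; have [||||h [Vh gh _]] := clause4 set0 g e => //.
  by rewrite set0U; split=> [a b ? ? -> -> _ _ /(_ erefl)|a b -> -> /(_ erefl)].
by exists h.
Qed.
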